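(* Let $k$ be an algebraically closed field, let $A$ be a noetherian AS-Gorenstein Hopf $k$-algebra of finite global dimension $d$ with bijective antipode, and let $\nu$ be its Nakayama automorphism. Then: (a) $H_d(A,A^{\nu})\cong Z(A)\neq 0$, where $Z(A)$ is the centre of $A$. As a consequence, the twisted Hochschild dimension of $A$ equals $d$. (b) $H^d(A,{}^{\nu}A)\cong A/[A,A]\neq 0$, where $[A,A]$ is the $k$-span of $\{ab-ba : a,b\in A\}$. As a consequence, the twisted Hochschild cohomological dimension of $A$ equals $d$. (The isomorphisms are isomorphisms of $k$-vector spaces.)
   Context: Algebras are associative unital $k$-algebras; noetherian means left and right noetherian; $A^e=A\otimes_k A^{\mathrm{op}}$; $k$ also denotes the trivial module $A/\ker\epsilon$, $\epsilon$ the counit. AS-Gorenstein: a noetherian algebra $A$ with augmentation $\epsilon:A\to k$ is AS-Gorenstein (of injective dimension $d$) if (AS1) $\operatorname{injdim}({}_AA)=d<\infty$; (AS2) $\dim_k\operatorname{Ext}^d_A({}_Ak,{}_AA)=1$ and $\operatorname{Ext}^i_A({}_Ak,{}_AA)=0$ for all $i\ne d$; (AS3) the right-module versions hold. When the global dimension is finite it equals the injective dimension. Twisting: for a bimodule $M$ and algebra automorphisms $\sigma,\tau$, ${}^{\sigma}M^{\tau}$ is $M$ with $a\cdot m\cdot b=\sigma(a)m\tau(b)$; identity superscripts are omitted. Nakayama automorphism: an algebra automorphism $\nu$ of $A$ with $\operatorname{Ext}^i_{A^e}(A,A^e)=0$ for $i\neq d$ and $\operatorname{Ext}^d_{A^e}(A,A^e)\cong{}^1A^{\nu}$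 as $A$-bimodules. For the algebras considered here it exists, and it is unique up to composition with inner automorphisms. Hochschild (co)homology: $H_i(A,M)=\operatorname{Tor}_i^{A^e}(A,M)$ and $H^i(A,M)=\operatorname{Ext}^i_{A^e}(A,M)$. The twisted Hochschild dimension is $\max\{i : H_i(A,{}^{\sigma}A)\ne0 \text{ for some algebra automorphism }\sigma\text{ of }A\}$; the twisted Hochschild cohomological dimension is $\max\{i : H^i(A,{}^{\sigma}A)\ne0 \text{ for some algebra automorphism }\sigma\text{ of }A\}$. *)

(* Defs.v *)
From HB Require Import structures.
From mathcomp Require Import all_boot all_order all_algebra.
From mathcomp Require Import boolp classical_sets functions.
From mathcomp.multinomials Require Import freeg.

Set Implicit Arguments.
Unset Strict Implicit.
Unset Printing Implicit Defensive.
Import GRing.Theory.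
Local Open Scope ring_scope.
Local Open Scope quotient_scope.

Section SubQuot.
Variables (R : pzRingType) (V : lmodType R) (S : submodClosed V).

Record submod : Type := Submod { submod_val :> V; _ : submod_val \in S }.
HB.instance Definition _ := [isSub for submod_val].
HB.instance Definition _ := [Choice of submod by <:].
HB.instance Definition _ := [SubChoice_isSubLmodule of submod by <:].

Lemma submodN x : (- x \in S) = (x \in S).
Proof.
suff h y : y \in S -> - y \in S by apply/idP/idP => /h //; rewrite opprK.
by move=> yS; rewrite -scaleN1r rpredZ.
Qed.

Definition quot_rel : rel V := fun x y => x - y \in S.

Lemma quot_rel_refl : reflexive quot_rel.
Proof. by move=> x; rewrite /quot_rel subrr rpred0. Qed.
Lemma quot_rel_sym : symmetric quot_rel.
Proof. by move=> x y; rewrite /quot_rel -opprB submodN. Qed.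
Lemma quot_rel_trans : transitive quot_rel.
Proof.
by move=> y x z xy yz; rewrite /quot_rel -(subrKA y); apply: rpredD.
Qed.
Canonical quot_equiv := EquivRel quot_rel quot_rel_refl quot_rel_sym quot_rel_trans.

Definition quotmod : Type := {eq_quot quot_rel}.
HB.instance Definition _ := Choice.on quotmod.
HB.instance Definition _ : EqQuotient _ quot_rel quotmod := EqQuotient.on quotmod.

Definition quot_pi (x : V) : quotmod := \pi_quotmod x.
Definition quot_repr (x : quotmod) : V := repr x.

Lemma quot_reprK : cancel quot_repr quot_pi.
Proof. exact: reprK. Qed.
Lemma quot_piP x y : reflect (quot_pi x = quot_pi y) (x - y \in S).
Proof. by apply: (iffP idP) => [h|/eqmodP //]; apply/eqmodP. Qed.
Lemma quot_reprP x : quot_repr (quot_pi x) - x \in S.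
Proof. by apply/quot_piP; rewrite quot_reprK. Qed.

Definition quot_add x y := quot_pi (quot_repr x + quot_repr y).
Definition quot_opp x := quot_pi (- quot_repr x).
Definition quot_scale a x := quot_pi (a *: quot_repr x).

Lemma quot_piD x y : quot_add (quot_pi x) (quot_pi y) = quot_pi (x + y).
Proof.
by apply/quot_piP; rewrite opprD addrACA; apply: rpredD; apply: quot_reprP.
Qed.
Lemma quot_piZ a x : quot_scale a (quot_pi x) = quot_pi (a *: x).
Proof. by apply/quot_piP; rewrite -scalerBr; apply: rpredZ; apply: quot_reprP. Qed.
Lemma quot_piN x : quot_opp (quot_pi x) = quot_pi (- x).
Proof. by apply/quot_piP; rewrite -opprD submodN; apply: quot_reprP. Qed.

Lemma quot_addA : associative quot_add.
Proof.
move=> x y z; rewrite -(quot_reprK x) -(quot_reprK y) -(quot_reprK z).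
by rewrite !quot_piD addrA.
Qed.
Lemma quot_addC : commutative quot_add.
Proof. by move=> x y; rewrite /quot_add addrC. Qed.
Lemma quot_add0 : left_id (quot_pi 0) quot_add.
Proof. by move=> x; rewrite -(quot_reprK x) quot_piD add0r. Qed.
Lemma quot_addN : left_inverse (quot_pi 0) quot_opp quot_add.
Proof. by move=> x; rewrite -(quot_reprK x) quot_piN quot_piD addNr. Qed.
HB.instance Definition _ :=
  GRing.isZmodule.Build quotmod quot_addA quot_addC quot_add0 quot_addN.

Lemma quot_scaleA a b x : quot_scale a (quot_scale b x) = quot_scale (a * b) x.
Proof. by rewrite -(quot_reprK x) !quot_piZ scalerA. Qed.
Lemma quot_scale1 : left_id 1 quot_scale.
Proof. by move=> x; rewrite -(quot_reprK x) quot_piZ scale1r. Qed.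
Lemma quot_scaleDr : right_distributive quot_scale quot_add.
Proof.
move=> a x y; rewrite -(quot_reprK x) -(quot_reprK y).
by rewrite !(quot_piD, quot_piZ) scalerDr.
Qed.
Lemma quot_scaleDl x a b : quot_scale (a + b) x = quot_add (quot_scale a x) (quot_scale b x).
Proof. by rewrite -(quot_reprK x) !quot_piZ quot_piD scalerDl. Qed.
HB.instance Definition _ := GRing.Zmodule_isLmodule.Build R quotmod
  quot_scaleA quot_scale1 quot_scaleDr quot_scaleDl.

Lemma quot_pi_linear : linear quot_pi.
Proof. by move=> a x y; rewrite -quot_piD -quot_piZ. Qed.
HB.instance Definition _ := GRing.isLinear.Build R V quotmod *:%R quot_pi quot_pi_linear.
End SubQuot.

Definition ker (R : pzRingType) (V W : lmodType R) (f : {linear V -> W}) : {pred V} :=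
  fun x => f x == 0.
Lemma kerE (R : pzRingType) (V W : lmodType R) (f : {linear V -> W}) x :
  (x \in ker f) = (f x == 0).
Proof. by []. Qed.
Lemma ker_closed (R : pzRingType) (V W : lmodType R) (f : {linear V -> W}) :
  GRing.submod_closed (ker f).
Proof.
split=> [|a x y /eqP fx /eqP fy]; apply/eqP; first exact: linear0.
by rewrite linearP fx fy scaler0 addr0.
Qed.
HB.instance Definition _ (R : pzRingType) (V W : lmodType R) (f : {linear V -> W}) :=
  GRing.isSubmodClosed.Build R V (ker f) (GRing.submod_closed_semi (ker_closed f)).

Section Homology.
Variables (R : pzRingType) (X Y Z : lmodType R).
Variables (f : {linear X -> Y}) (g : {linear Y -> Z}).

Definition boundary : {pred submod (ker g)} := fun y => `[< exists x, f x = val y >].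
Lemma boundary_closed : GRing.submod_closed boundary.
Proof.
split=> [|a y z /asboolP[u fu] /asboolP[v fv]]; apply/asboolP.
  by exists 0; rewrite linear0.
by exists (a *: u + v); rewrite linearP fu fv.
Qed.
HB.instance Definition _ := GRing.isSubmodClosed.Build R (submod (ker g)) boundary
  (GRing.submod_closed_semi boundary_closed).

(* The boundaries are those elements of ker g that f hits; no hypothesis
   g \o f = 0 is needed for the quotient to make sense. *)
Definition homology : lmodType R := quotmod boundary.
End Homology.
Arguments boundary {R X Y Z} f g.

Section HomologyMap.
Variables (R : pzRingType) (X Y Z X' Y' Z' : lmodType R).
Variables (f : {linear X -> Y}) (g : {linear Y -> Z}).
Variables (f' : {linear X' -> Y'}) (g' : {linear Y' -> Z'}) (h : {linear Y -> Y'}).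
Hypothesis hg : forall y, g y = 0 -> g' (h y) = 0.

Lemma cycle_map_subproof (y : submod (ker g)) : h (val y) \in ker g'.
Proof. by have /eqP gy := valP y; apply/eqP/hg. Qed.
Definition cycle_map (y : submod (ker g)) : submod (ker g') :=
  Submod (cycle_map_subproof y).
Definition homology_map (y : homology f g) : homology f' g' :=
  quot_pi (boundary f' g') (cycle_map (quot_repr y)).
End HomologyMap.

Section FreeModule.
Variables (R : nzRingType) (T : choiceType) (M : lmodType R) (f : T -> M).

Definition free_lift (x : {freeg T / R}) : M := fglift f x.

HB.instance Definition _ := GRing.isZmodMorphism.Build {freeg T / R} M free_lift
  (lift_is_additive f).
Lemma free_liftU a v : free_lift << a *g v >> = a *: f v.
Proof. exact: liftU. Qed.
Lemma free_liftE x : free_lift x = \sum_(v <- dom x) coeff v x *: f v.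
Proof.
rewrite -[in LHS](freeg_sumE x) raddf_sum.
by apply: eq_bigr => v _; rewrite /= free_liftU.
Qed.
Lemma free_lift_scalable : scalable free_lift.
Proof.
move=> a x; have -> : a *: x = \sum_(v <- dom x) << a * coeff v x *g v >> by [].
rewrite raddf_sum free_liftE scaler_sumr.
by apply: eq_bigr => v _; rewrite /= free_liftU scalerA.
Qed.
HB.instance Definition _ := GRing.isScalable.Build R {freeg T / R} M *:%R free_lift
  free_lift_scalable.
End FreeModule.

(* A module over a k-algebra R is a k-vector space through c |-> c%:A. *)
Section Restrict.
Variables (k : comNzRingType) (R : algType k) (M : lmodType R).

Definition restrict : Type := M.
HB.instance Definition _ := GRing.Zmodule.on restrict.

Definition restrict_scale (c : k) (m : restrict) : restrict := (c%:A : R) *: (m : M).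
Lemma restrict_scaleA a b m :
  restrict_scale a (restrict_scale b m) = restrict_scale (a * b) m.
Proof. by rewrite /restrict_scale scalerA -scalerAl mul1r scalerA. Qed.
Lemma restrict_scale1 : left_id 1 restrict_scale.
Proof. by move=> m; rewrite /restrict_scale !scale1r. Qed.
Lemma restrict_scaleDr : right_distributive restrict_scale +%R.
Proof. by move=> a m n; rewrite /restrict_scale scalerDr. Qed.
Lemma restrict_scaleDl m : {morph restrict_scale^~ m : a b / a + b}.
Proof. by move=> a b; rewrite /restrict_scale !scalerDl. Qed.
HB.instance Definition _ := GRing.Zmodule_isLmodule.Build k restrict
  restrict_scaleA restrict_scale1 restrict_scaleDr restrict_scaleDl.
End Restrict.

Section Hom.
Variables (k : comNzRingType) (R : algType k).
Implicit Types M N : lmodType R.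

Definition is_hom M N : {pred M -> restrict N} :=
  fun f => `[< linear (f : M -> N) >].
Lemma is_hom_closed M N : GRing.submod_closed (@is_hom M N).
Proof.
split=> [|c f g /asboolP hf /asboolP hg]; apply/asboolP => a x y.
  by rewrite scaler0 addr0.
have E z : (c *: f + g) z = c%:A *: (f z : N) + (g z : N) :> N by [].
rewrite !E hf hg !scalerDr !addrA; congr (_ + _); rewrite -!addrA; congr (_ + _).
  by rewrite !scalerA -scalerAl -scalerAr mul1r mulr1.
by rewrite addrC.
Qed.
HB.instance Definition _ M N := GRing.isSubmodClosed.Build k (M -> restrict N)
  (@is_hom M N) (GRing.submod_closed_semi (@is_hom_closed M N)).

Definition hom M N : lmodType k := submod (@is_hom M N).
Definition hom_fun M N (f : hom M N) : M -> N := val f.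

Lemma hom_linear M N (f : hom M N) : linear (hom_fun f).
Proof. by have /asboolP := valP f. Qed.

Lemma precomp_subproof M M' N (g : {linear M' -> M}) (f : hom M N) :
  (hom_fun f \o g : M' -> restrict N) \in @is_hom M' N.
Proof. by apply/asboolP => a x y /=; rewrite linearP hom_linear. Qed.
Definition precomp M M' N (g : {linear M' -> M}) (f : hom M N) : hom M' N :=
  Submod (precomp_subproof g f).
Lemma precomp_linear M M' N (g : {linear M' -> M}) : linear (@precomp M M' N g).
Proof. by move=> a f f'; apply/val_inj/funext. Qed.
HB.instance Definition _ M M' N (g : {linear M' -> M}) :=
  GRing.isLinear.Build k (hom M N) (hom M' N) *:%R (precomp g) (@precomp_linear M M' N g).

Lemma postcomp_subproof M N N' (g : {linear N -> N'}) (f : hom M N) :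
  (g \o hom_fun f : M -> restrict N') \in @is_hom M N'.
Proof. by apply/asboolP => a x y /=; rewrite hom_linear linearP. Qed.
Definition postcomp M N N' (g : {linear N -> N'}) (f : hom M N) : hom M N' :=
  Submod (postcomp_subproof g f).
Lemma postcomp_linear M N N' (g : {linear N -> N'}) : linear (@postcomp M N N' g).
Proof. by move=> a f f'; apply/val_inj/funext => x; apply: linearP. Qed.
HB.instance Definition _ M N N' (g : {linear N -> N'}) :=
  GRing.isLinear.Build k (hom M N) (hom M N') *:%R (postcomp g) (@postcomp_linear M N N' g).
End Hom.

Record chain (R : pzRingType) := Chain {
  chain_ob :> nat -> lmodType R;
  chain_d : forall n, {linear chain_ob n.+1 -> chain_ob n} }.

Record cochain (R : pzRingType) := Cochain {
  cochain_ob :> nat -> lmodType R;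
  cochain_d : forall n, {linear cochain_ob n -> cochain_ob n.+1} }.

Definition surjective (T U : Type) (f : T -> U) := forall y, exists x, f x = y.

Definition exact_at (T : Type) (V W : zmodType) (f : T -> V) (g : V -> W) :=
  forall y, g y = 0 <-> exists x, f x = y.

Definition is_zero_module (V : zmodType) := forall x : V, x = 0.

Definition projective (R : pzRingType) (P : lmodType R) :=
  forall (M N : lmodType R) (g : {linear M -> N}) (f : {linear P -> N}),
    surjective g -> exists h : {linear P -> M}, forall x, g (h x) = f x.

Definition injective_mod (R : pzRingType) (E : lmodType R) :=
  forall (M N : lmodType R) (g : {linear M -> N}) (f : {linear M -> E}),
    injective g -> exists h : {linear N -> E}, forall x, h (g x) = f x.

Record proj_resolution (R : pzRingType) (M : lmodType R) (P : chain R)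
    (e : {linear P 0%N -> M}) : Prop := ProjResolution {
  proj_res_projective : forall n, projective (P n);
  proj_res_surj : surjective e;
  proj_res_exact0 : exact_at (chain_d P 0) e;
  proj_res_exact : forall n, exact_at (chain_d P n.+1) (chain_d P n) }.

Record inj_resolution (R : pzRingType) (M : lmodType R) (E : cochain R)
    (e : {linear M -> E 0%N}) : Prop := InjResolution {
  inj_res_injective : forall n, injective_mod (E n);
  inj_res_inj : injective e;
  inj_res_exact0 : exact_at e (cochain_d E 0);
  inj_res_exact : forall n, exact_at (cochain_d E n) (cochain_d E n.+1) }.

Definition projdim_le (R : pzRingType) (M : lmodType R) (n : nat) :=
  exists (P : chain R) (e : {linear P 0%N -> M}),
    proj_resolution e /\ forall i, (n < i)%N -> is_zero_module (P i).

Definition injdim_le (R : pzRingType) (M : lmodType R) (n : nat) :=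
  exists (E : cochain R) (e : {linear M -> E 0%N}),
    inj_resolution e /\ forall i, (n < i)%N -> is_zero_module (E i).

Definition injdim_eq (R : pzRingType) (M : lmodType R) (n : nat) :=
  injdim_le M n /\ forall m, injdim_le M m -> (n <= m)%N.

(* Global dimension of left modules; for a noetherian ring it agrees with the
   one of right modules. *)
Definition gldim_eq (R : pzRingType) (n : nat) :=
  (forall M : lmodType R, projdim_le M n) /\
  forall m, (forall M : lmodType R, projdim_le M m) -> (n <= m)%N.

Definition left_noetherian (R : nzRingType) :=
  forall I : submodClosed R^o, exists s : seq R, forall x : R,
    x \in I <-> exists c : 'I_(size s) -> R, x = \sum_i c i * s`_i.

(* The functorial free resolution: F_0 is free on the underlying set of M and
   F_(n+1) is free on the underlying set of the kernel of F_n -> syzygy n.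
   Ext and Tor are computed from it; std_res_proj shows that it is a
   projective resolution. *)
Section StandardResolution.
Variables (R : nzRingType) (M : lmodType R).

Definition free_cover (N : lmodType R) : {linear {freeg N / R} -> N} := free_lift id.

Fixpoint syzygy (n : nat) : lmodType R :=
  if n is m.+1 then submod (ker (free_cover (syzygy m))) else M.

Definition std_d n : {freeg (syzygy n.+1) / R} -> {freeg (syzygy n) / R} :=
  val \o free_cover (syzygy n.+1).
HB.instance Definition _ n := GRing.Linear.on (@std_d n).

Definition std_res : chain R :=
  @Chain R (fun n => {freeg (syzygy n) / R} : lmodType R) (fun n => @std_d n).

Lemma free_cover_surj N : surjective (free_cover N).
Proof. by move=> x; exists << x >>; rewrite /= free_liftU scale1r. Qed.

Lemma free_projective (T : choiceType) : projective ({freeg T / R} : lmodType R).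
Proof.
move=> X Y g f gs; have [s sP] := choice (fun t : T => gs (f << t >>)).
exists (free_lift s) => x; rewrite -(freeg_sumE x) !raddf_sum.
apply: eq_bigr => t _; rewrite /= free_liftU linearZ sP -linearZ; congr (f _).
by apply/eqP/freeg_eqP => u; rewrite coeffZ !coeffU mul1r.
Qed.

Lemma std_res_proj : @proj_resolution R M std_res (free_cover M).
Proof.
split=> [n||y|n y]; [exact: free_projective|exact: free_cover_surj| |].
- split=> [y0|[x <-]]; last by apply/eqP/(valP (free_cover (syzygy 1) x)).
  have yk : y \in ker (free_cover M) by apply/eqP.
  have [x xy] := free_cover_surj (Submod yk : syzygy 1).
  by exists x; rewrite /= /std_d /= xy.
- have dE x : chain_d std_res n x = val (free_cover (syzygy n.+1) x) by [].
  split=> [|[x <-]]; rewrite dE.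
    move=> y0; have yk : y \in ker (free_cover (syzygy n.+1)).
      by apply/eqP/val_inj.
    have [x xy] := free_cover_surj (Submod yk : syzygy n.+2).
    by exists x; rewrite /= /std_d /= xy.
  by have /eqP := valP (free_cover (syzygy n.+2) x) => /= ->.
Qed.
End StandardResolution.

Section Ext.
Variables (k : comNzRingType) (R : algType k).

Definition hom_out (P : chain R) (N : lmodType R) i : {linear hom (P i) N -> hom (P i.+1) N} :=
  precomp (chain_d P i).
(* The incoming differential in degree 0 is zero: its source is a placeholder
   for the zero module in degree -1. *)
Definition hom_in (P : chain R) (N : lmodType R) i : {linear hom (P i.-1) N -> hom (P i) N} :=
  match i return {linear hom (P i.-1) N -> hom (P i) N} with
  | 0 => \0
  | j.+1 => hom_out P N j
  end.

Definition ext (M N : lmodType R) i : lmodType k :=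
  homology (hom_in (std_res M) N i) (hom_out (std_res M) N i).

Lemma ext_map_subproof (P : chain R) (N N' : lmodType R) (g : {linear N -> N'}) i f :
  hom_out P N i f = 0 -> hom_out P N' i (postcomp g f) = 0.
Proof.
move=> hf; have -> : hom_out P N' i (postcomp g f) = postcomp g (hom_out P N i f).
  exact: val_inj.
by rewrite hf linear0.
Qed.
Definition ext_map (M N N' : lmodType R) (g : {linear N -> N'}) i : ext M N i -> ext M N' i :=
  homology_map (hom_in (std_res M) N' i)
    (@ext_map_subproof (std_res M) N N' g i).
End Ext.

(* Tensor product of M and N over a family S acting on M by r and on N by l.
   Elements are formal sums of pairs; two sums are identified when every
   biadditive S-balanced map takes the same value on them, which builds in the
   universal property. The scalars k act through N. This covers both the tensor
   product over k (S = k) and M (x)_R N for a noncommutative R (S = R). *)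
Section Tensor.
Variables (k : pzRingType) (M : zmodType) (N : lmodType k) (S : Type).
Variables (r : S -> {additive M -> M}) (l : S -> {linear N -> N}).

Definition balanced (W : zmodType) (f : M -> N -> W) :=
  [/\ forall m m' n, f (m + m') n = f m n + f m' n,
      forall m n n', f m (n + n') = f m n + f m n' &
      forall s m n, f (r s m) n = f m (l s n)].

Definition sum_eval (W : zmodType) (f : M -> N -> W) (x : seq (M * N)) : W :=
  \sum_(p <- x) f p.1 p.2.

Definition tensor_rel : rel (seq (M * N)) := fun x y =>
  `[< forall (W : zmodType) (f : M -> N -> W), balanced f -> sum_eval f x = sum_eval f y >].

Lemma tensor_rel_refl : reflexive tensor_rel.
Proof. by move=> x; apply/asboolP. Qed.
Lemma tensor_rel_sym : symmetric tensor_rel.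
Proof. by move=> x y; apply/asboolP/asboolP => h W f /h. Qed.
Lemma tensor_rel_trans : transitive tensor_rel.
Proof.
move=> y x z /asboolP h /asboolP h'; apply/asboolP => W f hf.
by rewrite (h _ _ hf) h'.
Qed.
Canonical tensor_equiv :=
  EquivRel tensor_rel tensor_rel_refl tensor_rel_sym tensor_rel_trans.

Definition tensor : Type := {eq_quot tensor_rel}.
HB.instance Definition _ := Choice.on tensor.
HB.instance Definition _ : EqQuotient _ tensor_rel tensor := EqQuotient.on tensor.

Definition tsum (x : seq (M * N)) : tensor := \pi_tensor x.
Definition tens (m : M) (n : N) : tensor := tsum [:: (m, n)].
Definition tlift (W : zmodType) (f : M -> N -> W) (t : tensor) : W := sum_eval f (repr t).

Lemma tsumP x y : (forall (W : zmodType) (f : M -> N -> W), balanced f ->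
  sum_eval f x = sum_eval f y) <-> tsum x = tsum y.
Proof.
by split=> [h|/eqmodP/asboolP //]; apply/eqmodP/asboolP.
Qed.
Lemma tlift_sum (W : zmodType) (f : M -> N -> W) x :
  balanced f -> tlift f (tsum x) = sum_eval f x.
Proof. by apply: (tsumP _ _).2; rewrite /tsum reprK. Qed.

Definition tadd (t u : tensor) := tsum (repr t ++ repr u).
Definition topp (t : tensor) := tsum [seq (- p.1, p.2) | p <- repr t].
Definition tscale (c : k) (t : tensor) := tsum [seq (p.1, c *: p.2) | p <- repr t].

Lemma tsum_surj t : t = tsum (repr t).
Proof. by rewrite /tsum reprK. Qed.
Lemma tsumD x y : tadd (tsum x) (tsum y) = tsum (x ++ y).
Proof.
apply/tsumP => W f hf; rewrite /sum_eval !big_cat /=.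
by rewrite -!/(sum_eval f _) -!/(tlift f _) !tlift_sum.
Qed.

Lemma balancedN (W : zmodType) (f : M -> N -> W) m n : balanced f -> f (- m) n = - f m n.
Proof.
case=> fD _ _; apply/eqP; rewrite -addr_eq0 -fD addNr.
by rewrite -[X in X == _](addrK (f 0 n)) -fD addr0 subrr.
Qed.
Lemma sum_evalN (W : zmodType) (f : M -> N -> W) x : balanced f ->
  sum_eval f [seq (- p.1, p.2) | p <- x] = - sum_eval f x.
Proof.
move=> hf; rewrite /sum_eval big_map -sumrN; apply: eq_bigr => p _ /=.
exact: balancedN.
Qed.
Lemma tsumN x : topp (tsum x) = tsum [seq (- p.1, p.2) | p <- x].
Proof.
by apply/tsumP => W f hf; rewrite !sum_evalN // -!/(tlift f _) !tlift_sum.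
Qed.

Lemma balancedZ (W : zmodType) (f : M -> N -> W) c : balanced f ->
  balanced (fun m n => f m (c *: n)).
Proof.
case=> f1 f2 f3; split=> [m m' n|m n n'|s m n].
- by rewrite f1.
- by rewrite scalerDr f2.
- by rewrite f3 linearZ.
Qed.
Lemma tsumZ c x : tscale c (tsum x) = tsum [seq (p.1, c *: p.2) | p <- x].
Proof.
apply/tsumP => W f /(balancedZ c) hf; rewrite /sum_eval !big_map /=.
by rewrite -!/(sum_eval (fun m n => f m (c *: n)) _) -!/(tlift _ _) !tlift_sum.
Qed.

Lemma tadd_assoc : associative tadd.
Proof.
by move=> t u v; rewrite (tsum_surj t) (tsum_surj u) (tsum_surj v) !tsumD catA.
Qed.
Lemma tadd_comm : commutative tadd.
Proof.
move=> t u; apply/tsumP => W f _; rewrite /sum_eval !big_cat /=; exact: addrC.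
Qed.
Lemma tadd0 : left_id (tsum [::]) tadd.
Proof. by move=> t; rewrite (tsum_surj t) tsumD. Qed.
Lemma taddN : left_inverse (tsum [::]) topp tadd.
Proof.
move=> t; rewrite (tsum_surj t) tsumN tsumD; apply/tsumP => W f hf.
by rewrite /sum_eval big_cat /= -!/(sum_eval f _) sum_evalN // addNr /sum_eval big_nil.
Qed.
HB.instance Definition _ := GRing.isZmodule.Build tensor tadd_assoc tadd_comm tadd0 taddN.

Lemma tscaleA a b t : tscale a (tscale b t) = tscale (a * b) t.
Proof.
rewrite (tsum_surj t) !tsumZ -map_comp; congr tsum; apply: eq_map => p /=.
by rewrite scalerA.
Qed.
Lemma tscale1 : left_id 1 tscale.
Proof.
move=> t; rewrite (tsum_surj t) !tsumZ; congr tsum.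
by rewrite -[RHS]map_id; apply: eq_map => -[m n] /=; rewrite scale1r.
Qed.
Lemma tscaleDr : right_distributive tscale tadd.
Proof.
by move=> c t u; rewrite (tsum_surj t) (tsum_surj u) !(tsumD, tsumZ) map_cat.
Qed.
Lemma tscaleDl t a b : tscale (a + b) t = tadd (tscale a t) (tscale b t).
Proof.
rewrite (tsum_surj t) !(tsumZ, tsumD); apply/tsumP => W f [_ fD _].
rewrite /sum_eval big_cat !big_map /= -big_split /=.
by apply: eq_bigr => p _; rewrite scalerDl fD.
Qed.
HB.instance Definition _ := GRing.Zmodule_isLmodule.Build k tensor
  tscaleA tscale1 tscaleDr tscaleDl.

Lemma tensDl m m' n : tens (m + m') n = tens m n + tens m' n.
Proof.
rewrite [RHS]tsumD; apply/tsumP => W f [fD _ _].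
by rewrite /sum_eval big_cat !big_seq1 fD.
Qed.
Lemma tensDr m n n' : tens m (n + n') = tens m n + tens m n'.
Proof.
rewrite [RHS]tsumD; apply/tsumP => W f [_ fD _].
by rewrite /sum_eval big_cat !big_seq1 fD.
Qed.
Lemma tens_bal s m n : tens (r s m) n = tens m (l s n).
Proof.
by apply/tsumP => W f [_ _ fS]; rewrite /sum_eval !big_seq1 fS.
Qed.
Lemma tens_balanced : balanced tens.
Proof. by split; [apply: tensDl|apply: tensDr|apply: tens_bal]. Qed.
Lemma tensZr c m n : tens m (c *: n) = c *: tens m n.
Proof. by rewrite [RHS]tsumZ. Qed.

Lemma tensE t : t = \sum_(p <- repr t) tens p.1 p.2.
Proof.
rewrite {1}(tsum_surj t); elim: (repr t) => [|[m n] x IHx]; first by rewrite big_nil.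
by rewrite big_cons -IHx /= [RHS]tsumD.
Qed.
Lemma tensor_ind (P : tensor -> Prop) :
  P 0 -> (forall m n t, P t -> P (tens m n + t)) -> forall t, P t.
Proof.
move=> P0 PD t; rewrite (tensE t).
by elim: (repr t) => [|p x IHx]; rewrite ?big_nil // big_cons; apply: PD.
Qed.

Lemma tliftE (W : zmodType) (f : M -> N -> W) m n :
  balanced f -> tlift f (tens m n) = f m n.
Proof. by move=> hf; rewrite tlift_sum // /sum_eval big_seq1. Qed.
Lemma tlift0 (W : zmodType) (f : M -> N -> W) : balanced f -> tlift f 0 = 0.
Proof. by move=> hf; rewrite tlift_sum // /sum_eval big_nil. Qed.
Lemma tliftD (W : zmodType) (f : M -> N -> W) t u :
  balanced f -> tlift f (t + u) = tlift f t + tlift f u.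
Proof.
move=> hf; rewrite (tsum_surj t) (tsum_surj u) [_ + _ as X in tlift _ X]tsumD.
by rewrite !tlift_sum // /sum_eval big_cat.
Qed.
Lemma tlift_scale (W : lmodType k) (f : M -> N -> W) :
  balanced f -> (forall c m n, f m (c *: n) = c *: f m n) ->
  forall c t, tlift f (c *: t) = c *: tlift f t.
Proof.
move=> hf fZ c; elim/tensor_ind => [|m n t IHt]; first by rewrite scaler0 tlift0 // scaler0.
by rewrite scalerDr !tliftD // scalerDr IHt -tensZr !tliftE // fZ.
Qed.
Lemma tlift_linear (W : lmodType k) (f : M -> N -> W) :
  balanced f -> (forall c m n, f m (c *: n) = c *: f m n) -> linear (tlift f).
Proof. by move=> hf fZ c t u; rewrite tliftD // tlift_scale. Qed.
Lemma tlift_ext (W : zmodType) (f g : M -> N -> W) :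
  (forall m n, f m n = g m n) -> tlift f =1 tlift g.
Proof. by move=> fg t; apply: eq_bigr => p _; apply: fg. Qed.
End Tensor.

(* Used only to see that the tensor product of two nonzero algebras over a
   field is nonzero, as algType requires. *)
Section Functional.
Variables (k : fieldType) (V : lmodType k) (v : V).
Local Open Scope classical_set_scope.

Let P (A : set V) := (forall a x y, A x -> A y -> A (a *: x + y)) /\ ~ A v.

Let max_subspace : v <> 0 ->
  exists A : set V, [/\ P A, A 0 & forall u, exists c : k, A (u - c *: v)].
Proof.
move=> v0.
have [F FP totF|A [[AL Av] maxA]] := @Zorn_bigcup V P.
  split=> [a x y [X FX Xx] [Y FY Yy]|[X FX Xv]]; last by case: (FP _ FX).
  have [XY|YX] := totF _ _ FX FY.
    by exists Y => //; apply: (FP _ FY).1 => //; apply: XY.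
  by exists X => //; apply: (FP _ FX).1 => //; apply: YX.
have A0 : A 0.
  apply: contrapT => nA0; apply: (maxA (A `|` [set 0])).
    by split=> [x|/(_ 0)]; [left|move=> h; apply/nA0/h; right].
  split=> [a x y [Ax|->] [Ay|->]|[//|//]].
  - by left; apply: AL.
  - have [->|a0] := eqVneq a 0; first by right; rewrite scale0r addr0.
    left; rewrite (_ : a *: x + 0 = (a - 1) *: x + x); first exact: AL.
    by rewrite scalerBl scale1r subrK addr0.
  - by left; rewrite scaler0 add0r.
  - by right; rewrite scaler0 addr0.
exists A; split=> // u; apply: contrapT => /forallNP nu.
pose B : set V := [set y | exists c, A (y - c *: u)].
have Bv : ~ B v.
  move=> [c Ac]; have [c0|c0] := eqVneq c 0.
    by apply: Av; rewrite c0 scale0r subr0 in Ac.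
  apply: (nu c^-1); have := AL (- c^-1) _ _ Ac A0.
  by rewrite addr0 scalerBr !scaleNr scalerA mulVf // scale1r opprK addrC.
apply: (maxA B); last first.
  split=> // a x y [c Ac] [c' Ac']; exists (a * c + c').
  have := AL a _ _ Ac Ac'; congr A.
  by rewrite scalerBr scalerA addrACA -opprD -scalerDl.
split=> [x Ax|BA]; first by exists 0; rewrite scale0r subr0.
apply: (nu 0); rewrite scale0r subr0; apply: BA.
by exists 1; rewrite scale1r subrr.
Qed.

Lemma exists_functional : v <> 0 -> exists f : {linear V -> k^o}, f v = 1.
Proof.
move=> v0; have [A [[AL Av] A0 Au]] := max_subspace v0.
have [f fP] := choice Au.
have uniq u c : A (u - c *: v) -> f u = c.
  move=> Ac; apply/eqP; rewrite -subr_eq0; apply: contrapT => /negP fc; apply: Av.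
  have := AL (-1) _ _ (fP u) Ac.
  rewrite scaleN1r opprB addrA subrK -scalerBl => Afc.
  by have := AL (f u - c)^-1 _ _ Afc A0; rewrite addr0 scalerA mulVf // scale1r.
have fL : linear (f : V -> k^o).
  move=> a x y; apply: uniq; have := AL a _ _ (fP x) (fP y); congr A.
  by rewrite scalerBr scalerA addrACA -opprD -scalerDl.
pose F : {linear V -> k^o} := HB.pack (f : V -> k^o) (GRing.isLinear.Build k V k^o *:%R (f : V -> k^o) fL).
by exists F; apply: uniq; rewrite scale1r subrr.
Qed.
End Functional.

Section Converse.
Variables (k : comNzRingType) (A : algType k).
HB.instance Definition _ := GRing.Lmodule.copy A^c A.
Let converse_scaleAl (a : k) (u v : A^c) : a *: (u * v) = @GRing.mul A^c (a *: u) v.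
Proof. exact: (@scalerAr k A a v u). Qed.
HB.instance Definition _ := GRing.Lmodule_isLalgebra.Build k A^c converse_scaleAl.
Let converse_scaleAr (a : k) (u v : A^c) : a *: (u * v) = @GRing.mul A^c u (a *: v).
Proof. exact: (@scalerAl k A a v u). Qed.
HB.instance Definition _ := GRing.Lalgebra_isAlgebra.Build k A^c converse_scaleAr.
End Converse.

Section VTensor.
Variables (k : comNzRingType) (V W : lmodType k).
Definition scale_act (U : lmodType k) (c : k) : {linear U -> U} := *:%R c.

Definition vtensor : Type := tensor (fun c => scale_act V c) (fun c => scale_act W c).
HB.instance Definition _ := GRing.Lmodule.on vtensor.

Definition vtens (v : V) (w : W) : vtensor := tens _ _ v w.
Definition vlift (U : zmodType) (f : V -> W -> U) (t : vtensor) : U := tlift f t.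
End VTensor.

Section VTensorTheory.
Variables (k : comNzRingType) (V W : lmodType k).

Definition vbalanced (U : zmodType) (f : V -> W -> U) :=
  balanced (fun c => scale_act V c) (fun c => scale_act W c) f.

Lemma vtensDl (v v' : V) (w : W) : vtens (v + v') w = vtens v w + vtens v' w.
Proof. exact: tensDl. Qed.
Lemma vtensDr (v : V) (w w' : W) : vtens v (w + w') = vtens v w + vtens v w'.
Proof. exact: tensDr. Qed.
Lemma vtensZr c (v : V) (w : W) : vtens v (c *: w) = c *: vtens v w.
Proof. exact: tensZr. Qed.
Lemma vtensZl c (v : V) (w : W) : vtens (c *: v) w = c *: vtens v w.
Proof. by rewrite -vtensZr; apply: tens_bal. Qed.
Lemma vliftE (U : zmodType) (f : V -> W -> U) v w : vbalanced f -> vlift f (vtens v w) = f v w.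
Proof. exact: tliftE. Qed.
Lemma vlift0 (U : zmodType) (f : V -> W -> U) : vbalanced f -> vlift f 0 = 0.
Proof. exact: tlift0. Qed.
Lemma vliftD (U : zmodType) (f : V -> W -> U) t u :
  vbalanced f -> vlift f (t + u) = vlift f t + vlift f u.
Proof. by move=> hf; apply: tliftD. Qed.
Lemma vtensor_ind (P : vtensor V W -> Prop) :
  P 0 -> (forall v w t, P t -> P (vtens v w + t)) -> forall t, P t.
Proof. exact: tensor_ind. Qed.
End VTensorTheory.

Section TensorAlgebra.
Variables (k : fieldType) (A B : algType k).
Local Notation AB := (vtensor A B).

Let inner (a : A) (b : B) (a' : A) (b' : B) : AB := vtens (a * a') (b * b').
Let outer (t : AB) (a : A) (b : B) : AB := vlift (inner a b) t.

Let inner_bal a b : vbalanced (inner a b).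
Proof.
rewrite /inner; split=> [x x' y|x y y'|c x y].
- by rewrite mulrDr vtensDl.
- by rewrite mulrDr vtensDr.
- by rewrite /= -!scalerAr vtensZl vtensZr.
Qed.
Let outer_tens a' b' a b : outer (vtens a' b') a b = vtens (a * a') (b * b').
Proof. exact: vliftE. Qed.
Let outer0 a b : outer 0 a b = 0.
Proof. exact: vlift0. Qed.
Let outerD t u a b : outer (t + u) a b = outer t a b + outer u a b.
Proof. exact: vliftD. Qed.
Let outer_bal t : vbalanced (outer t).
Proof.
split=> [x x' y|x y y'|c x y]; elim/vtensor_ind: t => [|a b t IHt];
  rewrite ?outer0 ?addr0 // !outerD !outer_tens IHt.
- by rewrite mulrDl vtensDl addrACA.
- by rewrite mulrDl vtensDr addrACA.
- by rewrite /= -!scalerAl vtensZl vtensZr.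
Qed.

Definition tensor_mul (t u : AB) : AB :=
  vlift (fun a b => vlift (fun a' b' => vtens (a * a') (b * b')) u) t.
Definition tensor_one : AB := vtens 1 1.

Lemma tensor_mulE a b a' b' :
  tensor_mul (vtens a b) (vtens a' b') = vtens (a * a') (b * b').
Proof. by rewrite [LHS]vliftE; [exact: outer_tens|exact: outer_bal]. Qed.
Lemma tensor_mul0l t : tensor_mul 0 t = 0.
Proof. by apply: vlift0; apply: outer_bal. Qed.
Lemma tensor_mulDl : left_distributive tensor_mul +%R.
Proof. by move=> t u v; apply: vliftD; apply: outer_bal. Qed.
Let mul_tl a b u : tensor_mul (vtens a b) u = outer u a b.
Proof. by apply: vliftE; apply: outer_bal. Qed.
Lemma tensor_mul0r t : tensor_mul t 0 = 0.
Proof.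
elim/vtensor_ind: t => [|a b t IHt]; first exact: tensor_mul0l.
by rewrite tensor_mulDl IHt mul_tl outer0 addr0.
Qed.
Lemma tensor_mulDr : right_distributive tensor_mul +%R.
Proof.
move=> t u v; elim/vtensor_ind: t => [|a b t IHt].
  by rewrite !tensor_mul0l addr0.
by rewrite !tensor_mulDl IHt !mul_tl outerD addrACA.
Qed.
Lemma tensor_mulA : associative tensor_mul.
Proof.
move=> t u v; elim/vtensor_ind: t => [|a b t IHt]; first by rewrite !tensor_mul0l.
rewrite !tensor_mulDl IHt; congr (_ + _) => {t IHt}.
elim/vtensor_ind: u => [|a' b' u IHu]; first by rewrite !(tensor_mul0l, tensor_mul0r).
rewrite !(tensor_mulDl, tensor_mulDr) IHu; congr (_ + _) => {u IHu}.
elim/vtensor_ind: v => [|a2 b2 v IHv]; first by rewrite !tensor_mul0r.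
by rewrite !tensor_mulDr IHv !tensor_mulE !mulrA.
Qed.
Lemma tensor_mul1 : left_id tensor_one tensor_mul.
Proof.
elim/vtensor_ind => [|a b t IHt]; first exact: tensor_mul0r.
by rewrite tensor_mulDr IHt tensor_mulE !mul1r.
Qed.
Lemma tensor_mulr1 : right_id tensor_one tensor_mul.
Proof.
elim/vtensor_ind => [|a b t IHt]; first exact: tensor_mul0l.
by rewrite tensor_mulDl IHt tensor_mulE !mulr1.
Qed.
Lemma tensor_one_neq0 : tensor_one != 0.
Proof.
have [f f1] := exists_functional (elimN eqP (oner_neq0 A)).
have [g g1] := exists_functional (elimN eqP (oner_neq0 B)).
pose h (a : A) (b : B) : k := f a * g b.
have hb : vbalanced h.
  rewrite /h; split=> [x x' y|x y y'|c x y].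
  - by rewrite linearD mulrDl.
  - by rewrite linearD mulrDr.
  - by rewrite /= !linearZ /= mulrCA mulrA.
apply/eqP => t0; have := vliftE 1 1 hb.
rewrite -/tensor_one t0 vlift0 // /h f1 g1 mulr1.
by move/esym/eqP; rewrite oner_eq0.
Qed.
HB.instance Definition _ := GRing.Zmodule_isNzRing.Build AB
  tensor_mulA tensor_mul1 tensor_mulr1 tensor_mulDl tensor_mulDr tensor_one_neq0.

Lemma vtensM a b a' b' : vtens a b * vtens a' b' = vtens (a * a') (b * b') :> AB.
Proof. exact: tensor_mulE. Qed.
Lemma vtens11 : vtens 1 1 = 1 :> AB.
Proof. by []. Qed.

Let tensor_scaleAl (c : k) (t u : AB) : c *: (t * u) = c *: t * u.
Proof.
elim/vtensor_ind: t => [|a b t IHt]; first by rewrite scaler0 !mul0r scaler0.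
rewrite scalerDr !mulrDl scalerDr IHt; congr (_ + _) => {t IHt}.
elim/vtensor_ind: u => [|a' b' u IHu]; first by rewrite !mulr0 scaler0.
rewrite !mulrDr scalerDr IHu; congr (_ + _).
by rewrite -vtensZl !vtensM -scalerAl vtensZl.
Qed.
HB.instance Definition _ := GRing.Lmodule_isLalgebra.Build k AB tensor_scaleAl.
Let tensor_scaleAr (c : k) (t u : AB) : c *: (t * u) = t * (c *: u).
Proof.
elim/vtensor_ind: t => [|a b t IHt]; first by rewrite !mul0r scaler0.
rewrite !mulrDl scalerDr IHt; congr (_ + _) => {t IHt}.
elim/vtensor_ind: u => [|a' b' u IHu]; first by rewrite scaler0 !mulr0 scaler0.
by rewrite scalerDr !mulrDr scalerDr IHu -!vtensZr !vtensM -scalerAr vtensZr.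
Qed.
HB.instance Definition _ := GRing.Lalgebra_isAlgebra.Build k AB tensor_scaleAr.
End TensorAlgebra.

(* A^e; modules over it are bimodules. *)
Definition env (k : fieldType) (A : algType k) : algType k := vtensor A A^c.

Section Bimodules.
Variables (k : fieldType) (A : algType k).

(* The bimodule written ^s A ^t, as a left A^e-module:
   (a (x) b) . m = s(a) m t(b). *)
Definition twist (s t : {lrmorphism A -> A}) : Type := A.

Section Twist.
Variables s t : {lrmorphism A -> A}.
Local Notation twist := (twist s t).
HB.instance Definition _ := GRing.Zmodule.on twist.

Definition twist_scale (x : env A) (m : twist) : twist :=
  vlift (fun (a : A) (b : A^c) => s a * (m : A) * t b) x.

Lemma twist_bal (m : A) : vbalanced (fun (a : A) (b : A^c) => s a * m * t b).
Proof.
split=> [a a' b|a b b'|c a b].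
- by rewrite raddfD !mulrDl.
- by rewrite raddfD mulrDr.
- by rewrite /= !linearZ /= -!scalerAl -scalerAr.
Qed.
Lemma twist_scaleE (a : A) (b : A^c) (m : twist) :
  twist_scale (vtens a b) m = s a * (m : A) * t b.
Proof. exact/vliftE/twist_bal. Qed.
Lemma twist_scale0l m : twist_scale 0 m = 0.
Proof. exact/vlift0/twist_bal. Qed.
Lemma twist_scaleDl m : {morph twist_scale^~ m : x y / x + y}.
Proof. move=> x y; exact/vliftD/twist_bal. Qed.
Lemma twist_scaleDr : right_distributive twist_scale +%R.
Proof.
move=> x m n; elim/vtensor_ind: x => [|a b x IHx].
  by rewrite !twist_scale0l addr0.
by rewrite !twist_scaleDl IHx !twist_scaleE mulrDr mulrDl addrACA.
Qed.
Lemma twist_scaleA x y m : twist_scale x (twist_scale y m) = twist_scale (x * y) m.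
Proof.
elim/vtensor_ind: x => [|a b x IHx]; first by rewrite mul0r !twist_scale0l.
rewrite mulrDl !twist_scaleDl IHx; congr (_ + _) => {x IHx}.
elim/vtensor_ind: y => [|a' b' y IHy].
  by rewrite mulr0 twist_scale0l twist_scaleE mulr0 mul0r.
rewrite mulrDr !twist_scaleDl twist_scaleDr IHy; congr (_ + _) => {y IHy}.
have -> : vtens a b * vtens a' b' = vtens (a * a') ((b' : A) * (b : A)) :> env A.
  exact: vtensM.
by rewrite !twist_scaleE !rmorphM !mulrA.
Qed.
Lemma twist_scale1 : left_id 1 twist_scale.
Proof.
move=> m; have -> : 1 = vtens 1 (1 : A) :> env A by [].
by rewrite twist_scaleE !rmorph1 mul1r mulr1.
Qed.
HB.instance Definition _ := GRing.Zmodule_isLmodule.Build (env A) twist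
  twist_scaleA twist_scale1 twist_scaleDr twist_scaleDl.
End Twist.

Definition bimod : lmodType (env A) := twist idfun idfun.

(* A as a right A^e-module: m . (a (x) b) = b m a. *)
Definition rbimod : Type := A.
HB.instance Definition _ := GRing.Zmodule.on rbimod.

Definition rbimod_scale (x : (env A)^c) (m : rbimod) : rbimod :=
  vlift (fun (a : A) (b : A^c) => (b : A) * (m : A) * a) x.

Lemma rbimod_bal (m : A) : vbalanced (fun (a : A) (b : A^c) => (b : A) * m * a).
Proof.
split=> [a a' b|a b b'|c a b].
- by rewrite mulrDr.
- by rewrite !mulrDl.
- by rewrite /= -!scalerAl -scalerAr.
Qed.
Lemma rbimod_scaleE (a : A) (b : A^c) (m : rbimod) :
  rbimod_scale (vtens a b) m = (b : A) * (m : A) * a.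
Proof. exact/vliftE/rbimod_bal. Qed.
Lemma rbimod_scale0l m : rbimod_scale 0 m = 0.
Proof. exact/vlift0/rbimod_bal. Qed.
Lemma rbimod_scaleDl m : {morph rbimod_scale^~ m : x y / x + y}.
Proof. move=> x y; exact/vliftD/rbimod_bal. Qed.
Lemma rbimod_scaleDr : right_distributive rbimod_scale +%R.
Proof.
move=> x m n; elim/vtensor_ind: x => [|a b x IHx].
  by rewrite !rbimod_scale0l addr0.
by rewrite !rbimod_scaleDl IHx !rbimod_scaleE mulrDr mulrDl addrACA.
Qed.
Lemma rbimod_scaleA x y m :
  rbimod_scale x (rbimod_scale y m) = rbimod_scale (@GRing.mul (env A) y x) m.
Proof.
elim/vtensor_ind: x => [|a b x IHx].
  by rewrite (@mulr0 (env A)) !rbimod_scale0l.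
rewrite (@mulrDr (env A)) !rbimod_scaleDl IHx; congr (_ + _) => {x IHx}.
elim/vtensor_ind: y => [|a' b' y IHy].
  by rewrite (@mul0r (env A)) rbimod_scale0l rbimod_scaleE mulr0 mul0r.
rewrite (@mulrDl (env A)) !rbimod_scaleDl rbimod_scaleDr IHy; congr (_ + _) => {y IHy}.
have -> : vtens a' b' * vtens a b = vtens (a' * a) ((b : A) * (b' : A)) :> env A.
  exact: vtensM.
by rewrite !rbimod_scaleE !mulrA.
Qed.
Lemma rbimod_scale1 : left_id 1 rbimod_scale.
Proof.
move=> m; transitivity (rbimod_scale (vtens 1 (1 : A)) m); first by [].
by rewrite rbimod_scaleE mul1r mulr1.
Qed.
HB.instance Definition _ := GRing.Zmodule_isLmodule.Build (env A)^c rbimod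
  rbimod_scaleA rbimod_scale1 rbimod_scaleDr rbimod_scaleDl.
End Bimodules.

Section RTensor.
Variables (k : comNzRingType) (R : algType k).

Definition restrict_act (N : lmodType R) (a : R) (n : restrict N) : restrict N :=
  a *: (n : N).
Lemma restrict_act_linear (N : lmodType R) (a : R) : linear (@restrict_act N a).
Proof.
move=> c n n'; rewrite /restrict_act scalerDr; congr (_ + _).
have E (m : restrict N) : c *: m = (c%:A : R) *: (m : N) by [].
by rewrite !E !scalerA -scalerAl -scalerAr mul1r mulr1.
Qed.
HB.instance Definition _ (N : lmodType R) (a : R) := GRing.isLinear.Build k
  (restrict N) (restrict N) *:%R (@restrict_act N a) (restrict_act_linear a).

Definition rtensor (M : lmodType R^c) (N : lmodType R) : lmodType k :=
  tensor (fun a : R => *:%R (a : R^c) : {additive M -> M})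
         (fun a : R => @restrict_act N a : {linear restrict N -> restrict N}).

Definition rtensor_map (M M' : lmodType R^c) (N : lmodType R) (g : {linear M -> M'})
    (x : rtensor M N) : rtensor M' N :=
  tlift (fun m n => tens _ _ (g m) n) x.

Lemma rtensor_map_linear (M M' : lmodType R^c) (N : lmodType R) (g : {linear M -> M'}) : linear (@rtensor_map M M' N g).
Proof.
apply: tlift_linear => [|c m n]; last exact: tensZr.
split=> [m m' n|m n n'|a m n].
- by rewrite linearD tensDl.
- by rewrite tensDr.
- by rewrite [g _]linearZ; apply: tens_bal.
Qed.
HB.instance Definition _ (M M' : lmodType R^c) (N : lmodType R) (g : {linear M -> M'}) :=
  GRing.isLinear.Build k
  (rtensor M N) (rtensor M' N) *:%R (@rtensor_map M M' N g) (rtensor_map_linear g).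

Definition tensor_in (P : chain R^c) (N : lmodType R) i :
    {linear rtensor (P i.+1) N -> rtensor (P i) N} :=
  @rtensor_map _ _ N (chain_d P i).
(* As for hom_in, the outgoing differential in degree 0 is zero. *)
Definition tensor_out (P : chain R^c) (N : lmodType R) i :
    {linear rtensor (P i) N -> rtensor (P i.-1) N} :=
  match i return {linear rtensor (P i) N -> rtensor (P i.-1) N} with
  | 0 => \0
  | j.+1 => tensor_in P N j
  end.

Definition tor (M : lmodType R^c) (N : lmodType R) i : lmodType k :=
  homology (tensor_in (std_res M) N i) (tensor_out (std_res M) N i).
End RTensor.

Section Hochschild.
Variables (k : fieldType) (A : algType k).

Definition hochschild_homology (M : lmodType (env A)) (i : nat) : lmodType k :=
  tor (rbimod A : lmodType (env A)^c) M i.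

Definition hochschild_cohomology (M : lmodType (env A)) (i : nat) : lmodType k :=
  ext (bimod A) M i.

Definition twisted_hochschild_dim_eq (d : nat) :=
  (exists s : {lrmorphism A -> A}, bijective s /\
     ~ is_zero_module (hochschild_homology (twist s idfun) d)) /\
  forall (i : nat) (s : {lrmorphism A -> A}), bijective s ->
    ~ is_zero_module (hochschild_homology (twist s idfun) i) -> (i <= d)%N.

Definition twisted_hochschild_codim_eq (d : nat) :=
  (exists s : {lrmorphism A -> A}, bijective s /\
     ~ is_zero_module (hochschild_cohomology (twist s idfun) d)) /\
  forall (i : nat) (s : {lrmorphism A -> A}), bijective s ->
    ~ is_zero_module (hochschild_cohomology (twist s idfun) i) -> (i <= d)%N.

(* Right multiplication by x is left A^e-linear, so that Ext^i(A, A^e) is a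
   right A^e-module by functoriality; as a bimodule, b . e . a = e . (a (x) b). *)
Definition env_rmul (x : env A) : {linear (env A)^o -> (env A)^o} := x \o* idfun.

(* nakayama_iso: Ext^d(A, A^e) is isomorphic to ^1 A ^nu as a bimodule.
   k-linearity of phi is the case a = c%:A, b = 1. *)
Record nakayama (d : nat) (nu : {lrmorphism A -> A}) : Prop := Nakayama {
  nakayama_bij : bijective nu;
  nakayama_vanish : forall i, i <> d ->
    is_zero_module (hochschild_cohomology (env A)^o i);
  nakayama_iso : exists phi : {additive hochschild_cohomology (env A)^o d -> A},
    bijective phi /\
    forall (a b : A) x,
      phi (ext_map (env_rmul (vtens a (b : A^c))) x) = b * phi x * nu a }.

Definition is_central : {pred A} := fun z => `[< forall a, z * a = a * z >].
Lemma is_central_closed : GRing.submod_closed is_central.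
Proof.
split=> [|c x y /asboolP hx /asboolP hy]; apply/asboolP => a; first by rewrite mul0r mulr0.
by rewrite mulrDl mulrDr hy -scalerAl hx scalerAr.
Qed.
HB.instance Definition _ := GRing.isSubmodClosed.Build k A is_central
  (GRing.submod_closed_semi is_central_closed).
Definition center : lmodType k := submod is_central.

Definition is_commutator_sum : {pred A} := fun x =>
  `[< exists s : seq (k * (A * A)),
      x = \sum_(p <- s) p.1 *: (p.2.1 * p.2.2 - p.2.2 * p.2.1) >].
Lemma is_commutator_sum_closed : GRing.submod_closed is_commutator_sum.
Proof.
split=> [|c x y /asboolP[s ->] /asboolP[t ->]]; apply/asboolP.
  by exists [::]; rewrite big_nil.
exists ([seq (c * p.1, p.2) | p <- s] ++ t); rewrite big_cat big_map /= scaler_sumr.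
by congr (_ + _); apply: eq_bigr => p _; rewrite scalerA.
Qed.
HB.instance Definition _ := GRing.isSubmodClosed.Build k A is_commutator_sum
  (GRing.submod_closed_semi is_commutator_sum_closed).
Definition commutator_quotient : lmodType k := quotmod is_commutator_sum.
End Hochschild.

(* k as a left A-module through the augmentation; with A^c in place of A
   it is the right trivial module. *)
Definition trivial_module (k : fieldType) (A : algType k)
    (eps : {lrmorphism A -> k^o}) : Type := k.

Section ASGorenstein.
Variables (k : fieldType) (A : algType k) (eps : {lrmorphism A -> k^o}).
Local Notation trivial_module := (trivial_module eps).

HB.instance Definition _ := GRing.Zmodule.on trivial_module.

Definition trivial_scale (a : A) (c : trivial_module) : trivial_module := eps a * (c : k).
Lemma trivial_scaleA a b c : trivial_scale a (trivial_scale b c) = trivial_scale (a * b) c.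
Proof. by rewrite /trivial_scale rmorphM mulrA. Qed.
Lemma trivial_scale1 : left_id 1 trivial_scale.
Proof. by move=> c; rewrite /trivial_scale rmorph1 mul1r. Qed.
Lemma trivial_scaleDr : right_distributive trivial_scale +%R.
Proof. by move=> a c c'; rewrite /trivial_scale mulrDr. Qed.
Lemma trivial_scaleDl c : {morph trivial_scale^~ c : a b / a + b}.
Proof. by move=> a b; rewrite /trivial_scale raddfD mulrDl. Qed.
HB.instance Definition _ := GRing.Zmodule_isLmodule.Build A trivial_module
  trivial_scaleA trivial_scale1 trivial_scaleDr trivial_scaleDl.

Definition dim_one (V : lmodType k) :=
  exists2 e : V, e <> 0 & forall x : V, exists c : k, x = c *: e.

Definition left_as_gorenstein (d : nat) :=
  [/\ injdim_eq (A^o : lmodType A) d,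
      dim_one (ext (trivial_module : lmodType A) A^o d) &
      forall i, i <> d -> is_zero_module (ext (trivial_module : lmodType A) A^o i)].

Definition converse_aug : A^c -> k^o := eps.
Lemma converse_aug_linear : linear converse_aug.
Proof. by move=> c x y; rewrite /converse_aug linearP. Qed.
Lemma converse_aug_monoid : monoid_morphism converse_aug.
Proof.
by split=> [|x y]; rewrite /converse_aug ?rmorph1 // (rmorphM eps) [LHS]mulrC.
Qed.
HB.instance Definition _ := GRing.isLinear.Build k A^c k^o *:%R converse_aug
  converse_aug_linear.
HB.instance Definition _ := GRing.isMonoidMorphism.Build A^c k^o converse_aug
  converse_aug_monoid.
End ASGorenstein.

Definition noetherian (k : fieldType) (A : algType k) :=
  left_noetherian A /\ left_noetherian A^c.

Definition as_gorenstein (k : fieldType) (A : algType k) (eps : {lrmorphism A -> k^o})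
    (d : nat) :=
  [/\ noetherian A, left_as_gorenstein eps d &
      left_as_gorenstein (converse_aug eps : {lrmorphism A^c -> k^o}) d].

Section Hopf.
Variables (k : fieldType).

Definition vmap (V W V' W' : lmodType k) (f : V -> V') (g : W -> W') (t : vtensor V W) :
    vtensor V' W' :=
  vlift (fun v w => vtens (f v) (g w)) t.

Definition vassoc (U V W : lmodType k) (t : vtensor (vtensor U V) W) :
    vtensor U (vtensor V W) :=
  vlift (fun x w => vlift (fun u v => vtens u (vtens v w)) x) t.

Record hopf_algebra (A : algType k) := HopfAlgebra {
  comul : {lrmorphism A -> vtensor A A};
  counit : {lrmorphism A -> k^o};
  antipode : {linear A -> A};
  comulA : forall a,
    vassoc (vmap comul id (comul a)) = vmap id comul (comul a);
  counitl : forall a, vlift (fun x y => (counit x : k) *: y) (comul a) = a;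
  counitr : forall a, vlift (fun x y => (counit y : k) *: x) (comul a) = a;
  antipodel : forall a, vlift (fun x y => antipode x * y) (comul a) = (counit a : k)%:A;
  antipoder : forall a, vlift (fun x y => x * antipode y) (comul a) = (counit a : k)%:A }.
End Hopf.

Definition lmod_iso (k : pzRingType) (V W : lmodType k) :=
  exists f : {linear V -> W}, bijective f.

(* Main.v *)
(* M |-> M (x) A, with the diagonal left action and right multiplication on A, is an exact
   functor from left A-modules to bimodules that sends the trivial module to A and A to
   A^e. It turns a resolution of length d of the trivial
   module by finitely generated projectives into one, P, of the bimodule A. By
   the Nakayama hypothesis the dual complex Hom(P, A^e), reversed, resolves A twisted
   by nu; untwisting gives a resolution of the right A^e-module A, and since
   Hom(P, A^e) (x) M = Hom(P, M) for finitely generated projectives, Tor_j(A, M) is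
   Ext^(d-j)(A, N) with N a twist of M (Van den Bergh duality). In the extreme degrees,
   Ext^0(A, A) is the centre and Tor_0(A, A) is A / [A, A]. *)
From HB Require Import structures.
From mathcomp Require Import all_boot all_order all_algebra zify.
From mathcomp Require Import boolp classical_sets functions.
Require Import Defs.
Set Implicit Arguments.
Unset Strict Implicit.
Unset Printing Implicit Defensive.
Import GRing.Theory.
Local Open Scope ring_scope.

(** * Modules over a ring *)

(** The resolution of A has to be finitely generated and of length [d] at once: the length kills
    homology and cohomology above [d] for all coefficients, and finite generation identifies Hom(P,
    A^e) (x) M with Hom(P, M). The global dimension controls only the length and noetherianity only
    the generators; a notion of dimension that does not depend on the chosen projective covers
    combines them. Induced modules stay projective because A (x) A with its diagonal action is free
    of rank one over A^e: the map a (x) b |-> a_1 (x) a_2 b is inverted by means of the antipode.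
    All twists come from a single automorphism [w] of A^e, namely nu^-1 (x) id: duals carry the
    action through [w], and coefficients are compared by maps semilinear along [w]. The Nakayama
    isomorphism lives on Ext of the standard resolution, so comparison maps are kept explicit in
    order to transport it linearly to the dual of P. The groups in degree [d] are nonzero because 1
    is central and because the counit, a character, kills commutators but not 1. *)

Section MkLinear.
Variables (R : pzRingType) (U V : lmodType R) (f : U -> V).
Hypothesis f_linear : linear f.
Definition mk_linear : {linear U -> V} :=
  HB.pack f (GRing.isLinear.Build R U V *:%R f f_linear).
End MkLinear.

Section PropSubmodule.
Variables (R : pzRingType) (M : lmodType R) (S : M -> Prop).
Hypotheses (S0 : S 0) (SL : forall a x y, S x -> S y -> S (a *: x + y)).

Definition prop_pred : {pred M} := fun x => `[< S x >].
Lemma prop_pred_closed : GRing.submod_closed prop_pred.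
Proof.
split=> [|a x y /asboolP hx /asboolP hy]; apply/asboolP => //; exact: SL.
Qed.
Definition prop_submod : submodClosed M :=
  HB.pack prop_pred (GRing.isSubmodClosed.Build R M prop_pred
    (GRing.submod_closed_semi prop_pred_closed)).
Lemma prop_submodP x : x \in prop_submod <-> S x.
Proof. by split=> /asboolP. Qed.
End PropSubmodule.

Section Lifting.
Variable R : pzRingType.
Implicit Types M N P : lmodType R.

(** [projective] speaks of surjections only; corestricting [g] and [f] to the range of [g] reduces
    to that case. *)
Lemma projective_lift P M N (g : {linear M -> N}) (f : {linear P -> N}) :
    projective P -> (forall x, exists y, g y = f x) ->
  exists h : {linear P -> M}, forall x, g (h x) = f x.
Proof.
move=> Pproj gf.
pose S y := exists x, g x = y.
have S0 : S 0 by exists 0; rewrite linear0.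
have SL a x y : S x -> S y -> S (a *: x + y).
  by move=> [u <-] [v <-]; exists (a *: u + v); rewrite linearP.
pose T := prop_submod S0 SL.
have gT x : g x \in T by apply/prop_submodP; exists x.
have fT x : f x \in T by apply/prop_submodP.
have gL : linear (fun x => Submod (gT x) : submod T).
  by move=> a x y; apply: val_inj; rewrite /= linearP.
have fL : linear (fun x => Submod (fT x) : submod T).
  by move=> a x y; apply: val_inj; rewrite /= linearP.
have [|h hP] := Pproj _ _ (mk_linear gL) (mk_linear fL).
  move=> [y yT]; have /prop_submodP[x xy] := yT; exists x; exact: val_inj.
by exists h => x; have := congr1 val (hP x).
Qed.

(** The identity of [M] factors through the direct sum of [N] and [P], which is never formed: the
    lifts along the two summands are added. *)
Lemma projective_retract P M N (i : {linear M -> N}) (p : {linear N -> M})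
    (a : {linear M -> P}) (b : {linear P -> M}) :
    projective N -> projective P -> (forall x, p (i x) + b (a x) = x) ->
  projective M.
Proof.
move=> Np Pp E X Y g f gs.
have [h1 h1P] := Np _ _ g (f \o p) gs.
have [h2 h2P] := Pp _ _ g (f \o b) gs.
exists ((h1 \o i) \+ (h2 \o a)) => x /=.
by rewrite linearD h1P h2P /= -linearD E.
Qed.
End Lifting.

(** * Chain maps and homotopies between projective resolutions *)

Section Comparison.
Variable R : pzRingType.
Implicit Types M N : lmodType R.

(** The augmented complex, with [M] in degree 0 and [P n] in degree [n.+1]: a map of modules is then
    lifted by the same step in every degree. Hence the shift [F i.+1] wherever a chain map is
    applied on [P i]. *)
Definition aug_ob M (P : chain R) n : lmodType R := if n is m.+1 then P m else M.
Definition aug_d M (P : chain R) (e : {linear P 0%N -> M}) n :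
    {linear aug_ob M P n.+1 -> aug_ob M P n} :=
  match n with 0 => e | m.+1 => chain_d P m end.

Lemma aug_dd M (P : chain R) (e : {linear P 0%N -> M}) n x :
  proj_resolution e -> aug_d e n (aug_d e n.+1 x) = 0.
Proof. by case=> _ _ e0 e1; case: n x => [|n] x; [apply/e0|apply/e1]; exists x. Qed.

Lemma aug_exact M (P : chain R) (e : {linear P 0%N -> M}) n x :
  proj_resolution e -> aug_d e n x = 0 -> exists y, aug_d e n.+1 y = x.
Proof. by case=> _ _ e0 e1; case: n x => [|n] x; [move/e0|move/e1]. Qed.

Section ChainMap.
Variables (M M' : lmodType R) (P P' : chain R).
Variables (e : {linear P 0%N -> M}) (e' : {linear P' 0%N -> M'}).
Hypotheses (eP : proj_resolution e) (eP' : proj_resolution e').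

Record aug_map := AugMap {
  aug_fun :> forall n, {linear aug_ob M P n -> aug_ob M' P' n};
  aug_comm : forall n x, aug_d e' n (aug_fun n.+1 x) = aug_fun n (aug_d e n x) }.

Lemma comparison_exists (f : {linear M -> M'}) : exists F : aug_map, F 0%N = f.
Proof.
pose liftable n (p : {linear aug_ob M P n -> aug_ob M' P' n}) :=
  forall x, exists y, aug_d e' n y = p (aug_d e n x).
(* Each step needs the liftability of the previous map, so the fixpoint [F] runs over maps paired
   with that proof. *)
have step n (p : {p | @liftable n p}) :
    {q : {q | @liftable n.+1 q} | forall x, aug_d e' n (sval q x) = sval p (aug_d e n x)}.
  apply: cid; case: p => p pl.
  have [||q qP] := @projective_lift _ (aug_ob M P n.+1) _ _ (aug_d e' n)
    (p \o aug_d e n : {linear _ -> _}).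
  - exact: (proj_res_projective eP).
  - by move=> x; apply: pl.
  suff ql : liftable n.+1 q by exists (exist _ q ql).
  move=> x; apply: (aug_exact eP'); rewrite qP /=.
  by rewrite (aug_dd _ eP) linear0.
have l0 : @liftable 0%N f by move=> x; apply: (proj_res_surj eP').
pose F := fix F n : {p | @liftable n p} :=
  match n with 0 => exist _ f l0 | m.+1 => sval (step m (F m)) end.
by exists (@AugMap (fun n => sval (F n) ) (fun n => svalP (step n (F n)))).
Qed.

Lemma homotopy_exists (F G : aug_map) : (forall x, F 0%N x = G 0%N x) ->
  exists s : forall n, {linear aug_ob M P n -> aug_ob M' P' n.+1},
    (forall x, s 0%N x = 0) /\
    forall n x, F n.+1 x - G n.+1 x = aug_d e' n.+1 (s n.+1 x) + s n (aug_d e n x).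
Proof.
move=> FG0.
(* The next lift sees the homotopy on boundaries only, where the term [s d] of the homotopy formula
   vanishes because [d d = 0]. *)
pose good n (h : {linear aug_ob M P n -> aug_ob M' P' n.+1}) :=
  forall x, aug_d e' n (h (aug_d e n x)) = F n (aug_d e n x) - G n (aug_d e n x).
have step n (p : {p | @good n p}) :
    {q : {q | @good n.+1 q} | forall x,
       F n.+1 x - G n.+1 x = aug_d e' n.+1 (sval q x) + sval p (aug_d e n x)}.
  apply: cid; case: p => p pg.
  have [||q qP] := @projective_lift _ (aug_ob M P n.+1) _ _ (aug_d e' n.+1)
    ((F n.+1 \- G n.+1) \- (p \o aug_d e n) : {linear _ -> _}).
  - exact: (proj_res_projective eP).
  - move=> x; apply: (aug_exact eP'); rewrite /= !linearB /= !aug_comm pg subrr //.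
  suff qg : good n.+1 q by exists (exist _ q qg) => x; rewrite /= qP /= subrK.
  move=> x; rewrite qP /= (aug_dd _ eP) linear0 subr0 //.
have g0 : @good 0%N \0 by move=> x; rewrite linear0 FG0 subrr.
pose S := fix S n : {p | @good n p} :=
  match n with 0 => exist _ _ g0 | m.+1 => sval (step m (S m)) end.
by exists (fun n => sval (S n) ); split=> // n x; apply: (svalP (step n (S n))).
Qed.
End ChainMap.

Section Compose.
Variables (M M' M'' : lmodType R) (P P' P'' : chain R).
Variables (e : {linear P 0%N -> M}) (e' : {linear P' 0%N -> M'}) (e'' : {linear P'' 0%N -> M''}).

Lemma aug_comp_comm (G : aug_map e' e'') (F : aug_map e e') n x :
  aug_d e'' n (G n.+1 (F n.+1 x)) = G n (F n (aug_d e n x)).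
Proof. by rewrite !aug_comm. Qed.
Definition aug_comp (G : aug_map e' e'') (F : aug_map e e') : aug_map e e'' :=
  @AugMap _ _ _ _ e e'' (fun n => G n \o F n : {linear _ -> _}) (aug_comp_comm G F).
Definition aug_id : aug_map e e :=
  @AugMap _ _ _ _ e e (fun n => idfun : {linear _ -> _}) (fun n x => erefl).
End Compose.

End Comparison.

(** * Finite resolutions by finitely generated projectives *)

Section SyzygyDimension.
Variable R : pzRingType.
Implicit Types M N : lmodType R.

(** Quantifying over all projective covers allows a finitely generated one to be picked at each
    step, whatever resolution bounds the dimension. *)
Fixpoint syzygy_dim_le n M : Prop :=
  match n with
  | 0 => projective M
  | m.+1 => forall (Q : lmodType R) (g : {linear Q -> M}),
      projective Q -> surjective g -> syzygy_dim_le m (submod (ker g))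
  end.

(* Replaces Schanuel's lemma: the condition "id - p i factors through a
   projective" passes to kernels of projective covers. *)
Lemma syzygy_dim_stable n M N (P : chain R) (e : {linear P 0%N -> N})
    (T : lmodType R) (i : {linear M -> N}) (p : {linear N -> M})
    (a : {linear M -> T}) (b : {linear T -> M}) :
    proj_resolution e -> (forall j, (n < j)%N -> is_zero_module (P j)) ->
    projective T -> (forall x, p (i x) + b (a x) = x) ->
  syzygy_dim_le n M.
Proof.
elim: n => [|n IHn] in M N P e T i p a b *; move=> eP P0 Tp E.
  apply: (projective_retract _ Tp E).
  (* [P 1] is zero, so [e] is an isomorphism and [N] is projective. *)
  have einj : injective e.
    move=> x y exy; apply/eqP; rewrite -subr_eq0; apply/eqP.
    have /(proj_res_exact0 eP)[z <-] : e (x - y) = 0 by rewrite linearB exy subrr.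
    by rewrite (P0 1%N isT z) linear0.
  have [r rP] : exists r : N -> P 0%N, cancel r e.
    by have [r] := choice (proj_res_surj eP); exists r.
  have rL : linear r by move=> c x y; apply: einj; rewrite linearP !rP.
  apply: (@projective_retract _ (P 0%N) _ _ (mk_linear rL) e \0 \0).
  - exact: (proj_res_projective eP).
  - exact: (proj_res_projective eP).
  - by move=> x /=; rewrite rP addr0.
move=> Q g Qp gs.
have [|i0 i0P] := @projective_lift _ Q _ _ e (i \o g) Qp.
  by move=> x; apply: (proj_res_surj eP).
have [|p0 p0P] := projective_lift (f := p \o e) (@proj_res_projective _ _ _ _ eP 0%N) (g := g).
  by move=> x; apply: gs.
have [|b0 b0P] := projective_lift (f := b) Tp (g := g).
  by move=> x; apply: gs.
pose K := submod (ker g); pose K' := submod (ker e).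
have i1P (x : K) : i0 (val x) \in ker e.
  by rewrite kerE i0P /=; have := valP x; rewrite kerE => /eqP ->; rewrite linear0.
have i1L : linear (fun x => Submod (i1P x) : K').
  by move=> c x y; apply: val_inj; rewrite /= linearP.
have p1P (x : K') : p0 (val x) \in ker g.
  by rewrite kerE p0P /=; have := valP x; rewrite kerE => /eqP ->; rewrite linear0.
have p1L : linear (fun x => Submod (p1P x) : K).
  by move=> c x y; apply: val_inj; rewrite /= linearP.
(* As the identity of [M] minus [p i] is [b a], this endomorphism of [Q] takes values in the kernel
   of [g]. On that kernel its last term vanishes, so the identity of the kernel minus the map
   induced by [p0 i0] factors through the inclusion into [Q]: the projective [Q] takes over the role
   of [T]. *)
have hP x : x - p0 (i0 x) - b0 (a (g x)) \in ker g.
  by rewrite kerE !linearB p0P b0P /= i0P /= -{1}(E (g x)) addrAC addrK subrr.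
have hL : linear (fun x => Submod (hP x) : K).
  move=> c x y; apply: val_inj => /=.
  exact: (linearP ((idfun \- (p0 \o i0)) \- (b0 \o (a \o g)) : {linear Q -> Q})).
have eP1x (x : P 1%N) : chain_d P 0 x \in ker e.
  by rewrite kerE; apply/eqP/(proj_res_exact0 eP); exists x.
have e1L : linear (fun x => Submod (eP1x x) : K').
  by move=> c x y; apply: val_inj; rewrite /= linearP.
pose P1 := @Chain R (fun n => P n.+1) (fun n => chain_d P n.+1).
have valL : linear (val : K -> Q) by move=> c x y; rewrite linearP.
apply: (IHn K K' P1 (mk_linear e1L) Q (mk_linear i1L) (mk_linear p1L)
  (mk_linear valL) (mk_linear hL)) => //.
- split=> [j||x|j x].
  + exact: (proj_res_projective eP).
  + move=> [y yK]; have := yK; rewrite kerE => /eqP/(proj_res_exact0 eP)[x xy].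
    by exists x; apply: val_inj.
  + split=> [/(congr1 val)/= /(proj_res_exact eP)//|[y <-]]; apply: val_inj.
    by apply/(proj_res_exact eP); exists y.
  + exact: (proj_res_exact eP).
- by move=> j nj; apply: P0.
- move=> x; apply: val_inj => /=.
  have := valP x; rewrite kerE => /eqP ->.
  by rewrite !linear0 addr0 addrC subrK.
Qed.

Lemma projdim_syzygy n M : projdim_le M n -> syzygy_dim_le n M.
Proof.
move=> [P [e [eP P0]]].
apply: (@syzygy_dim_stable n M M P e (P 0%N) idfun idfun \0 \0) => //.
- exact: (proj_res_projective eP).
- by move=> x /=; rewrite addr0.
Qed.
End SyzygyDimension.

(** * Finitely generated projectives over noetherian rings *)

Section DualBasis.
Variable R : nzRingType.
Implicit Types M N : lmodType R.

(** The dual basis criterion for finitely generated projective modules, a form that passes to duals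
    and to induced modules by formulas. *)
Definition dual_basis M := exists (n : nat) (x : 'I_n -> M) (f : 'I_n -> {linear M -> R^o}),
  forall m, m = \sum_i (f i m : R) *: x i.

Lemma dual_basis_projective M : dual_basis M -> projective M.
Proof.
move=> [n [x [f xf]]] X Y g h gs.
have [s sP] := choice (fun i => gs (h (x i))).
have hL : linear (fun m => \sum_i (f i m : R) *: s i).
  move=> a y z; rewrite scaler_sumr -big_split; apply: eq_bigr => i _.
  by rewrite linearP scalerDl scalerA.
exists (mk_linear hL) => m /=; rewrite linear_sum {2}(xf m) linear_sum.
by apply: eq_bigr => i _; rewrite !linearZ sP.
Qed.

Definition generated_by M (s : seq M) (x : M) :=
  exists c : 'I_(size s) -> R, x = \sum_i c i *: s`_i.

Definition fin_gen M := exists s : seq M, forall x, generated_by s x.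

Lemma generated_linear M (s : seq M) a x y :
  generated_by s x -> generated_by s y -> generated_by s (a *: x + y).
Proof.
move=> [c ->] [c' ->]; exists (fun i => a * c i + c' i).
rewrite scaler_sumr -big_split; apply: eq_bigr => i _.
by rewrite scalerDl scalerA.
Qed.
Lemma generated0 M (s : seq M) : generated_by s 0.
Proof. by exists (fun=> 0); rewrite big1 // => i _; rewrite scale0r. Qed.
Lemma generated_nth M (s : seq M) (i : 'I_(size s)) : generated_by s s`_i.
Proof.
exists (fun j => (j == i)%:R); rewrite (bigD1 i) //= eqxx scale1r big1 ?addr0 //.
by move=> j /negPf ->; rewrite scale0r.
Qed.
Lemma generated_sum M (s : seq M) n (c : 'I_n -> R) (x : 'I_n -> M) :
  (forall i, generated_by s (x i)) -> generated_by s (\sum_i c i *: x i).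
Proof.
move=> xs; apply: (big_ind (generated_by s)) => [|y z ys zs|i _].
- exact: generated0.
- by rewrite -[y]scale1r; apply: generated_linear.
- by rewrite -[_ *: _]addr0; apply: generated_linear => //; apply: generated0.
Qed.
Lemma generated_trans M (s t : seq M) x :
  (forall i : 'I_(size s), generated_by t s`_i) -> generated_by s x -> generated_by t x.
Proof. by move=> st [c ->]; apply: generated_sum. Qed.
Lemma generated_cons M m (s : seq M) x :
  generated_by (m :: s) x <-> exists a, generated_by s (x - a *: m).
Proof.
split=> [[c ->]|[a [c E]]].
  rewrite big_ord_recl /=; exists (c ord0); rewrite addrAC subrr add0r.
  by exists (fun i => c (lift ord0 i)).
exists (fun i => if unlift ord0 i is Some j then c j else a).
rewrite big_ord_recl unlift_none /=; apply/eqP; rewrite addrC -subr_eq E.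
by apply/eqP/eq_bigr => i _; rewrite liftK.
Qed.
Lemma generated_catl M (s t : seq M) x : generated_by s x -> generated_by (s ++ t) x.
Proof.
apply: generated_trans => i; have i' : (i < size (s ++ t))%N.
  by rewrite size_cat ltn_addr.
have := generated_nth (Ordinal i'); by rewrite /= nth_cat ltn_ord.
Qed.
Lemma generated_catr M (s t : seq M) x : generated_by t x -> generated_by (s ++ t) x.
Proof.
apply: generated_trans => i; have i' : (size s + i < size (s ++ t))%N.
  by rewrite size_cat ltn_add2l.
have := generated_nth (Ordinal i'); by rewrite /= nth_cat ltnNge leq_addr /= addKn.
Qed.

Lemma generated_family M n (x : 'I_n -> M) j : generated_by [seq x i | i <- enum 'I_n] (x j).
Proof.
have jt : (j < size [seq x i | i <- enum 'I_n])%N by rewrite size_map size_enum_ord.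
have := generated_nth (Ordinal jt); rewrite /= (nth_map j) ?size_enum_ord //.
by rewrite nth_ord_enum.
Qed.

Hypothesis R_noetherian : left_noetherian R.

(** Induction on the generators. The coefficients of the first generator [m] in elements of [S] form
    a left ideal, generated by a finite list [r]; lifts [u] of these generators to [S] reduce any
    element of [S] to one generated by the remaining [s]. *)
Lemma noetherian_sub M (s : seq M) (S : M -> Prop) :
    S 0 -> (forall a x y, S x -> S y -> S (a *: x + y)) ->
    (forall x, S x -> generated_by s x) ->
  exists t : seq M, (forall i : 'I_(size t), S t`_i) /\ forall x, S x -> generated_by t x.
Proof.
elim: s S => [|m s IHs] S S0 SL Sgen.
  exists [::]; split=> [[]//|x /Sgen]; by [].
pose I (a : R^o) := exists2 x, S x & generated_by s (x - (a : R) *: m).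
have I0 : I 0 by exists 0 => //; rewrite scale0r subr0; apply: generated0.
have IL a x y : I x -> I y -> I (a *: x + y).
  move=> [u Su gu] [v Sv gv]; exists (a *: u + v); first exact: SL.
  have -> : a *: u + v - (a *: x + y : R) *: m = a *: (u - (x : R) *: m) + (v - (y : R) *: m).
    by rewrite scalerBr scalerA scalerDl opprD addrACA.
  exact: generated_linear.
have [r rP] := R_noetherian (prop_submod I0 IL).
have rI (j : 'I_(size r)) : I r`_j.
  apply/(prop_submodP I0 IL)/rP.
  have [c E] := @generated_nth R^o r j; by exists c.
have rI' (j : 'I_(size r)) : exists x, S x /\ generated_by s (x - (r`_j : R) *: m).
  by have [x] := rI j; exists x.
have [u uP] := choice rI'.
have Ssum n (c : 'I_n -> R) (x : 'I_n -> M) : (forall i, S (x i)) -> S (\sum_i c i *: x i).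
  move=> xS; apply: (big_ind S) => // [y z yS zS|i _].
    by rewrite -[y]scale1r; apply: SL.
  by rewrite -[_ *: _]addr0; apply: SL.
pose S' x := S x /\ generated_by s x.
have [||x [_ //]|t' [t'S t'gen]] := IHs S'.
- by split=> //; apply: generated0.
- by move=> a x y [Sx gx] [Sy gy]; split; [apply: SL|apply: generated_linear].
pose tu := [seq u j | j <- enum 'I_(size r)].
have tuP (j : 'I_(size r)) : generated_by tu (u j) by apply: generated_family.
exists (tu ++ t'); split=> [i|x Sx].
  have : (tu ++ t')`_i \in tu ++ t' by apply: mem_nth.
  rewrite mem_cat => /orP[/mapP[j _ ->]|]; first by case: (uP j).
  by move/(nthP 0) => [k kt <-]; case: (t'S (Ordinal kt)).
have /generated_cons[a ga] := Sgen _ Sx.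
have /(prop_submodP I0 IL)/rP[c ac] : I a by exists x.
have -> : x = 1 *: \sum_j c j *: u j + (x - \sum_j c j *: u j).
  by rewrite scale1r addrC subrK.
apply: generated_linear.
  by apply: generated_catl; apply: generated_sum.
apply/generated_catr/t'gen; split.
  rewrite -scaleN1r addrC; apply: SL => //; apply: Ssum => j; by case: (uP j).
(* The multiples of [m] cancel because [ac] writes [a] in terms of the generators [r] with
   coefficients [c]. *)
have -> : x - \sum_j c j *: u j =
    1 *: (x - a *: m) + \sum_j (- c j) *: (u j - (r`_j : R) *: m).
  rewrite scale1r ac scaler_suml -addrA; congr (_ + _).
  rewrite -!sumrN -big_split; apply: eq_bigr => j _ /=.
  by rewrite scalerBr !scaleNr opprK scalerA addrCA addNr addr0.
apply: generated_linear => //; apply: generated_sum => j; by case: (uP j).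
Qed.

Lemma noetherian_ker M N (g : {linear M -> N}) : fin_gen M -> fin_gen (submod (ker g)).
Proof.
move=> [s sP].
have [||//|t [tS tgen]] := @noetherian_sub M s (fun x => g x = 0).
- exact: linear0.
- by move=> a x y gx gy; rewrite linearP gx gy scaler0 addr0.
have tK (i : 'I_(size t)) : t`_i \in ker g by rewrite kerE tS.
exists [seq Submod (tK i) | i <- enum 'I_(size t)] => x.
have /eqP/tgen[c xE] : g (val x) == 0 := valP x.
have -> : x = \sum_i c i *: (Submod (tK i) : submod (ker g)).
  by apply: val_inj; rewrite xE linear_sum.
by apply: generated_sum => i; apply: (generated_family (fun i => Submod (tK i))).
Qed.

Definition free_mod n : lmodType R := {ffun 'I_n -> R^o}.

Lemma free_mod_basis n : dual_basis (free_mod n).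
Proof.
pose x (i : 'I_n) : free_mod n := [ffun j => ((j == i)%:R : R^o)].
have fL (i : 'I_n) : linear (fun m : free_mod n => m i : R^o).
  by move=> a y z; rewrite !ffunE.
exists n, x, (fun i => mk_linear (fL i)) => m; apply/ffunP => j.
rewrite sum_ffunE (bigD1 j) //= !ffunE eqxx big1 ?addr0; first by rewrite /GRing.scale /= mulr1.
by move=> i ij; rewrite !ffunE eq_sym (negPf ij) scaler0.
Qed.

Lemma free_mod_cover M (s : seq M) : (forall x, generated_by s x) ->
  exists g : {linear free_mod (size s) -> M}, surjective g.
Proof.
move=> sP; have gL : linear (fun m : free_mod (size s) => \sum_i (m i : R) *: s`_i).
  move=> a x y; rewrite scaler_sumr -big_split; apply: eq_bigr => i _.
  by rewrite !ffunE scalerDl scalerA.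
exists (mk_linear gL) => x; have [c ->] := sP x; exists [ffun i => c i] => /=.
by apply: eq_bigr => i _; rewrite ffunE.
Qed.

Lemma projective_basis M : fin_gen M -> projective M -> dual_basis M.
Proof.
move=> [s sP] Mp; have [g gs] := free_mod_cover sP.
have [h hP] := Mp _ _ g idfun gs.
have [n [x [f xf]]] := free_mod_basis (size s).
exists n, (g \o x), (fun i => f i \o h : {linear _ -> _}) => m /=.
rewrite -{1}[m]/(idfun m) -hP {1}(xf (h m)) linear_sum.
by apply: eq_bigr => i _; rewrite linearZ.
Qed.

Lemma fin_gen_free n : fin_gen (free_mod n).
Proof.
have [m [x [f xf]]] := free_mod_basis n; exists [seq x i | i <- enum 'I_m] => y.
by rewrite (xf y); apply: generated_sum => i; apply: generated_family.
Qed.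

(** The kernel of a free cover of finite rank is again finitely generated and has dimension one
    less; in dimension 0 the module itself is projective and ends the resolution. *)
Lemma dual_basis_resolution n M : fin_gen M -> syzygy_dim_le n M ->
  exists (P : chain R) (e : {linear P 0%N -> M}),
    [/\ proj_resolution e, forall i, dual_basis (P i) &
        forall i, (n < i)%N -> is_zero_module (P i)].
Proof.
elim: n => [|n IHn] in M *; move=> Mfg Mdim.
  pose P := @Chain R (fun n => if n is m.+1 then free_mod 0 else M) (fun n => \0).
  have P0 i : (0 < i)%N -> is_zero_module (P i).
    by case: i => // i _ x; apply/ffunP => -[].
  have Pb i : dual_basis (P i).
    by case: i => [|i]; [apply: projective_basis|apply: free_mod_basis].
  exists P, idfun; split=> //; split=> [i||y|i y].
  - exact: dual_basis_projective.
  - by move=> x; exists x.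
  - split=> [/= ->|[x /= <-] //]; by exists 0.
  - by rewrite (P0 i.+1 isT y) linear0; split=> // _; exists 0; rewrite linear0.
have [s sP] := Mfg; have [g gs] := free_mod_cover sP.
have gp := dual_basis_projective (free_mod_basis (size s)).
have [||P [e [eP Pb P0]]] := IHn (submod (ker g)).
- exact: noetherian_ker (fin_gen_free _).
- exact: Mdim.
pose ob i : lmodType R := if i is j.+1 then P j else free_mod (size s).
have valL : linear (fun x => val (e x)) by move=> c x y; rewrite !linearP.
pose dif i : {linear ob i.+1 -> ob i} :=
  match i with 0 => mk_linear valL | j.+1 => chain_d P j end.
have ob_b i : dual_basis (ob i) by case: i => [|i]; [apply: free_mod_basis|apply: Pb].
exists (Chain dif), g; split=> // [|[//|i] /P0//].
split=> [i||y|[|i] y] /=.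
- exact: dual_basis_projective.
- exact: gs.
- split=> [/eqP gy|[x <-]]; last by apply/eqP; exact: (valP (e x)).
  have yK : y \in ker g by [].
  have [x xE] := proj_res_surj eP (Submod yK).
  by exists x; rewrite xE.
- split=> [ey|/(proj_res_exact0 eP) -> //].
  apply/(proj_res_exact0 eP); exact: val_inj.
- exact: (proj_res_exact eP).
Qed.
End DualBasis.

(** * Comparison of resolutions in Ext and Tor *)

Lemma inj_surj_bijective (T U : Type) (f : T -> U) :
  injective f -> Defs.surjective f -> bijective f.
Proof.
move=> finj fsurj; have [g gP] := choice fsurj.
by exists g => [x|//]; apply: finj; rewrite gP.
Qed.

Section LmodIso.
Variable k : pzRingType.
Implicit Types U V W : lmodType k.

Lemma lmod_iso_sym V W : lmod_iso V W -> lmod_iso W V.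
Proof.
move=> [f [g fg gf]]; have gL : linear g.
  by move=> a x y; apply: (can_inj fg); rewrite linearP !gf.
by exists (mk_linear gL), f.
Qed.
Lemma lmod_iso_trans U V W : lmod_iso U V -> lmod_iso V W -> lmod_iso U W.
Proof. by move=> [f bf] [g bg]; exists (g \o f); apply: bij_comp. Qed.
Lemma lmod_iso_zero V W : lmod_iso V W -> is_zero_module W -> is_zero_module V.
Proof.
move=> [f [g fg gf]] W0 x; rewrite -(fg x) (W0 (f x)) -[RHS]fg.
by rewrite linear0.
Qed.
End LmodIso.

Section Range.
Variables (R : pzRingType) (U V : lmodType R) (f : {linear U -> V}).

Definition in_range (y : V) := exists x, f x = y.

Lemma range_linear c t u : in_range t -> in_range u -> in_range (c *: t + u).
Proof. by move=> [x <-] [y <-]; exists (c *: x + y); rewrite linearP. Qed.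
Lemma range0 : in_range 0. Proof. by exists 0; rewrite linear0. Qed.
Lemma rangeD t u : in_range t -> in_range u -> in_range (t + u).
Proof. by move=> [x <-] [y <-]; exists (x + y); rewrite linearD. Qed.
Lemma rangeB t u : in_range t -> in_range u -> in_range (t - u).
Proof. by move=> [x <-] [y <-]; exists (x - y); rewrite linearB. Qed.
Lemma range_of_sub t u : in_range (t - u) -> in_range u -> in_range t.
Proof. by move=> htu hu; rewrite -(subrK u t); apply: rangeD. Qed.
Lemma range_subr t u v : in_range (t - u) -> in_range (t - v) -> in_range (u - v).
Proof.
move=> htu htv; have -> : u - v = (t - v) - (t - u) by rewrite opprB [RHS]addrC addrA subrK.
exact: rangeB.
Qed.
Lemma range_subD t t' u u' v :
  in_range (t - u) -> in_range (t' - u') -> in_range (v - (u + u')) -> in_range (t + t' - v).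
Proof.
move=> ht ht' hv; have -> : t + t' - v = (t - u) + (t' - u') - (v - (u + u')).
  by rewrite opprB [t - u + _]addrACA -opprD addrA subrK.
exact: rangeB (rangeD ht ht') hv.
Qed.
End Range.

Section CycleClass.
Variables (R : pzRingType) (X Y Z : lmodType R).
Variables (f : {linear X -> Y}) (g : {linear Y -> Z}).

Lemma cycle_subproof y : g y = 0 -> y \in ker g.
Proof. by move=> gy; apply/eqP. Qed.
Definition cycle_class y (gy : g y = 0) : homology f g :=
  quot_pi (boundary f g) (Submod (cycle_subproof gy)).

Lemma cycle_classP y y' (gy : g y = 0) (gy' : g y' = 0) :
  cycle_class gy = cycle_class gy' <-> exists x, f x = y - y'.
Proof. by split=> [/quot_piP/asboolP|h] //; apply/quot_piP/asboolP. Qed.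
Lemma cycle_class_surj c : exists y (gy : g y = 0), c = cycle_class gy.
Proof.
have /eqP gy := valP (quot_repr c); exists (val (quot_repr c)), gy.
rewrite -[LHS]quot_reprK /cycle_class; congr quot_pi; exact: val_inj.
Qed.
Lemma cycle_class_linear a y y' (gy : g y = 0) (gy' : g y' = 0)
    (gay : g (a *: y + y') = 0) :
  cycle_class gay = a *: cycle_class gy + cycle_class gy'.
Proof. by rewrite -linearP; congr quot_pi; apply: val_inj. Qed.
Lemma cycle_class_eq y y' (gy : g y = 0) (gy' : g y' = 0) :
  y = y' -> cycle_class gy = cycle_class gy'.
Proof. by move=> E; apply/cycle_classP; exists 0; rewrite E subrr linear0. Qed.
Lemma zero_homologyP :
  is_zero_module (homology f g) <-> forall y, g y = 0 -> exists x, f x = y.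
Proof.
split=> [h y gy|h c].
  have g0 : g 0 = 0 by rewrite linear0.
  have [|x xE] := (cycle_classP gy g0).1; first by rewrite [LHS]h [RHS]h.
  by exists x; rewrite xE subr0.
have [y [gy ->]] := cycle_class_surj c; have [x xy] := h _ gy.
have g0 : g 0 = 0 by rewrite linear0.
have -> : 0 = cycle_class g0.
  rewrite /cycle_class -[0 in LHS](linear0 (quot_pi (boundary f g))).
  congr quot_pi; exact: val_inj.
by apply/cycle_classP; exists x; rewrite subr0.
Qed.
End CycleClass.

Section OneSidedHomology.
Variables (R : pzRingType) (W X Y Z : lmodType R).
Variables (f : {linear X -> Y}) (g : {linear Y -> Z}).

(** The shape of Ext in degree 0, where no boundaries come in. *)
Lemma homology_kernel (h : {linear W -> Y}) :
    (forall x, f x = 0) -> injective h -> (forall y, g y = 0 <-> exists w, h w = y) ->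
  lmod_iso W (homology f g).
Proof.
move=> f0 hinj hg; have gh w : g (h w) = 0 by apply/hg; exists w.
have hL : linear (fun w => cycle_class f (gh w)).
  move=> a w w'; have gE : g (a *: h w + h w') = 0 by rewrite linearP !gh scaler0 addr0.
  by rewrite -(cycle_class_linear _ _ _ gE); apply: cycle_class_eq; rewrite linearP.
exists (mk_linear hL); apply: inj_surj_bijective => [w w' /cycle_classP[x]|c].
  by rewrite f0 => /esym/eqP; rewrite subr_eq0 => /eqP/hinj.
have [y [gy ->]] := cycle_class_surj c; have /hg[w wy] := gy.
by exists w; apply: cycle_class_eq.
Qed.

(** The shape of Tor in degree 0, where everything is a cycle. The inverse picks preimages along
    [h], a choice that becomes linear only on classes. *)
Lemma homology_cokernel (h : {linear Y -> W}) :
    (forall y, g y = 0) -> Defs.surjective h -> (forall y, h y = 0 <-> exists x, f x = y) ->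
  lmod_iso (homology f g) W.
Proof.
move=> g0 hsurj hf; apply: lmod_iso_sym; have [s sK] := choice hsurj.
have sE w y : h y = w -> cycle_class f (g0 (s w)) = cycle_class f (g0 y).
  by move=> hy; apply/cycle_classP/hf; rewrite linearB sK hy subrr.
have sL : linear (fun w => cycle_class f (g0 (s w))).
  move=> a w w'; rewrite -(cycle_class_linear _ _ _ (g0 (a *: s w + s w'))).
  by apply: sE; rewrite linearP !sK.
exists (mk_linear sL); apply: inj_surj_bijective => [w w' /cycle_classP/hf|c].
  by rewrite linearB !sK => /eqP; rewrite subr_eq0 => /eqP.
have [y [gy ->]] := cycle_class_surj c; exists (h y).
by rewrite [LHS](sE _ y) //; apply: cycle_class_eq.
Qed.
End OneSidedHomology.

Section QuasiIso.
Variables (R : pzRingType) (X Y Z X' Y' Z' : lmodType R).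
Variables (f : {linear X -> Y}) (g : {linear Y -> Z}).
Variables (f' : {linear X' -> Y'}) (g' : {linear Y' -> Z'}).

(** [homology_map] uses the representative chosen by [quot_repr]; any other cycle of the class
    differs from it by a boundary, which [h] sends to a boundary. *)
Lemma homology_map_class (h : {linear Y -> Y'}) (hg : forall y, g y = 0 -> g' (h y) = 0)
    (hf : forall y, g y = 0 -> (exists x, f x = y) -> exists x', f' x' = h y)
    y (gy : g y = 0) :
  homology_map f' hg (cycle_class f gy) = cycle_class f' (hg _ gy).
Proof.
have /eqP gr := valP (quot_repr (cycle_class f gy)).
transitivity (cycle_class f' (hg _ gr)); first by congr quot_pi; apply: val_inj.
apply/cycle_classP; rewrite -linearB; apply/hf.
  by rewrite linearB gr gy subrr.
apply/(@cycle_classP _ _ _ _ f g _ _ gr gy).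
rewrite -[RHS]quot_reprK; congr quot_pi; exact: val_inj.
Qed.

(** A condition in one degree, on a map that need not extend to a chain map: [h] induces a
    well-defined, injective and surjective map on homology there. *)
Definition quasi_iso (h : {linear Y -> Y'}) :=
  [/\ forall y, g y = 0 -> g' (h y) = 0,
      forall y, g y = 0 -> (exists x', f' x' = h y) <-> (exists x, f x = y) &
      forall y', g' y' = 0 -> exists2 y, g y = 0 & exists x', f' x' = h y - y'].

Lemma quasi_iso_homology h : quasi_iso h -> lmod_iso (homology f g) (homology f' g').
Proof.
move=> [h1 h2 h3].
have h_class := homology_map_class h1 (fun y gy => (h2 y gy).2).
have hL : linear (homology_map f' h1 : homology f g -> homology f' g').
  move=> a c c'; have [y [gy ->]] := cycle_class_surj c.
  have [y' [gy' ->]] := cycle_class_surj c'.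
  have gay : g (a *: y + y') = 0 by rewrite linearP gy gy' scaler0 addr0.
  have gah : g' (a *: h y + h y') = 0 by rewrite linearP !h1 ?scaler0 ?addr0.
  rewrite -(cycle_class_linear f gy gy' gay) !h_class -(cycle_class_linear f' _ _ gah).
  by apply: cycle_class_eq; rewrite linearP.
exists (mk_linear hL); apply: inj_surj_bijective => [c c'|c'] /=.
  have [y [gy ->]] := cycle_class_surj c; have [y' [gy' ->]] := cycle_class_surj c'.
  rewrite !h_class => /cycle_classP; rewrite -linearB => /h2 E.
  by apply/cycle_classP/E; rewrite linearB gy gy' subrr.
have [y' [gy' ->]] := cycle_class_surj c'; have [y gy E] := h3 _ gy'.
by exists (cycle_class f gy); rewrite h_class; apply/cycle_classP.
Qed.

Lemma homotopy_quasi_iso (h : {linear Y -> Y'}) (h' : {linear Y' -> Y}) :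
    (forall y, g y = 0 -> g' (h y) = 0) -> (forall y, g' y = 0 -> g (h' y) = 0) ->
    (forall x, exists x', f' x' = h (f x)) -> (forall x', exists x, f x = h' (f' x')) ->
    (forall y, g y = 0 -> exists x, f x = h' (h y) - y) ->
    (forall y, g' y = 0 -> exists x, f' x = h (h' y) - y) ->
  quasi_iso h.
Proof.
move=> hk hk' hb hb' hh hh'; split=> // [y gy|y' gy']; last first.
  by exists (h' y'); [apply: hk'|apply: hh'].
split=> [[x' E]|[x <-] //].
have [x1 E1] := hb' x'; have [x2 E2] := hh _ gy; exists (x1 - x2).
by rewrite linearB E1 E2 E opprB addrC subrK.
Qed.
End QuasiIso.

Section HomComparison.
Variables (k : comNzRingType) (R : algType k).
Implicit Types M N : lmodType R.

Lemma hom_ext M N (f g : hom M N) : (forall x, hom_fun f x = hom_fun g x) -> f = g.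
Proof. by move=> fg; apply/val_inj/funext. Qed.
Lemma mk_hom_subproof M N (f : {linear M -> N}) : (f : M -> restrict N) \in @is_hom k R M N.
Proof. by apply/asboolP => a x y; rewrite linearP. Qed.
Definition mk_hom M N (f : {linear M -> N}) : hom M N :=
  @Submod _ _ (@is_hom k R M N) f (mk_hom_subproof f).

Lemma hom_fun_linear M N (f : hom M N) : hom_fun f =1 mk_linear (hom_linear f).
Proof. by []. Qed.
Lemma hom_fun0 M N (f : hom M N) : hom_fun f 0 = 0.
Proof. by rewrite hom_fun_linear linear0. Qed.
Lemma hom_funD M N (f : hom M N) x y : hom_fun f (x + y) = hom_fun f x + hom_fun f y.
Proof. by rewrite !hom_fun_linear linearD. Qed.
Lemma hom_funB M N (f : hom M N) x y : hom_fun f (x - y) = hom_fun f x - hom_fun f y.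
Proof. by rewrite !hom_fun_linear linearB. Qed.
Lemma hom_funZ M N (f : hom M N) a x : hom_fun f (a *: x) = a *: hom_fun f x.
Proof. by rewrite !hom_fun_linear linearZ. Qed.
Lemma hom_fun_sum M N (f : hom M N) n (x : 'I_n -> M) :
  hom_fun f (\sum_i x i) = \sum_i hom_fun f (x i).
Proof. by rewrite hom_fun_linear linear_sum. Qed.

Lemma hom_fun_add M N (f g : hom M N) x : hom_fun (f + g) x = hom_fun f x + hom_fun g x.
Proof. by []. Qed.
Lemma hom_fun_scale M N c (f : hom M N) x : hom_fun (c *: f) x = (c%:A : R) *: hom_fun f x.
Proof. by []. Qed.

Lemma hom_outP (P : chain R) N i (f : hom (P i) N) :
  hom_out P N i f = 0 <-> forall x, hom_fun f (chain_d P i x) = 0.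
Proof.
split=> [E x|E]; last by apply: hom_ext => x; apply: E.
by have := congr1 (fun u => hom_fun u x) E.
Qed.

Section Maps.
Variables (M : lmodType R) (P P' : chain R).
Variables (e : {linear P 0%N -> M}) (e' : {linear P' 0%N -> M}).

Lemma precomp_cocycle (F : aug_map e' e) N i (f : hom (P i) N) :
  hom_out P N i f = 0 -> hom_out P' N i (precomp (F i.+1) f) = 0.
Proof.
move=> /hom_outP E; apply/hom_outP => x.
rewrite -[LHS]/(hom_fun f (F i.+1 (aug_d e' i.+1 x))) -aug_comm; exact: E.
Qed.
Lemma precomp_coboundary (F : aug_map e' e) N i x :
  exists x', hom_in P' N i x' = precomp (F i.+1) (hom_in P N i x).
Proof.
case: i x => [|i] x; first by exists 0; rewrite !linear0.
exists (precomp (F i.+1) x); apply: hom_ext => y.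
by rewrite -[LHS]/(hom_fun x (F i.+1 (aug_d e' i.+1 y))) -aug_comm.
Qed.
End Maps.

Lemma precomp_homotopy M (P : chain R) (e : {linear P 0%N -> M}) (F : aug_map e e) N i
    (f : hom (P i) N) :
    proj_resolution e -> (forall x, F 0%N x = x) ->
  hom_out P N i f = 0 -> exists x, hom_in P N i x = precomp (F i.+1) f - f.
Proof.
move=> eP F0 /hom_outP fd.
have [s [s0 sP]] := @homotopy_exists _ _ _ _ _ e e eP eP F (aug_id e) F0.
(* In degree 0 there are no coboundaries, so the two cocycles must be equal: [s 0] is zero, and [f]
   kills the remaining term of the homotopy. *)
case: i f fd => [|i] f fd.
  exists 0; apply: hom_ext => x.
  rewrite -[RHS]/(hom_fun f (F 1%N x) - hom_fun f x) -hom_funB.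
  have := sP 0%N x; rewrite s0 addr0 /= => ->; rewrite -[RHS]/(hom_fun f _).
  by rewrite fd.
exists (precomp (s i.+1) f); apply: hom_ext => x.
rewrite -[RHS]/(hom_fun f (F i.+2 x) - hom_fun f x) -hom_funB.
have /= -> := sP i.+1 x.
by rewrite hom_funD fd add0r.
Qed.

(** An explicit chain map rather than bare isomorphisms of homology: the augmentation of the dual
    complex is built from it, and its linearity is checked on cocycles. *)
Lemma hom_comparison M (P P' : chain R) (e : {linear P 0%N -> M}) (e' : {linear P' 0%N -> M}) :
    proj_resolution e -> proj_resolution e' ->
  exists F : aug_map e' e, forall N i,
    quasi_iso (hom_in P N i) (hom_out P N i) (hom_in P' N i) (hom_out P' N i)
      (precomp (F i.+1)).
Proof.
move=> eP eP'.
have [F F0] := comparison_exists eP' eP idfun.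
have [G G0] := comparison_exists eP eP' idfun.
exists F => N i; apply: (@homotopy_quasi_iso _ _ _ _ _ _ _ _ _ _ _ _ (precomp (G i.+1))).
- exact: precomp_cocycle.
- exact: precomp_cocycle.
- exact: precomp_coboundary.
- exact: precomp_coboundary.
- move=> f /(@precomp_homotopy _ _ _ (aug_comp F G) _ _ _ eP)[|x E].
    by move=> x; rewrite /= G0 F0.
  by exists x; rewrite E; congr (_ - _); apply: hom_ext.
- move=> f /(@precomp_homotopy _ _ _ (aug_comp G F) _ _ _ eP')[|x E].
    by move=> x; rewrite /= G0 F0.
  by exists x; rewrite E; congr (_ - _); apply: hom_ext.
Qed.
End HomComparison.

Section ExtMap.
Variables (k : comNzRingType) (R : algType k) (X N N' : lmodType R).

Lemma ext_map_class (g : {linear N -> N'}) i y (gy : hom_out (std_res X) N i y = 0) :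
  ext_map g (cycle_class (hom_in (std_res X) N i) gy) =
  cycle_class (hom_in (std_res X) N' i) (ext_map_subproof g gy).
Proof.
apply: homology_map_class => {gy}y gy [x <-].
case: i x {y gy} => [|i] x; last by exists (postcomp g x); apply: hom_ext.
by exists 0; apply: hom_ext => y; apply: (esym (linear0 g)).
Qed.

(** Lets a formula for right multiplication by pure tensors extend to all of [env A]. *)
Lemma ext_mapD (g g' g'' : {linear N -> N'}) i (x : ext X N i) :
  (forall n, g n = g' n + g'' n) -> ext_map g x = ext_map g' x + ext_map g'' x.
Proof.
move=> gE; have [y [gy ->]] := cycle_class_surj x; rewrite !ext_map_class.
rewrite -[X in _ = X + _]scale1r.
have E : hom_out (std_res X) N' i (1 *: postcomp g' y + postcomp g'' y) = 0.
  by rewrite linearP !ext_map_subproof // scaler0 addr0.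
rewrite -(cycle_class_linear _ _ _ E); apply: cycle_class_eq; rewrite scale1r.
by apply: hom_ext => z; apply: gE.
Qed.
End ExtMap.

Section TensorComparison.
Variables (k : comNzRingType) (R : algType k).
Implicit Types (M : lmodType R^c) (N : lmodType R).

Definition rtens M N (m : M) (n : N) : rtensor M N :=
  tens (fun a : R => *:%R (a : R^c) : {additive M -> M})
       (fun a : R => @restrict_act k R N a : {linear restrict N -> restrict N}) m n.

Lemma rtensDl M N (m m' : M) (n : N) : rtens (m + m') n = rtens m n + rtens m' n.
Proof. exact: tensDl. Qed.
Lemma rtensDr M N (m : M) (n n' : N) : rtens m (n + n') = rtens m n + rtens m n'.
Proof. exact: tensDr. Qed.
Lemma rtensA M N (r : R) (m : M) (n : N) : rtens ((r : R^c) *: m) n = rtens m (r *: n).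
Proof. exact: (@tens_bal _ _ _ _ _ _ r). Qed.
Lemma rtensZ M N (c : k) (m : M) (n : N) : c *: rtens m n = rtens m ((c%:A : R) *: n).
Proof. by rewrite /rtens -[LHS]tensZr. Qed.
Lemma rtensor_ind M N (T : rtensor M N -> Prop) :
  T 0 -> (forall m n t, T t -> T (rtens m n + t)) -> forall t, T t.
Proof. exact: (@tensor_ind k M (restrict N) R _ _ T). Qed.
Lemma rtens0l M N (n : N) : rtens (0 : M) n = 0.
Proof. by apply: (addrI (rtens (0 : M) n)); rewrite -rtensDl !addr0. Qed.
Lemma rtens0r M N (m : M) : rtens m (0 : N) = 0.
Proof. by apply: (addrI (rtens m (0 : N))); rewrite -rtensDr !addr0. Qed.

Lemma rtensor_mapE M M' N (g : {linear M -> M'}) (m : M) (n : N) :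
  rtensor_map g (rtens m n) = rtens (g m) n.
Proof.
apply: tliftE; split=> [x x' y|x y y'|a x y].
- by rewrite linearD tensDl.
- by rewrite tensDr.
- by rewrite [g _]linearZ; apply: tens_bal.
Qed.

Lemma rtensor_map_ext M M' N (g g' : {linear M -> M'}) (t : rtensor M N) :
  (forall m, g m = g' m) -> rtensor_map g t = rtensor_map g' t.
Proof. by move=> gg; apply: tlift_ext => m n; rewrite gg. Qed.
Lemma rtensor_map_id M N (t : rtensor M N) : rtensor_map idfun t = t.
Proof.
elim/rtensor_ind: t => [|m n t IHt]; first by rewrite linear0.
by rewrite linearD /= IHt; congr (_ + _); rewrite rtensor_mapE.
Qed.
Lemma rtensor_map_comp M M' M'' N (h : {linear M' -> M''}) (g : {linear M -> M'})
  (t : rtensor M N) : rtensor_map (h \o g) t = rtensor_map h (rtensor_map g t).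
Proof.
elim/rtensor_ind: t => [|m n t IHt]; first by rewrite !linear0.
by rewrite !linearD /= IHt; congr (_ + _); rewrite !rtensor_mapE.
Qed.
Lemma rtensor_mapB M M' N (h g : {linear M -> M'}) (t : rtensor M N) :
  rtensor_map (h \- g) t = rtensor_map h t - rtensor_map g t.
Proof.
elim/rtensor_ind: t => [|m n t IHt]; first by rewrite !linear0 addr0.
rewrite !linearD /= IHt addrACA; congr (_ + _); rewrite !rtensor_mapE /= rtensDl.
congr (_ + _); apply/eqP; rewrite -addr_eq0 -rtensDl addNr; apply/eqP; exact: rtens0l.
Qed.
Lemma rtensor_mapD M M' N (h g : {linear M -> M'}) (t : rtensor M N) :
  rtensor_map (h \+ g) t = rtensor_map h t + rtensor_map g t.
Proof.
elim/rtensor_ind: t => [|m n t IHt]; first by rewrite !linear0 addr0.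
by rewrite !linearD /= IHt addrACA; congr (_ + _); rewrite !rtensor_mapE /= rtensDl.
Qed.
Lemma rtensor_map0 M M' N (g : {linear M -> M'}) (t : rtensor M N) :
  (forall m, g m = 0) -> rtensor_map g t = 0.
Proof.
move=> g0; elim/rtensor_ind: t => [|m n t IHt]; first by rewrite !linear0.
by rewrite linearD /= IHt addr0 rtensor_mapE g0 rtens0l.
Qed.
Lemma rtensor_zero M N (t : rtensor M N) : is_zero_module M -> t = 0.
Proof. by move=> M0; rewrite -(rtensor_map_id t); apply: rtensor_map0 => m; apply: M0. Qed.

Section Maps.
Variables (M : lmodType R^c) (P P' : chain R^c).
Variables (e : {linear P 0%N -> M}) (e' : {linear P' 0%N -> M}).

Lemma rtensor_map_boundary (F : aug_map e e') N i (x : rtensor (P i.+1) N) :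
  rtensor_map (F i.+1) (tensor_in P N i x) = tensor_in P' N i (rtensor_map (F i.+2) x).
Proof.
rewrite /tensor_in /= -!rtensor_map_comp.
apply: (@rtensor_map_ext _ _ _ (F i.+1 \o chain_d P i) (chain_d P' i \o F i.+2)) => m /=.
exact: (esym (@aug_comm _ _ _ _ _ _ _ F i.+1 m)).
Qed.
Lemma rtensor_map_cycle (F : aug_map e e') N i (x : rtensor (P i) N) :
  tensor_out P N i x = 0 -> tensor_out P' N i (rtensor_map (F i.+1) x) = 0.
Proof.
case: i x => [//|i] x tx.
by rewrite -[LHS](rtensor_map_boundary F x) [tensor_in _ _ _ _]tx linear0.
Qed.
End Maps.

Lemma rtensor_homotopy M (P : chain R^c) (e : {linear P 0%N -> M}) (F : aug_map e e) N i
    (x : rtensor (P i) N) :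
    proj_resolution e -> (forall y, F 0%N y = y) ->
  tensor_out P N i x = 0 -> exists y, tensor_in P N i y = rtensor_map (F i.+1) x - x.
Proof.
move=> eP F0 tx.
have [s [s0 sP]] := @homotopy_exists _ _ _ _ _ e e eP eP F (aug_id e) F0.
exists (rtensor_map (s i.+1) x).
transitivity (rtensor_map ((F i.+1 : {linear P i -> P i}) \- idfun) x); last first.
  by rewrite rtensor_mapB rtensor_map_id.
transitivity (rtensor_map ((chain_d P i \o s i.+1) \+ (s i \o aug_d e i)) x); last first.
  by apply: rtensor_map_ext => m; exact: (esym (sP i m)).
rewrite rtensor_mapD rtensor_map_comp -[LHS]addr0; congr (_ + _).
case: i x tx => [|i] x tx; first by rewrite rtensor_map0 // => m; apply: s0.
by rewrite rtensor_map_comp [rtensor_map (aug_d e _) x]tx linear0.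
Qed.

Lemma tensor_comparison M (P P' : chain R^c) (e : {linear P 0%N -> M})
    (e' : {linear P' 0%N -> M}) : proj_resolution e -> proj_resolution e' ->
  exists F : aug_map e e', forall N i,
    quasi_iso (tensor_in P N i) (tensor_out P N i) (tensor_in P' N i) (tensor_out P' N i)
      (@rtensor_map _ _ _ _ N (F i.+1)).
Proof.
move=> eP eP'.
have [F F0] := comparison_exists eP eP' idfun.
have [G G0] := comparison_exists eP' eP idfun.
exists F => N i.
apply: (@homotopy_quasi_iso _ _ _ _ _ _ _ _ _ _ _ _ (@rtensor_map _ _ _ _ N (G i.+1))).
- exact: rtensor_map_cycle.
- exact: rtensor_map_cycle.
- by move=> x; exists (rtensor_map (F i.+2) x); exact: (esym (rtensor_map_boundary F x)).
- by move=> x; exists (rtensor_map (G i.+2) x); exact: (esym (rtensor_map_boundary G x)).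
- move=> x /(@rtensor_homotopy _ _ _ (aug_comp G F) _ _ _ eP)[|y E].
    by move=> y; rewrite /= G0 F0.
  by exists y; rewrite E; congr (_ - _); exact: rtensor_map_comp.
- move=> x /(@rtensor_homotopy _ _ _ (aug_comp F G) _ _ _ eP')[|y E].
    by move=> y; rewrite /= G0 F0.
  by exists y; rewrite E; congr (_ - _); exact: rtensor_map_comp.
Qed.
End TensorComparison.

(** * Duality between Ext and Tor *)

Section Dual.
Variables (k : fieldType) (R : algType k) (w : {lrmorphism R -> R}).
Implicit Types (P : lmodType R).

(** Hom(P, R) as a right R-module on which r acts as right multiplication by its image under [v];
    recording [v] in the type lets this structure be inferred. *)
Definition dual (v : R -> R) P : Type := hom P (R^o : lmodType R).
HB.instance Definition _ v P := GRing.Zmodule.on (dual v P).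

Definition right_mul (x : R) : {linear R^o -> R^o} := x \o* idfun.

Definition dual_scale P (r : R^c) (f : dual w P) : dual w P :=
  postcomp (right_mul (w (r : R))) (f : hom P (R^o : lmodType R)).
Definition dual_fun P (f : dual w P) : P -> R := hom_fun (f : hom P (R^o : lmodType R)).

Lemma dual_ext P (f g : dual w P) : (forall x, dual_fun f x = dual_fun g x) -> f = g.
Proof. by move=> fg; apply: (@hom_ext k R P (R^o : lmodType R)). Qed.
Lemma dual_funD P (f g : dual w P) x : dual_fun (f + g) x = dual_fun f x + dual_fun g x.
Proof. by []. Qed.
Lemma dual_fun_scale P r (f : dual w P) x : dual_fun (dual_scale r f) x = dual_fun f x * w r.
Proof. by []. Qed.

Lemma dual_scaleA P a b (f : dual w P) :
  dual_scale a (dual_scale b f) = dual_scale (a * b) f.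
Proof. by apply: dual_ext => x; rewrite !dual_fun_scale -mulrA -rmorphM. Qed.
Lemma dual_scale1 P : left_id 1 (@dual_scale P).
Proof. by move=> f; apply: dual_ext => x; rewrite dual_fun_scale rmorph1 mulr1. Qed.
Lemma dual_scaleDr P : right_distributive (@dual_scale P) +%R.
Proof.
by move=> r f g; apply: dual_ext => x; rewrite !(dual_funD, dual_fun_scale) mulrDl.
Qed.
Lemma dual_scaleDl P f : {morph (@dual_scale P)^~ f : a b / a + b}.
Proof.
move=> a b; apply: dual_ext => x.
by rewrite dual_funD !dual_fun_scale -mulrDr -rmorphD.
Qed.
HB.instance Definition _ P := GRing.Zmodule_isLmodule.Build R^c (dual w P)
  (@dual_scaleA P) (@dual_scale1 P) (@dual_scaleDr P) (@dual_scaleDl P).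

Lemma dual_funZ P (r : R^c) (f : dual w P) x : dual_fun (r *: f) x = dual_fun f x * w r.
Proof. by []. Qed.
Lemma dual_fun_sum P n (f : 'I_n -> dual w P) x :
  dual_fun (\sum_i f i) x = \sum_i dual_fun (f i) x.
Proof.
elim/big_rec2: _ => [//|i y g _ IH]; by rewrite dual_funD IH.
Qed.

Lemma dual_fun_linear P (f : dual w P) a x y :
  dual_fun f (a *: x + y) = a * dual_fun f x + dual_fun f y.
Proof. exact: (hom_linear (f : hom P (R^o : lmodType R))). Qed.
Lemma dual_fun0r P (f : dual w P) : dual_fun f 0 = 0.
Proof. exact: (@hom_fun0 k R P (R^o : lmodType R)). Qed.
Lemma dual_fun_sumr P (f : dual w P) n (c : 'I_n -> R) (x : 'I_n -> P) :
  dual_fun f (\sum_i c i *: x i) = \sum_i c i * dual_fun f (x i).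
Proof.
elim/big_rec2: _ => [|i y z _ <-]; [exact: dual_fun0r|exact: dual_fun_linear].
Qed.

Definition dual_map P P' (g : {linear P -> P'}) (f : dual w P') : dual w P :=
  precomp g (f : hom P' (R^o : lmodType R)).
Lemma dual_map_linear P P' (g : {linear P -> P'}) : linear (dual_map g).
Proof. by move=> a f f'; apply: dual_ext. Qed.
HB.instance Definition _ P P' (g : {linear P -> P'}) :=
  GRing.isLinear.Build R^c (dual w P') (dual w P) *:%R (dual_map g) (dual_map_linear g).

Lemma dual_zero P : is_zero_module P -> is_zero_module (dual w P).
Proof. by move=> P0 f; apply: dual_ext => x; rewrite (P0 x) !dual_fun0r. Qed.

(** The two halves of a dual basis swap roles: the functionals generate, and the evaluations at the
    [x i] are coordinates. Composing with [w'] makes evaluation linear for the twisted action. *)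
Lemma dual_basis_dual (w' : {lrmorphism R -> R}) P : cancel w w' -> cancel w' w ->
  dual_basis P -> dual_basis (dual w P : lmodType R^c).
Proof.
move=> wK w'K [n [x [f xf]]].
pose ev (i : 'I_n) (g : dual w P) : R^c^o := w' (dual_fun g (x i)).
have evL i : linear (ev i).
  by move=> a g h; rewrite /ev dual_funD dual_funZ rmorphD rmorphM /= wK.
exists n, (fun i => mk_hom (f i) : dual w P), (fun i => mk_linear (evL i)) => g.
apply: dual_ext => y; rewrite dual_fun_sum.
rewrite {1}(xf y) dual_fun_sumr.
by apply: eq_bigr => i _; rewrite dual_funZ /= /ev w'K.
Qed.
End Dual.

Section Pairing.
Variables (k : fieldType) (R : algType k) (w w' : {lrmorphism R -> R}).
Hypotheses (wK : cancel w w') (w'K : cancel w' w).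
Variables (M N : lmodType R) (t : {additive M -> N}) (t' : N -> M).
Hypotheses (tK : cancel t t') (t'K : cancel t' t).
Hypothesis t_scale : forall r m, t (r *: m) = w r *: t m.
Implicit Types P : lmodType R.

Lemma pairing_linear P (f : dual w P) (m : M) :
  linear (fun x => dual_fun f x *: t m : N).
Proof.
move=> a x y; rewrite scalerA -scalerDl; congr (_ *: _).
exact: dual_fun_linear.
Qed.
(** The canonical map Hom(P, R) (x) M -> Hom(P, N), composed with [t]. The semilinearity of [t]
    absorbs the twist of the dual, which is what makes it balanced. *)
Definition pairing_tens P (f : dual w P) (m : restrict M) : hom P N :=
  mk_hom (mk_linear (pairing_linear f m)).

Lemma pairing_tensE P (f : dual w P) m x :
  hom_fun (pairing_tens f m) x = dual_fun f x *: t m.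
Proof. by []. Qed.

Lemma pairing_balanced P : balanced
  (fun r : R => *:%R (r : R^c) : {additive dual w P -> dual w P})
  (fun r : R => @restrict_act k R M r : {linear restrict M -> restrict M})
  (@pairing_tens P).
Proof.
split=> [f g m|f m n|r f m]; apply: hom_ext => x;
  rewrite ?hom_fun_add !pairing_tensE.
- by rewrite dual_funD scalerDl.
- by rewrite raddfD scalerDr.
- by rewrite dual_funZ t_scale scalerA.
Qed.

Definition pairing_fun P : rtensor (dual w P) M -> hom P N := tlift (@pairing_tens P).

Lemma pairing_is_linear P : linear (@pairing_fun P).
Proof.
apply: tlift_linear => [|c f m]; first exact: pairing_balanced.
apply: hom_ext => x; rewrite hom_fun_scale !pairing_tensE.
have -> : t (c *: m) = (c%:A : R) *: t m.
  by rewrite [t _](t_scale (c%:A) (m : M)) linearZ /= rmorph1.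
by rewrite !scalerA -scalerAr mulr1 -scalerAl mul1r.
Qed.
Definition pairing P : {linear rtensor (dual w P) M -> hom P N} :=
  mk_linear (@pairing_is_linear P).
Arguments pairing {P} : simpl never.

Lemma pairingD P (x y : rtensor (dual w P) M) : pairing (x + y) = pairing x + pairing y.
Proof. exact: linearD. Qed.

Lemma pairingE P (f : dual w P) (m : M) : pairing (rtens f m) = pairing_tens f m.
Proof. by apply: tliftE; apply: pairing_balanced. Qed.

Lemma pairing_natural P P' (g : {linear P -> P'}) (x : rtensor (dual w P') M) :
  pairing (rtensor_map (dual_map g) x) = precomp g (pairing x).
Proof.
elim/rtensor_ind: x => [|f m x IHx]; first by rewrite !linear0.
have -> : rtensor_map (dual_map g) (rtens f m + x) =
    rtens (dual_map g f) m + rtensor_map (dual_map g) x.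
  by rewrite linearD /= rtensor_mapE.
rewrite !pairingD [RHS]linearD; congr (_ + _); last exact: IHx.
by rewrite !pairingE; apply: hom_ext.
Qed.

(** The inverse expands a map along a dual basis. On g (x) m it gives the sum of the d_i (x)
    w'(g(x_i)) m; moving the scalars to the left factor reassembles g from its values g(x_i). *)
Lemma pairing_bijective P : dual_basis P -> bijective (pairing (P := P)).
Proof.
move=> [n [x [f xf]]].
pose d i : dual w P := mk_hom (f i).
have dP y : y = \sum_i dual_fun (d i) y *: x i by rewrite {1}(xf y).
exists (fun u => \sum_i rtens (d i) (t' (hom_fun u (x i)))) => [y|u]; last first.
  rewrite linear_sum; apply: hom_ext => y /=.
  rewrite {2}(dP y) hom_fun_sum.
  transitivity (\sum_i hom_fun (pairing (rtens (d i) (t' (hom_fun u (x i))))) y).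
    by elim/big_rec2: _ => [//|i u1 u2 _ IH]; rewrite hom_fun_add IH.
  by apply: eq_bigr => i _; rewrite pairingE pairing_tensE hom_funZ t'K.
elim/rtensor_ind: y => [|g m y IHy].
  rewrite big1 // => i _; rewrite linear0.
  have -> : t' (hom_fun (0 : hom P N) (x i)) = 0.
    by apply: (can_inj tK); rewrite t'K raddf0.
  exact: rtens0r.
rewrite pairingD -[RHS](congr1 (+%R _) IHy).
transitivity (\sum_i (rtens (d i) (t' (hom_fun (pairing (rtens g m)) (x i))) +
                      rtens (d i) (t' (hom_fun (pairing y) (x i))))).
  apply: eq_bigr => i _; rewrite -rtensDr; congr rtens.
  by apply: (can_inj tK); rewrite raddfD !t'K.
rewrite big_split; congr (_ + _).
transitivity (rtens (\sum_i ((w' (dual_fun g (x i)) : R^c) *: d i)) m); last first.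
  congr rtens; apply: dual_ext => z; rewrite dual_fun_sum.
  rewrite [in RHS](dP z) dual_fun_sumr; apply: eq_bigr => i _.
  by rewrite dual_funZ w'K.
transitivity (\sum_i rtens ((w' (dual_fun g (x i)) : R^c) *: d i) m).
  apply: eq_bigr => i _; rewrite rtensA; congr rtens.
  by apply: (can_inj tK); rewrite t'K pairingE pairing_tensE t_scale w'K.
elim/big_rec2: _ => [|i y1 y2 _ ->]; first by rewrite rtens0l.
by rewrite rtensDl.
Qed.
End Pairing.
Arguments pairing {k R w M N t} t_scale {P} : simpl never.

Section Duality.
Variables (k : fieldType) (R : algType k) (w w' : {lrmorphism R -> R}).
Hypotheses (wK : cancel w w') (w'K : cancel w' w).
Variables (X : lmodType R) (d : nat).
Variables (P : chain R) (e : {linear P 0%N -> X}).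
Hypotheses (eP : proj_resolution e) (Pb : forall i, dual_basis (P i)).
Hypothesis P0 : forall i, (d < i)%N -> is_zero_module (P i).
Variables (Y : lmodType R^c) (phi : {additive ext X (R^o : lmodType R) d -> Y}).
Hypothesis phi_bij : bijective phi.
Hypothesis phi_scale : forall (r : R) x,
  phi (ext_map (right_mul (w r)) x) = (r : R^c) *: phi x.
Hypothesis ext_vanish : forall i, i <> d -> is_zero_module (ext X (R^o : lmodType R) i).

(* The dual complex shifted by one, with the zero module P_(d+1) dualised in
   degree 0; dual_res reverses it, so that dual_res j is the dual of P_(d-j)
   for j <= d and zero beyond. *)
Definition dual_ob i : lmodType R^c := dual w (if i is j.+1 then P j else P d.+1).
Definition dual_d i : {linear dual_ob i -> dual_ob i.+1} :=
  match i return {linear dual_ob i -> dual_ob i.+1} with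
  | 0 => \0
  | j.+1 => dual_map (chain_d P j)
  end.

(* The differential from degree a to degree b when b = a.+1, and 0 otherwise:
   this avoids casts along equations between degrees. *)
Definition dual_dif a b : {linear dual_ob a -> dual_ob b} :=
  match a.+1 =P b with
  | ReflectT ab => eq_rect _ (fun b => {linear dual_ob a -> dual_ob b}) (dual_d a) _ ab
  | ReflectF _ => \0
  end.
Lemma dual_difE a : dual_dif a a.+1 = dual_d a.
Proof. by rewrite /dual_dif; case: eqP => // aa; rewrite (eq_irrelevance aa erefl). Qed.

Definition dual_res : chain R^c :=
  @Chain R^c (fun j => dual_ob (d.+1 - j)) (fun j => dual_dif (d.+1 - j.+1) (d.+1 - j)).

Lemma dual_ob0 b : b = 0%N -> is_zero_module (dual_ob b).
Proof. by move=> ->; apply: dual_zero; apply: P0. Qed.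

Lemma dual_res_projective j : projective (dual_res j).
Proof.
apply: dual_basis_projective; apply: dual_basis_dual wK w'K _.
by case: (d.+1 - j)%N => [|i]; apply: Pb.
Qed.

(** In degree 0 the two incoming maps start from different placeholders, but both are zero. *)
Lemma dual_dP i (y : dual_ob i.+1) :
  (exists x, dual_d i x = y) <-> (exists x, hom_in P (R^o : lmodType R) i x = y).
Proof. by case: i y => [|i] y; split=> -[x <-]; [exists 0|exists 0|exists x|exists x]. Qed.

Lemma ext_resolution (N : lmodType R) i :
  lmod_iso (homology (hom_in P N i) (hom_out P N i)) (ext X N i).
Proof.
have [F FP] := hom_comparison eP (std_res_proj X).
exact: quasi_iso_homology (FP N i).
Qed.

Lemma ext_above (N : lmodType R) i : (d < i)%N -> is_zero_module (ext X N i).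
Proof.
move=> di; apply: (lmod_iso_zero (lmod_iso_sym (ext_resolution N i))).
apply/zero_homologyP => y _; exists 0; apply: hom_ext => x.
by rewrite (P0 di x) !hom_fun0.
Qed.

(** Exactness at [dual_ob i.+1], the dual of [P i], is the vanishing of Ext^i(X, R). *)
Lemma dual_d_exact i : i <> d -> exact_at (dual_d i) (dual_d i.+1).
Proof.
move=> /ext_vanish ext0 y.
have /zero_homologyP h := lmod_iso_zero (ext_resolution _ i) ext0.
split=> [/h/dual_dP //|/dual_dP[x <-]].
case: i x {ext0 h y} => [|i] x; first exact: (linear0 (dual_d 1)).
pose u : dual w (P i.+2) := dual_map (chain_d P i.+1) (dual_map (chain_d P i) (x : dual w (P i))).
rewrite -[LHS]/u; apply: (@dual_ext _ _ _ _ u 0) => z.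
have -> : dual_fun u z = dual_fun (x : dual w (P i)) (chain_d P i (chain_d P i.+1 z)) by [].
have -> : chain_d P i (chain_d P i.+1 z) = 0 by apply/(proj_res_exact eP); exists z.
exact: dual_fun0r.
Qed.

(** The degrees are variables tied by equations, as the subtractions in [dual_res] do not reduce.
    The case [b = 0] is the range beyond the length of the complex. *)
Lemma dual_dif_exact a b c :
    (b = 0%N \/ exists i, [/\ a = i, b = i.+1, c = i.+2 & i <> d]) ->
  exact_at (dual_dif a b) (dual_dif b c).
Proof.
case=> [b0|[i [-> -> -> id]]]; last by rewrite !dual_difE; apply: dual_d_exact.
have Z := dual_ob0 b0 => y; split=> _; last by rewrite (Z y) linear0.
by exists 0; apply: etrans (Z _) (esym (Z y)).
Qed.

Let std := std_res X.
Lemma comparison_map : exists F : aug_map (free_cover X : {linear std 0%N -> X}) e, forall N i,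
  quasi_iso (hom_in P N i) (hom_out P N i) (hom_in std N i) (hom_out std N i)
    (precomp (F i.+1)).
Proof. exact: hom_comparison eP (std_res_proj X). Qed.
Let F := sval (cid comparison_map).
Let FP := svalP (cid comparison_map).

Lemma top_cocycle (f : dual w (P d)) : hom_out P (R^o : lmodType R) d f = 0.
Proof. by apply/hom_outP => x; rewrite (P0 (ltnSn d) x) linear0 hom_fun0. Qed.

(** Every functional on [P d] is a cocycle, [P d.+1] being zero; [F] carries its class to the
    standard resolution, on which [ext] is defined. *)
Definition top_class (f : dual w (P d)) : ext X (R^o : lmodType R) d :=
  cycle_class (hom_in std (R^o : lmodType R) d) (precomp_cocycle F (top_cocycle f)).

Lemma top_classD f g : top_class (f + g) = top_class f + top_class g.
Proof.
rewrite /top_class -[cycle_class _ (precomp_cocycle _ (top_cocycle f))]scale1r.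
have E : hom_out std (R^o : lmodType R) d
    (1 *: precomp (F d.+1) (f : hom _ _) + precomp (F d.+1) (g : hom _ _)) = 0.
  rewrite linearP [X in _ *: X + _](precomp_cocycle F (top_cocycle f)).
  by rewrite [X in _ + X](precomp_cocycle F (top_cocycle g)) scaler0 addr0.
rewrite -(cycle_class_linear _ _ _ E); apply: cycle_class_eq.
by rewrite scale1r; apply: linearD.
Qed.

(** Right multiplication is composed after the functional and [F] before it, so the two commute. *)
Lemma top_classZ (r : R^c) f : top_class (r *: f) = ext_map (right_mul (w r)) (top_class f).
Proof.
rewrite /ext_map /top_class homology_map_class => [|y gy [x <-]].
  by apply: cycle_class_eq; apply: hom_ext.
case: (d) x {y gy} => [|i] x; first by exists 0; rewrite !linear0.
by exists (postcomp (right_mul (w r)) x); apply: hom_ext.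
Qed.

Definition top_aug (f : dual w (P d)) : Y := phi (top_class f).
Lemma top_aug_linear : linear top_aug.
Proof.
by move=> r f g; rewrite /top_aug top_classD raddfD top_classZ phi_scale.
Qed.
Definition dual_aug : {linear dual_res 0%N -> Y} := mk_linear top_aug_linear.

Lemma top_class0 f : top_class f = 0 <-> exists x, hom_in P (R^o : lmodType R) d x = f.
Proof.
have [_ FI _] := FP (R^o : lmodType R) d.
have Z : 0 = cycle_class (hom_in std (R^o : lmodType R) d)
    (linear0 (hom_out std (R^o : lmodType R) d)).
  rewrite /cycle_class -[LHS](linear0 (quot_pi (boundary
    (hom_in std (R^o : lmodType R) d) (hom_out std (R^o : lmodType R) d)))).
  congr quot_pi; exact: val_inj.
apply: iff_trans (FI _ (top_cocycle f)).
rewrite {1}Z; split=> [/cycle_classP|h]; first by rewrite subr0.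
by apply/cycle_classP; rewrite subr0.
Qed.

Lemma phi_eq0 x : phi x = 0 <-> x = 0.
Proof. by split=> [h|->]; [apply: (bij_inj phi_bij); rewrite h|]; rewrite raddf0. Qed.

Lemma dual_aug_exact a : a = d -> exact_at (dual_dif a d.+1) dual_aug.
Proof.
move=> -> f; rewrite dual_difE.
exact: iff_trans (phi_eq0 _) (iff_trans (top_class0 f) (iff_sym (dual_dP _))).
Qed.

(** At the end, Ext^d(X, R) is the cokernel of the last dual differential, and [phi] identifies it
    with [Y]; everywhere else exactness is the vanishing of Ext. *)
Lemma dual_resolution : proj_resolution dual_aug.
Proof.
have [_ _ FS] := FP (R^o : lmodType R) d.
split=> [j|y|f|j].
- exact: dual_res_projective.
- have [psi phiK psiK] := phi_bij.
  have [g [gd E]] := cycle_class_surj (psi y).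
  have [f _ fg] := FS _ gd; exists f.
  rewrite -[RHS]psiK E; congr (phi _); exact/cycle_classP.
- by apply: dual_aug_exact; rewrite subn1.
- apply: dual_dif_exact; rewrite !subSS.
  (* Below the length, degree [j.+1] of [dual_res] is the dual of [P (d - j.+1)], so the Ext group
     concerned has degree less than [d]. *)
  have [dj|jd] := leqP d j; first by left; apply/eqP; rewrite subn_eq0.
  right; exists (d - j.+1)%N; split=> //.
  + by rewrite -subSn // subSS.
  + by rewrite -!subSn ?subSS // ltnW.
  + by move=> E; lia.
Qed.

Lemma tor_resolution (M : lmodType R) j :
  lmod_iso (tor Y M j) (homology (tensor_in dual_res M j) (tensor_out dual_res M j)).
Proof.
have [G GP] := tensor_comparison (std_res_proj Y) dual_resolution.
exact: quasi_iso_homology (GP M j).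
Qed.

Lemma tor_above (M : lmodType R) j : (d < j)%N -> is_zero_module (tor Y M j).
Proof.
move=> dj; apply: (lmod_iso_zero (tor_resolution M j)).
apply/zero_homologyP => y _; exists 0; rewrite linear0; apply/esym/rtensor_zero.
by apply: dual_ob0; apply/eqP; rewrite subn_eq0.
Qed.

Section Coefficients.
Variables (M N : lmodType R) (t : {additive M -> N}) (t' : N -> M).
Hypotheses (tK : cancel t t') (t'K : cancel t' t).
Hypothesis t_scale : forall r m, t (r *: m) = w r *: t m.

Lemma pairing_cocycle i (y : rtensor (dual_ob i.+1) M) :
  rtensor_map (dual_dif i.+1 i.+2) y = 0 <-> hom_out P N i (pairing t_scale y) = 0.
Proof.
rewrite dual_difE; have E := pairing_natural t_scale (chain_d P i) y.
split=> [y0|]; first by rewrite -[LHS]E [rtensor_map _ _]y0 linear0.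
move=> h; apply: (bij_inj (pairing_bijective w'K tK t'K t_scale (Pb i.+1))).
by rewrite [LHS]E [LHS]h linear0.
Qed.

Lemma pairing_coboundary i (y : rtensor (dual_ob i.+1) M) :
  (exists x, rtensor_map (dual_dif i i.+1) x = y) <->
  (exists x, hom_in P N i x = pairing t_scale y).
Proof.
have inj := bij_inj (pairing_bijective w'K tK t'K t_scale (Pb i)).
rewrite dual_difE; case: i y inj => [|i] y inj.
  split=> [[x <-]|[x E]]; exists 0; first by rewrite rtensor_map0 // !linear0.
  by apply: inj; rewrite -E !linear0.
split=> [[x <-]|[u E]].
  by exists (pairing t_scale x); rewrite pairing_natural.
have [q _ qK] := pairing_bijective w'K tK t'K t_scale (Pb i).
exists (q u); apply: inj; rewrite pairing_natural qK; exact: E.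
Qed.

Lemma homology_reversed i a b c : a = i -> b = i.+1 -> c = i.+2 ->
  lmod_iso (homology (@rtensor_map _ _ _ _ M (dual_dif a b))
                     (@rtensor_map _ _ _ _ M (dual_dif b c)))
    (homology (hom_in P N i) (hom_out P N i)).
Proof.
move=> -> -> ->.
have [q qK Kq] := pairing_bijective w'K tK t'K t_scale (Pb i).
apply: (@quasi_iso_homology _ _ _ _ _ _ _ _ _ _ _ (pairing t_scale (P := P i))).
split=> [y /pairing_cocycle //|y _|u ud]; first exact: iff_sym (pairing_coboundary _).
exists (q u); first by apply/pairing_cocycle; rewrite Kq.
by exists 0; rewrite Kq subrr linear0.
Qed.

(** Tor in degree 0 meets Ext in degree [d]: every element is a cycle, on one side through the zero
    placeholder map, on the other because [P d.+1] is zero. *)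
Lemma homology_reversed0 a b : a = d -> b = d.+1 ->
  lmod_iso (homology (@rtensor_map _ _ _ _ M (dual_dif a b))
                     (\0 : {linear rtensor (dual_ob b) M -> rtensor (dual_ob b) M}))
    (homology (hom_in P N d) (hom_out P N d)).
Proof.
move=> -> ->.
have [q qK Kq] := pairing_bijective w'K tK t'K t_scale (Pb d).
apply: (@quasi_iso_homology _ _ _ _ _ _ _ _ _ _ _ (pairing t_scale (P := P d))).
split=> [y _|y _|u _]; last 1 first.
- by exists (q u) => //; exists 0; rewrite Kq subrr linear0.
- by apply/hom_outP => x; rewrite (P0 (ltnSn d) x) linear0 hom_fun0.
- exact: iff_sym (pairing_coboundary _).
Qed.

Theorem van_den_bergh_duality i j : (i + j)%N = d -> lmod_iso (tor Y M j) (ext X N i).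
Proof.
move=> ijd; apply: lmod_iso_trans (ext_resolution N i).
apply: lmod_iso_trans (tor_resolution M j) _.
case: j ijd => [|j] ijd.
  rewrite addn0 in ijd; rewrite ijd; apply: homology_reversed0 => //.
  by rewrite subn1.
by apply: homology_reversed; rewrite -ijd; lia.
Qed.
End Coefficients.
End Duality.

(** * From modules over a Hopf algebra to bimodules *)

Section LinearProp.
Variables (k : pzRingType) (U V W : lmodType k).
Lemma lin0 (f : U -> V) : linear f -> f 0 = 0.
Proof. by move=> hf; apply: (linear0 (mk_linear hf)). Qed.
Lemma linD (f : U -> V) x y : linear f -> f (x + y) = f x + f y.
Proof. by move=> hf; apply: (linearD (mk_linear hf)). Qed.
Lemma linZ (f : U -> V) a x : linear f -> f (a *: x) = a *: f x.
Proof. by move=> hf; rewrite -[in LHS](addr0 (a *: x)) hf lin0 // addr0. Qed.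
Lemma lin_comp (f : V -> W) (g : U -> V) : linear f -> linear g -> linear (fun x => f (g x)).
Proof. by move=> hf hg a x y; rewrite hg hf. Qed.
End LinearProp.

Section Bilinear.
Variables (k : comNzRingType) (U V W : lmodType k).

Definition bilin (f : U -> V -> W) := (forall v, linear (f^~ v)) /\ (forall u, linear (f u)).

Lemma bilin_balanced (f : U -> V -> W) : bilin f -> vbalanced f.
Proof.
move=> [fl fr]; split=> [u u' v|u v v'|c u v].
- exact: (linD _ _ (fl v)).
- exact: (linD _ _ (fr u)).
- by rewrite (linZ _ _ (fl v)) (linZ _ _ (fr u)).
Qed.
Lemma bvliftE (f : U -> V -> W) u v : bilin f -> vlift f (vtens u v) = f u v.
Proof. by move/bilin_balanced; apply: vliftE. Qed.
Lemma vlift_linear (f : U -> V -> W) : bilin f -> linear (vlift f).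
Proof.
move=> hf; apply: tlift_linear => [|c u v]; first exact: bilin_balanced.
exact: (linZ _ _ (hf.2 u)).
Qed.
Lemma vtensor_ext (f g : vtensor U V -> W) : linear f -> linear g ->
  (forall u v, f (vtens u v) = g (vtens u v)) -> forall x, f x = g x.
Proof.
move=> hf hg fg; elim/vtensor_ind => [|u v x IHx]; first by rewrite !lin0.
by rewrite (linD _ _ hf) (linD _ _ hg) fg IHx.
Qed.
Lemma linear_vlift (W' : lmodType k) (h : W -> W') (f : U -> V -> W) x : linear h ->
  h (vlift f x) = vlift (fun u v => h (f u v)) x.
Proof. by move=> hh; rewrite -[h _]/(mk_linear hh _) linear_sum. Qed.
Lemma vlift_param (T : lmodType k) (f : T -> U -> V -> W) x :
  (forall u v, linear (fun p => f p u v)) -> linear (fun p => vlift (f p) x).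
Proof.
move=> hf a p q; rewrite /vlift /tlift /sum_eval scaler_sumr -big_split.
by apply: eq_bigr => i _; apply: hf.
Qed.
Lemma eq_vlift (f g : U -> V -> W) x : (forall u v, f u v = g u v) -> vlift f x = vlift g x.
Proof. by move=> fg; apply: tlift_ext. Qed.
End Bilinear.

Lemma vtens_bilin (k : comNzRingType) (U V : lmodType k) : bilin (@vtens k U V).
Proof.
by split=> [v a u u'|u a v v']; rewrite ?vtensDl ?vtensDr ?vtensZl ?vtensZr.
Qed.

Section Sweedler.
Variables (k : fieldType) (A : algType k) (H : hopf_algebra A).
Local Notation Delta := (comul H).
Local Notation eps a := (counit H a : k).
Local Notation S := (antipode H).

Lemma comul_linear : linear Delta. Proof. exact: linearP. Qed.

(** Coassociativity tested on trilinear maps: [T] induces linear maps [L] and [G] on the two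
    bracketings of the threefold tensor product, and [vassoc] exchanges them. *)
Lemma comul_assoc (W : lmodType k) (T : A -> A -> A -> W) a :
    (forall v w, linear (fun u => T u v w)) -> (forall u w, linear (fun v => T u v w)) ->
    (forall u v, linear (T u v)) ->
  vlift (fun x w => vlift (fun u v => T u v w) (Delta x)) (Delta a) =
  vlift (fun u y => vlift (T u) (Delta y)) (Delta a).
Proof.
move=> T1 T2 T3.
have Tb u : bilin (T u) by split=> [w|v]; [apply: T2|apply: T3].
have Tb' w : bilin (fun u v => T u v w) by split=> [v|u]; [apply: T1|apply: T2].
pose G := vlift (fun u (y : vtensor A A) => vlift (T u) y).
have Gb : bilin (fun u (y : vtensor A A) => vlift (T u) y).
  by split=> [y|u]; [apply: vlift_param|apply: vlift_linear].
have GL : linear G by apply: vlift_linear.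
pose L := vlift (fun (x : vtensor A A) w => vlift (fun u v => T u v w) x).
have Lb : bilin (fun (x : vtensor A A) w => vlift (fun u v => T u v w) x).
  by split=> [w|x]; [apply: vlift_linear|apply: vlift_param].
have LL : linear L by apply: vlift_linear.
have Mb w : bilin (fun u v : A => vtens u (vtens v w)).
  split=> [v|u]; first exact: (vtens_bilin _ _).1.
  apply: (lin_comp ((vtens_bilin _ _).2 u)); exact: (vtens_bilin _ _).1.
have Ab : bilin (fun (x : vtensor A A) (w : A) => vlift (fun u v => vtens u (vtens v w)) x).
  split=> [w|x]; first exact: vlift_linear.
  apply: vlift_param => u v; apply: (lin_comp ((vtens_bilin _ _).2 u)).
  exact: (vtens_bilin _ _).2.
have GAL : linear (fun t => G (vassoc t)) := lin_comp GL (vlift_linear Ab).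
have GA t : G (vassoc t) = L t.
  apply: (vtensor_ext GAL LL) => x w.
  rewrite /vassoc bvliftE // linear_vlift // [RHS]bvliftE //.
  by apply: eq_vlift => u v; rewrite /G !bvliftE.
have D1b : bilin (fun x w => vtens (Delta x) (w : A)).
  split=> [w|x]; last exact: (vtens_bilin _ _).2.
  exact: (lin_comp ((vtens_bilin _ _).1 w) comul_linear).
have D2b : bilin (fun (u : A) y => vtens u (Delta y)).
  split=> [y|u]; first exact: (vtens_bilin _ _).1.
  exact: (lin_comp ((vtens_bilin _ _).2 u) comul_linear).
have := congr1 G (comulA H a); rewrite GA /vmap (linear_vlift _ _ LL) (linear_vlift _ _ GL) => E.
transitivity (vlift (fun u y => L (vtens (Delta u) (id y))) (Delta a)).
  by apply: eq_vlift => x w; rewrite /L bvliftE.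
by rewrite E; apply: eq_vlift => u y; rewrite /G bvliftE.
Qed.

(** In Sweedler notation, B(a_1, m(a_2, a_3)) = B(a_1, eps(a_2) 1) = B(a, 1) by coassociativity and
    the counit axiom. The intended [m] are the two products in the antipode axioms. *)
Lemma sweedler_cancel (W : lmodType k) (B : A -> A -> W) (m : A -> A -> A) a :
    bilin B -> bilin m -> (forall y, vlift m (Delta y) = (eps y)%:A) ->
  vlift (fun x w => vlift (fun u v => B u (m v w)) (Delta x)) (Delta a) = B a 1.
Proof.
move=> [B1 B2] [m1 m2] mE.
rewrite comul_assoc; last 3 first.
- by move=> v w; apply: B1.
- by move=> u w; apply: (lin_comp (B2 u)); apply: m1.
- by move=> u v; apply: (lin_comp (B2 u)); apply: m2.
rewrite -[in RHS](counitr H a) (linear_vlift _ _ (B1 1)); apply: eq_vlift => u y.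
by rewrite -linear_vlift // mE (linZ _ _ (B2 u)) (linZ _ _ (B1 1)).
Qed.
End Sweedler.

Section Induced.
Variables (k : fieldType) (A : algType k) (H : hopf_algebra A).
Local Notation Delta := (comul H).
Local Notation eps a := (counit H a : k).
Local Notation S := (antipode H).
Implicit Types M N : lmodType A.

(* The vector space M (x) A with the bimodule structure
   a . (m (x) x) . b = a_1 m (x) a_2 x b. *)
Definition induced (h : hopf_algebra A) M : Type := vtensor (restrict M) A.
HB.instance Definition _ h M := GRing.Zmodule.on (induced h M).

Definition rvtens M (m : M) (x : A) : vtensor (restrict M) A := vtens (m : restrict M) x.

Definition ind_act1 M (c c' b : A) : vtensor (restrict M) A -> vtensor (restrict M) A :=
  vlift (fun (m : restrict M) x => rvtens (c *: (m : M)) (c' * x * b)).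
(** An arbitrary element of A (x) A acts here, so that associativity is checked on pure tensors and
    [Delta] enters only as an algebra morphism. *)
Definition ind_act M (u : vtensor A A) (b : A) (t : vtensor (restrict M) A) :
    vtensor (restrict M) A :=
  vlift (fun c c' => ind_act1 c c' b t) u.
Definition ind_scale M (r : env A) (t : induced H M) : induced H M :=
  vlift (fun (a : A) (b : A^c) => ind_act (Delta a) b t) r.

Lemma restrict_scaleE M (a : k) (m : restrict M) : a *: m = (a%:A : A) *: (m : M).
Proof. by []. Qed.
Lemma scale_restrict_linear M (m : M) : linear (fun c : A => c *: m : restrict M).
Proof. by move=> a c c'; rewrite restrict_scaleE scalerA -scalerAl mul1r scalerDl. Qed.
Lemma mul_linear2 (c b : A) : linear (fun x : A => c * x * b).
Proof. by move=> a x y; rewrite mulrDr mulrDl -scalerAr -scalerAl. Qed.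
Lemma mul_linearl (b : A) : linear (fun x : A => x * b).
Proof. by move=> a x y; rewrite mulrDl -scalerAl. Qed.
Lemma mul_linearr (b : A) : linear (fun x : A => b * x).
Proof. by move=> a x y; rewrite mulrDr -scalerAr. Qed.

Lemma rvtens_bilin M : bilin (@rvtens M : restrict M -> A -> _).
Proof. exact: vtens_bilin. Qed.
Lemma ind_inner_bilin M (c c' b : A) :
  bilin (fun (m : restrict M) x => rvtens (c *: (m : M)) (c' * x * b)).
Proof.
split=> [x|m].
  apply: (lin_comp ((rvtens_bilin M).1 _)); exact: restrict_act_linear.
apply: (lin_comp ((rvtens_bilin M).2 _)); exact: mul_linear2.
Qed.
Lemma ind_act1E M c c' b (m : M) x :
  ind_act1 c c' b (rvtens m x) = rvtens (c *: m) (c' * x * b).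
Proof. exact: (bvliftE _ _ (ind_inner_bilin M c c' b)). Qed.
Lemma ind_act1_linear M c c' b : linear (@ind_act1 M c c' b).
Proof. exact/vlift_linear/ind_inner_bilin. Qed.
Lemma ind_act1_bilin M b (t : vtensor (restrict M) A) :
  bilin (fun c c' => ind_act1 c c' b t).
Proof.
split=> [c'|c]; apply: vlift_param => m x.
  apply: (lin_comp ((rvtens_bilin M).1 _)); exact: scale_restrict_linear.
apply: (lin_comp ((rvtens_bilin M).2 _)) => a y z.
by rewrite !mulrDl -!scalerAl.
Qed.
Lemma ind_act1_linearb M c c' (t : vtensor (restrict M) A) :
  linear (fun b => ind_act1 c c' b t).
Proof.
apply: vlift_param => m x; apply: (lin_comp ((rvtens_bilin M).2 _)); exact: mul_linearr.
Qed.

Lemma ind_actE M c c' b (t : vtensor (restrict M) A) :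
  ind_act (vtens c c') b t = ind_act1 c c' b t.
Proof. exact: (bvliftE _ _ (ind_act1_bilin _ _)). Qed.
Lemma ind_act_linear M u b : linear (@ind_act M u b).
Proof. by apply: vlift_param => c c'; apply: ind_act1_linear. Qed.
Lemma ind_act_bilin M (t : vtensor (restrict M) A) : bilin (fun u b => ind_act u b t).
Proof.
split=> [b|u]; first exact/vlift_linear/ind_act1_bilin.
by apply: vlift_param => c c'; apply: ind_act1_linearb.
Qed.
Lemma ind_act_linearu M b (t : vtensor (restrict M) A) : linear (fun u => ind_act u b t).
Proof. exact: (ind_act_bilin t).1. Qed.
Lemma ind_actM M (u v : vtensor A A) (b b' : A) (t : vtensor (restrict M) A) :
  ind_act (u * v) (b' * b) t = ind_act u b (ind_act v b' t).
Proof.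
have Lu v0 (t0 : vtensor (restrict M) A) : linear (fun u => ind_act (u * v0) (b' * b) t0).
  apply: (lin_comp (ind_act_linearu _ t0)) => a x y.
  by rewrite mulrDl -scalerAl.
apply: (vtensor_ext (Lu v t) (ind_act_linearu b _)) => c c' {u}.
have Lv (t0 : vtensor (restrict M) A) : linear (fun v => ind_act (vtens c c' * v) (b' * b) t0).
  apply: (lin_comp (ind_act_linearu _ t0)) => a x y.
  by rewrite mulrDr -scalerAr.
apply: (vtensor_ext (Lv t) (lin_comp (ind_act_linear _ _) (ind_act_linearu b' t))).
move=> e e' {v}; rewrite vtensM !ind_actE.
apply: (vtensor_ext (ind_act1_linear _ _ _)
  (lin_comp (ind_act1_linear _ _ _) (ind_act1_linear _ _ _))) => m x.
by rewrite -/(rvtens (m : M) x) !ind_act1E scalerA !mulrA.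
Qed.
Lemma ind_act1r M (t : vtensor (restrict M) A) : ind_act 1 1 t = t.
Proof.
have L : linear (id : vtensor (restrict M) A -> _) by [].
rewrite -vtens11 ind_actE.
apply: (vtensor_ext (ind_act1_linear _ _ _) L) => m x.
by rewrite -/(rvtens (m : M) x) ind_act1E scale1r mul1r mulr1.
Qed.

Lemma ind_scale_inner_bilin M (t : induced H M) :
  bilin (fun (a : A) (b : A^c) => ind_act (Delta a) b t).
Proof.
split=> [b|a]; last exact: (ind_act_bilin _).2.
exact: (lin_comp (ind_act_linearu b t) (@comul_linear _ _ H)).
Qed.
Lemma ind_scaleE M (a : A) (b : A^c) (t : induced H M) :
  ind_scale (vtens a b) t = ind_act (Delta a) b t.
Proof. exact: (bvliftE _ _ (ind_scale_inner_bilin t)). Qed.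
Lemma ind_scale_linearr M (r : env A) :
  linear (@ind_scale M r : vtensor (restrict M) A -> vtensor (restrict M) A).
Proof. by apply: vlift_param => a b; apply: ind_act_linear. Qed.
Lemma ind_scale_linearl M (t : induced H M) :
  linear ((@ind_scale M)^~ t : env A -> vtensor (restrict M) A).
Proof. exact/vlift_linear/ind_scale_inner_bilin. Qed.

Lemma ind_scaleA M (r s : env A) (t : induced H M) :
  ind_scale r (ind_scale s t) = ind_scale (r * s) t.
Proof.
have Lr s0 : linear (fun r => ind_scale (r * s0) t : vtensor (restrict M) A).
  apply: (lin_comp (ind_scale_linearl t)) => a x y.
  by rewrite mulrDl -scalerAl.
apply: (vtensor_ext (ind_scale_linearl _) (Lr s)) => a b {r}.
have Ls : linear (fun s => ind_scale (vtens a b * s) t : vtensor (restrict M) A).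
  apply: (lin_comp (ind_scale_linearl t)) => c x y.
  by rewrite mulrDr -scalerAr.
have Ls' : linear (fun s => ind_scale (vtens a b) (ind_scale s t) : vtensor (restrict M) A).
  exact: (lin_comp (@ind_scale_linearr M (vtens a b)) (ind_scale_linearl t)).
apply: (vtensor_ext Ls' Ls) => a' b' {s}.
have -> : vtens a b * vtens a' b' = vtens (a * a') ((b' : A) * (b : A)) :> env A.
  exact: vtensM.
by rewrite !ind_scaleE rmorphM ind_actM.
Qed.
Lemma ind_scale1 M : left_id 1 (@ind_scale M).
Proof.
move=> t; have -> : 1 = vtens 1 (1 : A) :> env A by [].
by rewrite ind_scaleE rmorph1 ind_act1r.
Qed.
Lemma ind_scaleDr M : right_distributive (@ind_scale M) +%R.
Proof. by move=> r x y; apply: linD; apply: ind_scale_linearr. Qed.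
Lemma ind_scaleDl M t : {morph (@ind_scale M)^~ t : r s / r + s}.
Proof. by move=> r s; apply: (linD _ _ (ind_scale_linearl t)). Qed.
HB.instance Definition _ M := GRing.Zmodule_isLmodule.Build (env A) (induced H M)
  (@ind_scaleA M) (@ind_scale1 M) (@ind_scaleDr M) (@ind_scaleDl M).

Lemma ind_zero M : is_zero_module M -> is_zero_module (induced H M).
Proof.
move=> M0; apply: (@vtensor_ind k (restrict M) A) => // m x t ->.
rewrite (M0 m) addr0; exact: (lin0 ((rvtens_bilin M).1 x)).
Qed.

Definition ind_map_fun M N (g : {linear M -> N}) : induced H M -> induced H N :=
  vlift (fun (m : restrict M) x => rvtens (g m) x).
Lemma ind_map_bilin M N (g : {linear M -> N}) :
  bilin (fun (m : restrict M) x => rvtens (g m) x).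
Proof.
split=> [x|m]; last exact: (rvtens_bilin N).2.
apply: (lin_comp ((rvtens_bilin N).1 x)) => a m m'.
by rewrite !restrict_scaleE linearP.
Qed.
Lemma ind_map_klinear M N (g : {linear M -> N}) :
  linear (ind_map_fun g : vtensor (restrict M) A -> vtensor (restrict N) A).
Proof. exact/vlift_linear/ind_map_bilin. Qed.
Lemma ind_mapE M N (g : {linear M -> N}) m x : ind_map_fun g (rvtens m x) = rvtens (g m) x.
Proof. exact: (bvliftE _ _ (ind_map_bilin g)). Qed.

Lemma ind_map_scale M N (g : {linear M -> N}) (r : env A) (t : induced H M) :
  ind_map_fun g (ind_scale r t) = ind_scale r (ind_map_fun g t).
Proof.
have L := ind_map_klinear g.
have L1 : linear (fun r => ind_map_fun g (ind_scale r t) : vtensor (restrict N) A).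
  exact: (lin_comp L (ind_scale_linearl t)).
apply: (vtensor_ext L1 (ind_scale_linearl _)) => a b {r L1}.
rewrite !ind_scaleE; move: (Delta a) => u.
have L2 : linear (fun u => ind_map_fun g (ind_act u b t) : vtensor (restrict N) A).
  exact: (lin_comp L (ind_act_linearu b t)).
apply: (vtensor_ext L2 (ind_act_linearu b _)) => c c' {u L2}.
rewrite !ind_actE.
have L3 : linear (fun t => ind_map_fun g (ind_act1 c c' b t) : vtensor (restrict N) A).
  exact: (lin_comp L (@ind_act1_linear M c c' b)).
have L4 : linear (fun t : vtensor (restrict M) A =>
    ind_act1 c c' b (ind_map_fun g t) : vtensor (restrict N) A).
  exact: (lin_comp (@ind_act1_linear N c c' b) L).
apply: (vtensor_ext L3 L4) => m x.
by rewrite -/(rvtens (m : M) x) ind_act1E !ind_mapE ind_act1E linearZ.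
Qed.
Lemma ind_map_linear M N (g : {linear M -> N}) : linear (ind_map_fun g).
Proof.
move=> r x y; apply: etrans (linD _ _ (ind_map_klinear g)) _.
by rewrite [X in X + _]ind_map_scale.
Qed.
Definition ind_map M N (g : {linear M -> N}) : {linear induced H M -> induced H N} :=
  mk_linear (ind_map_linear g).
End Induced.
Arguments ind_map {k A H M N} g : simpl never.

(** * Exactness and projectivity of induced bimodules *)

Section InducedResolution.
Variables (k : fieldType) (A : algType k) (H : hopf_algebra A).
Local Notation Delta := (comul H).
Local Notation eps a := (counit H a : k).
Local Notation S := (antipode H).
Local Notation indH := (@ind_map k A H _ _).
Implicit Types L M N : lmodType A.

Definition itens M (m : M) (x : A) : induced H M := rvtens m x.
Lemma itensDl M (m m' : M) x : itens (m + m') x = itens m x + itens m' x.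
Proof. exact: vtensDl. Qed.
Lemma itensDr M (m : M) x y : itens m (x + y) = itens m x + itens m y.
Proof. exact: vtensDr. Qed.
Lemma itensZ M (m : M) (c : k) x : itens ((c%:A : A) *: m) x = itens m (c *: x).
Proof.
rewrite /itens (linZ _ _ ((rvtens_bilin M).2 m)).
exact: (linZ c (m : restrict M) ((rvtens_bilin M).1 x)).
Qed.
Lemma itens0l M x : itens (0 : M) x = 0.
Proof. exact: (lin0 ((rvtens_bilin M).1 x)). Qed.
Lemma itensNr M (m : M) x : itens m (- x) = - itens m x.
Proof.
apply/eqP; rewrite -addr_eq0 -itensDr addNr; apply/eqP.
exact: (lin0 ((rvtens_bilin M).2 m)).
Qed.
Lemma ind_mapE' M N (g : {linear M -> N}) m x : indH g (itens m x) = itens (g m) x.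
Proof. exact: ind_mapE. Qed.
Lemma induced_ind M (Q : induced H M -> Prop) :
  Q 0 -> (forall m x t, Q t -> Q (itens m x + t)) -> forall t, Q t.
Proof. exact: (@vtensor_ind k (restrict M) A). Qed.

Lemma ind_map_comp L M N (f : {linear M -> N}) (g : {linear L -> M}) t :
  indH (f \o g) t = indH f (indH g t).
Proof.
elim/induced_ind: t => [|m x t IHt]; first by rewrite !linear0.
by rewrite (linearD (indH (f \o g))) (linearD (indH g)) (linearD (indH f)) IHt !ind_mapE'.
Qed.
Lemma ind_map_sum_id M n (g : 'I_n -> {linear M -> M}) t :
  (forall m, m = \sum_i g i m) -> t = \sum_i indH (g i) t.
Proof.
move=> gE; elim/induced_ind: t => [|m x t IHt].
  by rewrite big1 // => i _; rewrite linear0.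
rewrite {1}IHt {1}(gE m).
transitivity (\sum_i (itens (g i m) x + indH (g i) t)); last first.
  by apply: eq_bigr => i _; rewrite (linearD (indH (g i))) ind_mapE'.
rewrite big_split; congr (_ + _).
elim/big_rec2: _ => [|i y z _ <-]; [exact: itens0l|exact: itensDl].
Qed.

Definition isum M (s : seq (M * A)) : induced H M := \sum_(p <- s) itens p.1 p.2.
Lemma isum_surj M (t : induced H M) : exists s, t = isum s.
Proof.
elim/induced_ind: t => [|m x t [s ->]]; first by exists [::]; rewrite /isum big_nil.
by exists ((m, x) :: s); rewrite /isum big_cons.
Qed.

(* If g m <> 0 for the first term m (x) x of a tensor killed by g (x) 1, a functional
   equal to 1 on g m expresses x through the second components of the other terms,
   so that the number of terms drops. *)
Lemma induced_exact L M N (f : {linear L -> M}) (g : {linear M -> N}) :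
  exact_at f g -> exact_at (indH f) (indH g).
Proof.
move=> fg t; split=> [|[y <-]]; last first.
  rewrite -ind_map_comp; elim/induced_ind: y => [|m x t' IHt]; first exact: linear0.
  rewrite (linearD (indH (g \o f))) IHt addr0 ind_mapE' /=.
  have -> : g (f m) = 0 by apply/fg; exists m.
  exact: itens0l.
have [s ->] := isum_surj t; have [n] := ubnP (size s).
elim: n s => [//|n IHn] [|[m x] s] sn.
  by move=> _; exists 0; rewrite linear0 /isum big_nil.
have cons0 M' (m' : M') x' s' : isum ((m', x') :: s') = itens m' x' + isum s'.
  by rewrite /isum big_cons.
rewrite cons0 => gs.
have [/fg[l lm]|gm] := pselect (g m = 0).
  have [|y yE] := IHn s sn.
    by move: gs; rewrite (linearD (indH g)) ind_mapE' -lm (fg _).2 ?itens0l ?add0r //; exists l.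
  by exists (itens l x + y); rewrite (linearD (indH f)) ind_mapE' yE lm.
have [phi phi1] := @exists_functional k (restrict N) (g m) gm.
pose c (m' : M) : k := phi (g m').
pose Phi : vtensor (restrict N) A -> A := vlift (fun n y => (phi n : k) *: y).
have Phib : bilin (fun (n : restrict N) (y : A) => (phi n : k) *: y).
  split=> [y a u v|u a y z]; first by rewrite linearP scalerDl scalerA.
  by rewrite scalerDr !scalerA mulrC.
have PhiL : linear Phi by apply: vlift_linear.
have PhiE s' : Phi (indH g (isum s')) = \sum_(p <- s') c p.1 *: p.2.
  elim: s' => [|[m' x'] s' IHs]; first by rewrite /isum !big_nil linear0 lin0.
  rewrite cons0 (linearD (indH g)) (linD _ _ PhiL) IHs big_cons ind_mapE'; congr (_ + _).
  exact: bvliftE.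
have xE : x = - \sum_(p <- s) c p.1 *: p.2.
  have := congr1 Phi gs; rewrite -cons0 PhiE big_cons (lin0 PhiL) /= {1}/c phi1 scale1r.
  by move/eqP; rewrite addr_eq0 => /eqP.
(* Substituting [xE] for [x] distributes the first term over the others and changes only their first
   components. *)
pose s' := [seq (p.1 - ((c p.1)%:A : A) *: m, p.2) | p <- s].
have sE : itens m x + isum s = isum s'.
  have -> : itens m x = - \sum_(p <- s) itens (((c p.1)%:A : A) *: m) p.2.
    rewrite xE; elim: (s) => [|p s1 IHs].
      rewrite !big_nil !oppr0; exact: (lin0 ((rvtens_bilin M).2 m)).
    by rewrite !big_cons !opprD itensDr IHs itensNr itensZ.
  rewrite addrC -sumrB /isum big_map; apply: eq_bigr => p _ /=.
  apply/eqP; rewrite subr_eq -itensDl subrK //.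
rewrite sE; apply: IHn; first by rewrite size_map.
by rewrite -sE.
Qed.

Local Notation triv := (trivial_module (counit H) : lmodType A).

Definition ind_counit_fun : induced H triv -> bimod A :=
  vlift (fun (c : restrict triv) (x : A) => (c : k) *: x).
Lemma ind_counit_bilin : bilin (fun (c : restrict triv) (x : A) => (c : k) *: x).
Proof.
split=> [x a c c'|c a x y]; last by rewrite scalerDr !scalerA mulrC.
have -> : a *: c + c' = a * (c : k) + (c' : k) :> k.
  rewrite restrict_scaleE; congr (_ + _).
  by rewrite [LHS]/(trivial_scale _ _) /trivial_scale linearZ rmorph1 /= [_ *: 1]mulr1.
by rewrite scalerDl scalerA.
Qed.
Lemma ind_counit_klinear : linear (ind_counit_fun : vtensor (restrict triv) A -> A).
Proof. exact/vlift_linear/ind_counit_bilin. Qed.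
Lemma ind_counitE (c : triv) x : ind_counit_fun (itens c x) = (c : k) *: (x : A).
Proof. exact: (bvliftE _ _ ind_counit_bilin). Qed.

(** The diagonal action becomes left multiplication by eps(a_1) a_2, which is a by the counit
    axiom. *)
Lemma ind_counit_scale (r : env A) (t : induced H triv) :
  ind_counit_fun (ind_scale r t) = twist_scale r (ind_counit_fun t : bimod A).
Proof.
have GL := ind_counit_klinear.
elim/vtensor_ind: r => [|a b r IHr].
  by rewrite (lin0 (ind_scale_linearl t)) (lin0 GL) twist_scale0l.
rewrite (linD _ _ (ind_scale_linearl t)) (linD _ _ GL) twist_scaleDl IHr; congr (_ + _).
rewrite twist_scaleE ind_scaleE /= {r IHr}.
elim/induced_ind: t => [|c x t IHt].
  by rewrite (lin0 (@ind_act_linear k A triv _ _)) (lin0 GL) mulr0 mul0r.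
rewrite (linD _ _ (@ind_act_linear k A triv _ _)) !(linD _ _ GL) IHt mulrDr mulrDl.
congr (_ + _); rewrite ind_counitE /ind_act (linear_vlift _ _ GL).
have hL : linear (fun y => (c : k) *: (y * x * b) : A).
  by move=> z y y'; rewrite !mulrDl -!scalerAl scalerDr !scalerA mulrC.
transitivity (vlift (fun c1 c2 => (c : k) *: ((eps c1 *: c2) * x * b)) (Delta a)).
  apply: eq_vlift => c1 c2; rewrite ind_act1E ind_counitE.
  by rewrite [c1 *: c]/(trivial_scale _ _) /trivial_scale mulrC -scalerA -!scalerAl.
by rewrite -(linear_vlift _ _ hL) counitl -scalerAr -scalerAl.
Qed.
Lemma ind_counit_linear : linear (ind_counit_fun : induced H triv -> bimod A).
Proof.
move=> r x y; apply: etrans (linD _ _ ind_counit_klinear) _.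
by rewrite [X in X + _]ind_counit_scale.
Qed.
Definition ind_counit : {linear induced H triv -> bimod A} := mk_linear ind_counit_linear.

(** Every tensor over the trivial module equals 1 (x) x, where x is its image. *)
Lemma ind_counit_inj t : ind_counit t = 0 -> t = 0.
Proof.
have E : t = @itens triv (1 : k) (ind_counit t : A) :> induced H triv.
  elim/induced_ind: t => [|c x t IHt].
    by rewrite linear0; symmetry; apply: (lin0 ((rvtens_bilin triv).2 _)).
  rewrite (linearD ind_counit) [RHS]itensDr -IHt; congr (_ + _).
  rewrite [ind_counit _]ind_counitE -itensZ; congr itens.
  by rewrite [RHS]/(trivial_scale _ _) /trivial_scale linearZ rmorph1 /= mulr1 [_ *: 1]mulr1.
by move=> t0; rewrite E t0; apply: (lin0 ((rvtens_bilin triv).2 _)).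
Qed.
Lemma ind_counit_surj : Defs.surjective ind_counit.
Proof. by move=> x; exists (@itens triv (1 : k) x); rewrite [LHS]ind_counitE scale1r. Qed.

Lemma induced_resolution (P : chain A) (e : {linear P 0%N -> triv}) :
    proj_resolution e -> (forall n, projective (induced H (P n))) ->
  @proj_resolution _ (bimod A)
    (@Chain (env A) (fun n => induced H (P n)) (fun n => indH (chain_d P n)))
    (ind_counit \o indH e).
Proof.
move=> eP IP; split=> [n|x|t|n].
- exact: IP.
- have [y <-] := ind_counit_surj x; elim/induced_ind: y => [|c a y [z E]].
    by exists 0; rewrite linear0 linear0.
  have [m mc] := proj_res_surj eP c; exists (itens m a + z).
  rewrite (linearD (ind_counit \o indH e)) E (linearD ind_counit); congr (_ + _).
  by rewrite -mc -ind_mapE'.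
- apply: iff_trans (induced_exact (proj_res_exact0 eP) t).
  split=> [/ind_counit_inj //|h]; exact: (etrans (congr1 ind_counit h) (linear0 _)).
- exact/induced_exact/(proj_res_exact eP).
Qed.

Section DualBasis.
Local Notation reg := (A^o : lmodType A).

Definition ind_unit : induced H reg := itens (1 : reg) 1.

(** The formula u (x) x |-> u_1 (x) S(u_2) x, inverse to r |-> r . (1 (x) 1), which sends a (x) b to
    a_1 (x) a_2 b. It shows that the induced module of A is free of rank one. *)
Definition untwist1 (u : A) (x : A) : env A :=
  vlift (fun c1 c2 => vtens c1 (S c2 * x : A^c)) (Delta u).
Definition untwist : induced H reg -> env A :=
  vlift (fun (u : restrict reg) (x : A) => untwist1 u x).

Lemma untwist1_inner_bilin x : bilin (fun c1 c2 : A => vtens c1 (S c2 * x : A^c) : env A).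
Proof.
split=> [c2|c1]; first exact: (vtens_bilin _ _).1.
apply: (lin_comp ((vtens_bilin _ _).2 c1)) => a y z.
by rewrite linearP mulrDl -scalerAl.
Qed.
Lemma untwist_bilin : bilin (fun (u : restrict reg) (x : A) => untwist1 u x : env A).
Proof.
split=> [x a u u'|u].
  have -> : a *: u + u' = a *: (u : A) + (u' : A) :> A.
    by rewrite restrict_scaleE; congr (_ + _); rewrite [LHS]mulr_algl.
  exact: (lin_comp (vlift_linear (untwist1_inner_bilin x)) (@comul_linear _ _ H) a u u').
apply: vlift_param => c1 c2; apply: (lin_comp ((vtens_bilin _ _).2 c1)).
exact: mul_linearr.
Qed.
Lemma untwist_klinear : linear (untwist : vtensor (restrict reg) A -> env A).
Proof. exact/vlift_linear/untwist_bilin. Qed.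
Lemma untwistE (u : reg) x : untwist (itens u x) = untwist1 u x.
Proof. exact: (bvliftE _ _ untwist_bilin). Qed.

Lemma scale_ind_unit (a : A) (b : A^c) :
  ind_scale (vtens a b) ind_unit =
  vlift (fun u v => rvtens (u : reg) (v * (b : A))) (Delta a).
Proof.
rewrite ind_scaleE; apply: eq_vlift => u v.
by rewrite [LHS]ind_act1E [u *: 1]mulr1 mulr1.
Qed.

Lemma reg_bilin (x : A) : bilin (fun (u : A) y => rvtens (u : reg) (y * x)).
Proof.
split=> [y a u u'|u]; last first.
  apply: (lin_comp ((rvtens_bilin reg).2 u)); exact: mul_linearl.
have -> : a *: u + u' = a *: (u : restrict reg) + (u' : restrict reg) :> A.
  by rewrite restrict_scaleE; congr (_ + _); rewrite [RHS]mulr_algl.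
exact: ((rvtens_bilin reg).1 (y * x)).
Qed.

(** On a pure tensor the composite is u_1 (x) u_2 S(u_3) x, and the right antipode axiom cancels u_2
    S(u_3). *)
Lemma untwistK t : ind_scale (untwist t) ind_unit = t.
Proof.
have TL := ind_scale_linearl ind_unit.
elim/induced_ind: t => [|u x t IHt]; first by rewrite (lin0 untwist_klinear) (lin0 TL).
rewrite (linD _ _ untwist_klinear) (linD _ _ TL) IHt; congr (_ + _).
rewrite untwistE /untwist1 (linear_vlift _ _ TL).
have mb : bilin (fun v w : A => v * S w).
  by split=> [w|v] a y z; rewrite ?linearP ?mulrDl ?mulrDr -?scalerAl -?scalerAr.
apply: etrans (etrans (sweedler_cancel u (reg_bilin x) mb (antipoder H)) _); last by rewrite mul1r.
apply: eq_vlift => c c'; rewrite scale_ind_unit; apply: eq_vlift => v w.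
by rewrite mulrA.
Qed.

(** Here the composite is a_1 (x) S(a_2) a_3 b, and the left antipode axiom applies. *)
Lemma scale_unitK r : untwist (ind_scale r ind_unit) = r.
Proof.
have TL := ind_scale_linearl ind_unit.
elim/vtensor_ind: r => [|a b r IHr]; first by rewrite (lin0 TL) (lin0 untwist_klinear).
rewrite (linD _ _ TL) (linD _ _ untwist_klinear) IHr; congr (_ + _).
rewrite scale_ind_unit (linear_vlift _ _ untwist_klinear).
have mb : bilin (fun v w : A => S v * w).
  by split=> [w|v] c y z; rewrite ?linearP ?mulrDl ?mulrDr -?scalerAl -?scalerAr.
have Bb : bilin (fun (u y : A) => vtens u (y * (b : A) : A^c) : env A).
  split=> [y|u]; first exact: (vtens_bilin _ _).1.
  apply: (lin_comp ((vtens_bilin _ _).2 u)); exact: mul_linearl.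
apply: etrans (etrans (sweedler_cancel a Bb mb (antipodel H)) _); last by rewrite mul1r.
apply: eq_vlift => c c'; rewrite untwistE; apply: eq_vlift => v w.
by rewrite mulrA.
Qed.

(** Inherited from the inverse map, the action on [ind_unit]. *)
Lemma untwist_linear : linear (untwist : induced H reg -> (env A)^o).
Proof.
move=> r x y; apply: etrans (linD _ _ untwist_klinear) _; congr (_ + _).
rewrite -[in LHS](untwistK x).
have -> : r *: ind_scale (untwist x) ind_unit = ind_scale (r * untwist x) ind_unit.
  exact: ind_scaleA.
exact: scale_unitK.
Qed.

(** Inducing the decomposition of the identity of [M] into the maps m |-> f_i(m) x_i factors each
    summand through the free module A (x) A; [untwist] reads off the coordinate there, and [rho i]
    sends the basis element [ind_unit] to x_i (x) 1. *)
Lemma induced_dual_basis M : dual_basis M -> dual_basis (induced H M).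
Proof.
move=> [n [x [f xf]]].
exists n, (fun i => itens (x i) 1), (fun i => mk_linear untwist_linear \o indH (f i)) => t.
have rhoL i : linear (fun b : reg => (b : A) *: x i).
  by move=> a b c; rewrite scalerDl scalerA.
pose rho i := mk_linear (rhoL i).
rewrite {1}(@ind_map_sum_id M n (fun i => rho i \o f i) t xf).
apply: eq_bigr => i _; rewrite ind_map_comp -[in LHS](untwistK (indH (f i) t)).
apply: etrans (ind_map_scale (rho i) _ _) _; congr (ind_scale _ _).
by rewrite [LHS]ind_mapE' /= scale1r.
Qed.
End DualBasis.
End InducedResolution.

(** * Extreme degrees *)

From mathcomp.multinomials Require Import freeg.

Section ExtremeDegrees.
Variables (k : fieldType) (A : algType k).
Local Notation E := (env A).
Local Notation N := (bimod A).

Definition etens (a b : A) : E := vtens a (b : A^c).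

Lemma bimod_scaleE (a b : A) (m : N) : etens a b *: m = a * (m : A) * b :> A.
Proof. exact: (@twist_scaleE k A idfun idfun). Qed.
Lemma etens1l c : etens c%:A 1 = c%:A.
Proof. by rewrite /etens vtensZl. Qed.
Lemma twist_scale_k (s t : {lrmorphism A -> A}) c (m : twist s t) :
  (c%:A : E) *: m = c *: (m : A) :> A.
Proof.
rewrite -etens1l; apply: etrans (@twist_scaleE k A s t _ _ m) _.
by rewrite linearZ /= !rmorph1 mulr1 -scalerAl mul1r.
Qed.

Section Ext0.
Local Notation cov := (free_cover N).
Local Notation S := (std_res N).

Lemma central_mul_linear (z : center A) : linear (fun m : N => (val z : A) * (m : A) : N).
Proof.
have /asboolP zC := valP z.
move=> r x y; rewrite mulrDr; congr (_ + _).
elim/vtensor_ind: r => [|a b r IHr]; first by rewrite !scale0r mulr0.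
rewrite !scalerDl mulrDr IHr; congr (_ + _).
by rewrite !bimod_scaleE !mulrA zC.
Qed.
Definition central_cocycle (z : center A) : hom (S 0%N) N :=
  mk_hom (mk_linear (central_mul_linear z) \o cov : {linear S 0%N -> N}).
Lemma central_cocycleE z x : hom_fun (central_cocycle z) x = (val z : A) * (cov x : A).
Proof. by []. Qed.
Lemma central_cocycle_linear : linear central_cocycle.
Proof.
move=> c z z'; apply: hom_ext => x.
rewrite hom_fun_add hom_fun_scale !central_cocycleE.
by rewrite [X in _ = X + _]twist_scale_k /= mulrDl scalerAl.
Qed.

(** A cocycle in degree 0 factors through the cover, that is, it is a bimodule endomorphism of A.
    Writing m as m 1 and as 1 m shows that it multiplies by its value [z] at 1 both on the right and
    on the left, so [z] is central. *)
Lemma ext0_center : lmod_iso (center A) (ext N N 0).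
Proof.
have SP := std_res_proj N.
have [e1 cov1] : exists e1 : S 0%N, cov e1 = (1 : A) by apply: free_cover_surj.
apply: (homology_kernel (h := mk_linear central_cocycle_linear)) => //.
  move=> z z' zz'; apply: val_inj; rewrite -[LHS]mulr1 -[RHS]mulr1 -cov1.
  exact: (congr1 (fun u => hom_fun u e1) zz').
move=> u; apply: iff_trans (hom_outP (N := N) (i := 0) u) _; split=> [ud|[z <-] x]; last first.
  rewrite [LHS]central_cocycleE.
  have -> : cov (chain_d S 0 x) = 0 by apply/(proj_res_exact0 SP); exists x.
  by rewrite mulr0.
have uE (x y : S 0%N) : cov x = cov y -> hom_fun u x = hom_fun u y.
  move=> xy; apply/eqP; rewrite -subr_eq0 -hom_funB.
  have /(proj_res_exact0 SP)[v <-] : cov (x - y) = 0 by rewrite linearB xy subrr.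
  by rewrite ud.
pose z : A := hom_fun u e1.
have zl x : hom_fun u x = (cov x : A) * z.
  rewrite (@uE x (etens (cov x) 1 *: e1)); last first.
    by rewrite linearZ cov1 /= bimod_scaleE !mulr1.
  by rewrite hom_funZ bimod_scaleE mulr1.
have zr x : hom_fun u x = z * (cov x : A).
  rewrite (@uE x (etens 1 (cov x) *: e1)); last first.
    by rewrite linearZ cov1 /= bimod_scaleE !mul1r.
  by rewrite hom_funZ bimod_scaleE mul1r.
have zC : z \in is_central (A := A).
  by apply/asboolP => a; have [x <-] := free_cover_surj (a : N); rewrite -zr zl.
exists (Submod zC); apply: hom_ext => x; rewrite [RHS]zr; exact: central_cocycleE.
Qed.
End Ext0.

Section CommutatorCokernel.
Variables (U V : lmodType k) (f : {linear U -> V}) (G : A -> V).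
Local Notation cls := (quot_pi (@is_commutator_sum k A)).

(** [G] will come from a choice of preimages, so it is linear only modulo the range of [f]; the
    linear map that gives the isomorphism is [h]. *)
Lemma commutator_cokernel (h : {linear V -> commutator_quotient A}) :
    (forall c a b, in_range f (G (c *: a + b) - (c *: G a + G b))) ->
    (forall a b, in_range f (G (a * b) - G (b * a))) ->
    (forall t, exists a, in_range f (t - G a)) ->
    (forall u, h (f u) = 0) -> (forall a, h (G a) = cls a) ->
  lmod_iso (homology f (\0 : {linear V -> V})) (commutator_quotient A).
Proof.
move=> GL GC GE hf hG.
have G0 : in_range f (G 0).
  by have := GL (- 1) 0 0; rewrite scaler0 addr0 scaleN1r addNr subr0.
have GS a : a \in is_commutator_sum (A := A) -> in_range f (G a).
  move=> /asboolP[s ->]; elim: s => [|p s IHs]; first by rewrite big_nil.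
  rewrite big_cons; apply: range_of_sub (GL _ _ _) _; apply: range_linear => //.
  rewrite addrC -scaleN1r; apply: range_of_sub (GL _ _ _) _.
  by rewrite scaleN1r addrC.
apply: (homology_cokernel (h := h)) => [//|c|t].
  by exists (G (quot_repr c)); rewrite hG quot_reprK.
split=> [t0|[x <-] //]; have [a [u ua]] := GE t.
have ta : in_range f (t - G a) by exists u.
apply: range_of_sub ta (GS _ _).
have := hf u; rewrite ua linearB t0 hG sub0r => /eqP; rewrite oppr_eq0 => /eqP.
by rewrite -[RHS](linear0 cls) => /quot_piP; rewrite subr0.
Qed.
End CommutatorCokernel.

Section Tor0.
Local Notation Y := (rbimod A : lmodType E^c).
Local Notation cls := (quot_pi (@is_commutator_sum k A)).

Lemma rbimod_etens (a b : A) (y : Y) : (etens a b : E^c) *: y = b * (y : A) * a :> A.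
Proof. exact: rbimod_scaleE. Qed.
Lemma rbimod_scale_k c (y : Y) : ((c%:A : E) : E^c) *: y = c *: (y : A) :> A.
Proof. by rewrite -etens1l rbimod_etens mul1r -scalerAr mulr1. Qed.

Lemma commutator_cls (a b : A) : cls (a * b) = cls (b * a).
Proof.
apply/quot_piP/asboolP; exists [:: (1, (a, b))].
by rewrite big_seq1 scale1r.
Qed.

(** On pure tensors this is the cyclic exchange of b (c a m) with (c a m) b modulo commutators. *)
Lemma cls_balanced (r : E) (c : Y) (m : N) :
  cls ((rbimod_scale r c : A) * (m : A)) = cls ((c : A) * (twist_scale r m : A)).
Proof.
elim/vtensor_ind: r => [|a b r IHr].
  by rewrite rbimod_scale0l twist_scale0l mul0r mulr0.
rewrite rbimod_scaleDl twist_scaleDl mulrDl mulrDr !linearD; congr (_ + _); last exact: IHr.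
rewrite /= rbimod_scaleE twist_scaleE -mulrA -mulrA commutator_cls.
by rewrite !mulrA.
Qed.

Section Cover.
Variables (X : lmodType E^c) (cov : {linear X -> Y}).

Definition cover_pair (x : X) (m : restrict N) : commutator_quotient A :=
  cls ((cov x : A) * (m : A)).
Lemma cover_pair_balanced : balanced
  (fun r : E => *:%R (r : E^c) : {additive X -> X})
  (fun r : E => @restrict_act k E N r : {linear restrict N -> restrict N}) cover_pair.
Proof.
rewrite /cover_pair; split=> [x y m|x m n|r x m].
- by rewrite linearD mulrDl linearD.
- by rewrite mulrDr linearD.
have -> : cov ((r : E^c) *: x) = (r : E^c) *: cov x by apply: linearZ.
exact: cls_balanced.
Qed.
Definition cover_class : rtensor X N -> commutator_quotient A := tlift cover_pair.
Lemma cover_class_linear : linear cover_class.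
Proof.
apply: tlift_linear => [|c x m]; first exact: cover_pair_balanced.
rewrite /cover_pair -linearZ; congr (quot_pi _ _).
by rewrite scalerAr; congr (_ * _); apply: twist_scale_k.
Qed.
Lemma cover_classE x (m : N) : cover_class (rtens x m) = cls ((cov x : A) * (m : A)).
Proof. by apply: tliftE; apply: cover_pair_balanced. Qed.

Variables (gen : A -> X) (U : lmodType k) (D : {linear U -> rtensor X N}).
Hypothesis cov_gen : forall a, cov (gen a) = a.
Hypothesis D_ker : forall x (m : N), cov x = 0 -> in_range D (rtens x m).

Lemma D_kerB x y (m : N) : cov x = cov y -> in_range D (rtens x m - rtens y m).
Proof.
move=> xy; have -> : rtens x m - rtens y m = rtens (x - y) m.
  by apply/eqP; rewrite subr_eq -rtensDl subrK.
by apply: D_ker; rewrite linearB xy subrr.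
Qed.

Definition gen_tens (a : A) : rtensor X N := rtens (gen a) ((1 : A) : N).

Lemma rtens_left (x : X) (m : A) :
  rtens x (m : N) = rtens ((etens m 1 : E^c) *: x) ((1 : A) : N).
Proof. by rewrite rtensA; congr rtens; rewrite bimod_scaleE !mulr1. Qed.
Lemma rtens_right (x : X) (m : A) :
  rtens x (m : N) = rtens ((etens 1 m : E^c) *: x) ((1 : A) : N).
Proof. by rewrite rtensA; congr rtens; rewrite bimod_scaleE !mul1r. Qed.

(** Balancing moves [m] into the first factor, and elements of the first factor with the same image
    under [cov] agree modulo boundaries. The variant after it moves [m] through the other tensor
    factor of A^e, hence to the other side. *)
Lemma rtens_normal (x : X) (m a : A) :
  (cov x : A) * m = a -> in_range D (rtens x (m : N) - gen_tens a).
Proof.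
move=> <-; rewrite rtens_left; apply: D_kerB.
by rewrite cov_gen linearZ /= rbimod_etens mul1r.
Qed.
Lemma rtens_normal' (x : X) (m a : A) :
  m * (cov x : A) = a -> in_range D (rtens x (m : N) - gen_tens a).
Proof.
move=> <-; rewrite rtens_right; apply: D_kerB.
by rewrite cov_gen linearZ /= rbimod_etens mulr1.
Qed.
(** The tensor gen a (x) b has two normal forms, one for each side, namely those of a b and of b
    a. *)
Lemma gen_tens_commutator a b : in_range D (gen_tens (a * b) - gen_tens (b * a)).
Proof.
apply: (range_subr (t := rtens (gen a) (b : N))).
  by apply: rtens_normal; rewrite cov_gen.
by apply: rtens_normal'; rewrite cov_gen.
Qed.
Lemma gen_tens_linear c a b :
  in_range D (gen_tens (c *: a + b) - (c *: gen_tens a + gen_tens b)).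
Proof.
rewrite rtensZ -rtensA -rtensDl; apply: D_kerB.
by rewrite linearD linearZ /= !cov_gen rbimod_scale_k.
Qed.
Lemma gen_tens_exists t : exists a, in_range D (t - gen_tens a).
Proof.
elim/rtensor_ind: t => [|x m t [a ta]].
  by exists 0; apply: rangeB; [exact: range0|apply: D_ker; rewrite cov_gen].
exists (1 *: ((cov x : A) * m) + a).
apply: (range_subD (rtens_normal (erefl ((cov x : A) * m))) ta).
by have := gen_tens_linear 1 ((cov x : A) * m) a; rewrite (scale1r (gen_tens _)).
Qed.

Lemma cover_cokernel : (forall u, cover_class (D u) = 0) ->
  lmod_iso (homology D (\0 : {linear rtensor X N -> rtensor X N})) (commutator_quotient A).
Proof.
move=> D0; apply: (commutator_cokernel (h := mk_linear cover_class_linear)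
  gen_tens_linear gen_tens_commutator gen_tens_exists D0) => a.
by apply: etrans (cover_classE _ _) _; rewrite cov_gen mulr1.
Qed.
End Cover.

Lemma tor0_commutator_quotient : lmod_iso (tor Y N 0) (commutator_quotient A).
Proof.
have SP := std_res_proj Y.
have [gen cov_gen] := choice (@free_cover_surj E^c Y).
apply: (@cover_cokernel _ (free_cover Y) gen _ (tensor_in (std_res Y) N 0)) => //.
- by move=> x m /(proj_res_exact0 SP)[y <-]; exists (rtens y m); apply: rtensor_mapE.
have cL := linearD (mk_linear (cover_class_linear (free_cover Y))).
elim/rtensor_ind => [|y m x IHx].
  by rewrite linear0; apply: (linear0 (mk_linear (cover_class_linear (free_cover Y)))).
rewrite linearD [LHS]cL [X in _ + X]IHx addr0.
have -> : tensor_in (std_res Y) N 0 (rtens y m) = rtens (chain_d (std_res Y) 0 y) m.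
  exact: rtensor_mapE.
rewrite [LHS]cover_classE.
have -> : free_cover Y (chain_d (std_res Y) 0 y) = 0 by apply/(proj_res_exact0 SP); exists y.
by rewrite mul0r linear0.
Qed.
End Tor0.
End ExtremeDegrees.

(** * Nakayama automorphisms *)

Section Mapping.
Variables (k : fieldType) (A : algType k).
Local Notation E := (env A).

Section EnvMap.
Variable s : {lrmorphism A -> A}.

Definition env_map_fun (x : E) : E := vlift (fun (a : A) (b : A^c) => vtens (s a) b) x.
Lemma env_map_bilin : bilin (fun (a : A) (b : A^c) => vtens (s a) b : E).
Proof.
split=> [b|a]; last exact: (vtens_bilin _ _).2.
apply: (lin_comp ((vtens_bilin _ _).1 b)); exact: linearP.
Qed.
Lemma env_map_linear : linear env_map_fun.
Proof. exact/vlift_linear/env_map_bilin. Qed.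
Lemma env_mapE (a : A) (b : A^c) : env_map_fun (vtens a b) = vtens (s a) b.
Proof. exact: (bvliftE _ _ env_map_bilin). Qed.
Lemma env_map_monoid : monoid_morphism env_map_fun.
Proof.
have L := env_map_linear.
split=> [|x y].
  have -> : 1 = vtens 1 (1 : A^c) :> E by [].
  by rewrite env_mapE rmorph1.
elim/vtensor_ind: x => [|a b x IHx]; first by rewrite mul0r (lin0 L) mul0r.
rewrite mulrDl !(linD _ _ L) IHx mulrDl; congr (_ + _) => {x IHx}.
elim/vtensor_ind: y => [|a' b' y IHy]; first by rewrite mulr0 (lin0 L) mulr0.
rewrite mulrDr !(linD _ _ L) IHy mulrDr; congr (_ + _).
by rewrite !env_mapE !vtensM env_mapE rmorphM.
Qed.
HB.instance Definition _ := GRing.isLinear.Build k E E *:%R env_map_fun env_map_linear.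
HB.instance Definition _ := GRing.isMonoidMorphism.Build E E env_map_fun env_map_monoid.
Definition env_map : {lrmorphism E -> E} := env_map_fun.
End EnvMap.

Lemma env_mapK (s s' : {lrmorphism A -> A}) : cancel s s' -> cancel (env_map s) (env_map s').
Proof.
have L := env_map_linear s; have L' := env_map_linear s'.
move=> sK x; rewrite -[LHS]/(env_map_fun s' (env_map_fun s x)).
elim/vtensor_ind: x => [|a b x IHx]; first by rewrite (lin0 L) (lin0 L').
by rewrite (linD _ _ L) (linD _ _ L') IHx !env_mapE sK.
Qed.

Lemma inverse_lrmorphism (s : {lrmorphism A -> A}) : bijective s ->
  exists s' : {lrmorphism A -> A}, cancel s s' /\ cancel s' s.
Proof.
move=> [g sK gK]; have gL : linear g.
  by move=> a x y; apply: (can_inj sK); rewrite gK linearP /= !gK.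
have gM : monoid_morphism g.
  by split=> [|x y]; apply: (can_inj sK); rewrite gK ?rmorph1 // rmorphM /= !gK.
pose G : {lrmorphism A -> A} := HB.pack g
  (GRing.isLinear.Build k A A *:%R g gL) (GRing.isMonoidMorphism.Build A A g gM).
by exists G.
Qed.

Section TwistMap.
Variables (w f s1 t1 s2 t2 : {lrmorphism A -> A}).
Hypotheses (fs : forall a, f (s1 a) = s2 (w a)) (ft : forall b, f (t1 b) = t2 b).

(** An algebra endomorphism of A regarded as a map of twisted bimodules; [fs] and [ft] are the
    conditions that make it semilinear along [env_map w]. *)
Definition twist_map_fun (m : twist s1 t1) : twist s2 t2 := f m.
Lemma twist_map_additive : zmod_morphism twist_map_fun.
Proof. exact: (raddfB f). Qed.
HB.instance Definition _ := GRing.isZmodMorphism.Build (twist s1 t1) (twist s2 t2)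
  twist_map_fun twist_map_additive.
Definition twist_map : {additive twist s1 t1 -> twist s2 t2} := twist_map_fun.

Lemma twist_map_scale (r : E) (m : twist s1 t1) :
  twist_map (r *: m) = env_map w r *: twist_map m.
Proof.
have K : twist_map (twist_scale r m) = twist_scale (env_map_fun w r) (twist_map m).
  elim/vtensor_ind: r => [|a b r IHr].
    by rewrite (lin0 (env_map_linear w)) !twist_scale0l raddf0.
  rewrite (linD _ _ (env_map_linear w)) !twist_scaleDl raddfD IHr env_mapE !twist_scaleE.
  by congr (_ + _); rewrite /twist_map /= /twist_map_fun !rmorphM /= fs ft.
exact: K.
Qed.
End TwistMap.
End Mapping.

(** * Duality for Hopf algebras and the degree [d] *)

Section HopfResolution.
Variables (k : fieldType) (A : algType k) (H : hopf_algebra A) (d : nat).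
Local Notation triv := (trivial_module (counit H) : lmodType A).

Lemma trivial_fin_gen : fin_gen triv.
Proof.
exists [:: (1 : k) : triv] => x; exists (fun=> (x : k)%:A).
rewrite big_ord1 /= [RHS]/(trivial_scale _ _) /trivial_scale linearZ rmorph1 /= mulr1.
by rewrite [RHS]mulr1.
Qed.

Lemma hopf_bimod_resolution : left_noetherian A -> projdim_le triv d ->
  exists (P : chain (env A)) (e : {linear P 0%N -> bimod A}),
    [/\ proj_resolution e, forall i, dual_basis (P i) &
        forall i, (d < i)%N -> is_zero_module (P i)].
Proof.
move=> An pd.
have [P [e [eP Pb P0]]] :=
  dual_basis_resolution An trivial_fin_gen (projdim_syzygy pd).
have IPb i := induced_dual_basis H (Pb i).
exists (@Chain (env A) (fun n => induced H (P n)) (fun n => ind_map (chain_d P n))).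
exists (ind_counit H \o ind_map e); split.
- exact: induced_resolution eP (fun n => dual_basis_projective (IPb n)).
- exact: IPb.
- by move=> i /P0; apply: ind_zero.
Qed.
End HopfResolution.

Section NakayamaDuality.
Variables (k : fieldType) (A : algType k) (d : nat).
Variables (P : chain (env A)) (e : {linear P 0%N -> bimod A}).
Hypotheses (eP : proj_resolution e) (Pb : forall i, dual_basis (P i)).
Hypothesis P0 : forall i, (d < i)%N -> is_zero_module (P i).
Variables (nu nu' : {lrmorphism A -> A}).
Hypotheses (nuK : cancel nu nu') (nu'K : cancel nu' nu) (Anu : nakayama d nu).
Local Notation E := (env A).
Local Notation Y := (rbimod A : lmodType E^c).
Local Notation Ext := (ext (bimod A) (E^o : lmodType E) d).

(** Replacing a by nu'(a) turns the action b phi(x) nu(a) of the Nakayama isomorphism into b phi(x)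
    a, that of [rbimod]; this is why the dual is twisted by [env_map nu']. *)
Lemma nakayama_rbimod : exists phi : {additive Ext -> Y}, bijective phi /\
  forall (r : E) x, phi (ext_map (right_mul (env_map nu' r)) x) = (r : E^c) *: phi x.
Proof.
have [phi0 [bij phiE]] := nakayama_iso Anu.
have phiB : zmod_morphism (phi0 : Ext -> Y) by exact: (raddfB phi0).
pose phi : {additive Ext -> Y} :=
  HB.pack (phi0 : Ext -> Y) (GRing.isZmodMorphism.Build Ext Y phi0 phiB).
exists phi; split=> [|r x]; first exact: bij.
have L := env_map_linear nu'.
pose m r := phi (ext_map (right_mul (env_map_fun nu' r)) x).
have mD r1 r2 : m (r1 + r2) = m r1 + m r2.
  rewrite /m -raddfD; congr (phi _); apply: ext_mapD => n.
  by rewrite /= (linD _ _ L) mulrDr.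
have m0 : m 0 = 0 by apply: (addrI (m 0)); rewrite -mD !addr0.
have K : m r = rbimod_scale r (phi x).
  elim/vtensor_ind: r => [|a b r IHr]; first by rewrite m0 rbimod_scale0l.
  rewrite mD rbimod_scaleDl IHr; congr (_ + _).
  rewrite /m env_mapE rbimod_scaleE; apply: etrans (phiE _ (b : A) x) _.
  by rewrite nu'K.
exact: K.
Qed.

(** Leaving [f] free covers every presentation of a twist: an automorphism of A can move it from one
    side of the bimodule to the other. *)
Lemma nakayama_duality (s1 t1 s2 t2 f g : {lrmorphism A -> A}) i j :
    cancel f g -> cancel g f ->
    (forall a, f (s1 a) = s2 (nu' a)) -> (forall b, f (t1 b) = t2 b) -> (i + j)%N = d ->
  lmod_iso (hochschild_homology (twist s1 t1) j) (hochschild_cohomology (twist s2 t2) i).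
Proof.
move=> fK gK fs ft ij.
have [phi [phi_bij phi_scale]] := nakayama_rbimod.
pose t := twist_map f s1 t1 s2 t2; pose t' : twist s2 t2 -> twist s1 t1 := g.
have tK : cancel t t' by move=> x; apply: fK.
have t'K : cancel t' t by move=> x; apply: gK.
exact: (van_den_bergh_duality (env_mapK nu'K) (env_mapK nuK) eP Pb P0 phi_bij
  phi_scale (nakayama_vanish Anu) tK t'K
  (twist_map_scale fs ft) ij).
Qed.

Lemma homology_above (M : lmodType E) j : (d < j)%N -> is_zero_module (hochschild_homology M j).
Proof.
have [phi [phi_bij phi_scale]] := nakayama_rbimod.
exact: (tor_above (env_mapK nu'K) (env_mapK nuK) eP Pb P0 phi_bij
  phi_scale (nakayama_vanish Anu)).
Qed.

Lemma cohomology_above (M : lmodType E) j : (d < j)%N -> is_zero_module (hochschild_cohomology M j).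
Proof. exact: (ext_above eP P0). Qed.

Lemma homology_top :
  lmod_iso (hochschild_homology (twist idfun nu) d) (center A).
Proof.
apply: lmod_iso_trans (lmod_iso_sym (ext0_center A)).
(* The map [nu'] identifies A^nu with A semilinearly: it cancels [nu] on the right and produces the
   required [nu'] on the left. *)
exact: (@nakayama_duality idfun nu idfun idfun nu' nu 0 d).
Qed.

(** The twisted dimension admits twists on the left only, so nu on the right is traded for its
    inverse on the left. *)
Lemma homology_top_twist :
  lmod_iso (hochschild_homology (twist nu' idfun) d) (center A).
Proof.
apply: lmod_iso_trans (lmod_iso_sym (ext0_center A)).
exact: (@nakayama_duality nu' idfun idfun idfun idfun idfun 0 d).
Qed.

Lemma cohomology_top :
  lmod_iso (hochschild_cohomology (twist nu idfun) d) (commutator_quotient A).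
Proof.
apply: lmod_iso_trans (tor0_commutator_quotient A); apply: lmod_iso_sym.
(* The identity map serves here, as [nu] on the target cancels the [nu'] that the duality
   introduces. *)
apply: (@nakayama_duality idfun idfun nu idfun idfun idfun d 0) => //.
exact: addn0.
Qed.
End NakayamaDuality.

Lemma center_neq0 (k : fieldType) (A : algType k) : ~ is_zero_module (center A).
Proof.
have C1 : 1 \in is_central (A := A) by apply/asboolP => a; rewrite mul1r mulr1.
by move=> /(_ (Submod C1))/(congr1 val)/= /eqP; rewrite oner_eq0.
Qed.

(** An algebra morphism to the commutative field [k] kills all commutators but sends 1 to 1. *)
Lemma commutator_quotient_neq0 (k : fieldType) (A : algType k) (eps : {lrmorphism A -> k^o}) :
  ~ is_zero_module (commutator_quotient A).
Proof.
move=> /(_ (quot_pi _ 1)); rewrite -[RHS](linear0 (quot_pi (@is_commutator_sum k A))).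
move=> /quot_piP/asboolP[s]; rewrite subr0 => /(congr1 eps).
rewrite rmorph1 linear_sum big1 => [/eqP|p _]; first by rewrite oner_eq0.
by rewrite linearZ rmorphB !rmorphM /= [X in X - _]mulrC subrr scaler0.
Qed.

Theorem theorem0p4 (k : closedFieldType) (A : algType k) (H : hopf_algebra A)
    (d : nat) (nu : {lrmorphism A -> A})
    (antipode_bij : bijective (antipode H))
    (AS_A : as_gorenstein (counit H) d)
    (gldim_A : gldim_eq A d)
    (nakayama_nu : nakayama d nu) :
  [/\ lmod_iso (hochschild_homology (twist idfun nu) d) (center A),
      ~ is_zero_module (center A) &
      twisted_hochschild_dim_eq A d] /\
  [/\ lmod_iso (hochschild_cohomology (twist nu idfun) d) (commutator_quotient A),
      ~ is_zero_module (commutator_quotient A) &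
      twisted_hochschild_codim_eq A d].
Proof.
have [[An _] _ _] := AS_A.
have [P [e [eP Pb P0]]] := hopf_bimod_resolution An (gldim_A.1 (trivial_module (counit H))).
have [nu' [nuK nu'K]] := inverse_lrmorphism (nakayama_bij nakayama_nu).
have C0 := @center_neq0 k A; have Q0 := commutator_quotient_neq0 (counit H).
have hC := homology_top eP Pb P0 nuK nu'K nakayama_nu.
have hQ := cohomology_top eP Pb P0 nuK nu'K nakayama_nu.
split; split=> //; split.
(* The witness is the inverse of [nu], because the twist sits on the left. *)
- exists nu'; split=> [|Z]; first by exists nu.
  apply/C0/(lmod_iso_zero (lmod_iso_sym (homology_top_twist eP Pb P0 nuK nu'K nakayama_nu)) Z).
- move=> i s _ Z; rewrite leqNgt; apply/negP => di; apply: Z.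
  exact: (homology_above eP Pb P0 nuK nu'K nakayama_nu) di.
- exists nu; split=> [|Z]; first exact: nakayama_bij nakayama_nu.
  exact: Q0 (lmod_iso_zero (lmod_iso_sym hQ) Z).
- move=> i s _ Z; rewrite leqNgt; apply/negP => di; apply: Z.
  exact: (cohomology_above eP P0) di.
Qed.
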